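(* Let $\mathsf{K}$ be a subvariety of $\mathsf{KG}$. The following are equivalent: (i) $\mathsf{K}$ has the ES property; (ii) $\mathsf{K}$ contains no algebra isomorphic to a sum $\sum\mathbf{A}_n$ of a family $\{\mathbf{A}_n:n\in\omega\}$ of Heyting algebras with $\mathbf{A}_n\in\{\boldsymbol{D}_2^{\ast},\boldsymbol{X}_2^{\ast}\}$ for every $n$; (iii) there is a positive integer $n$ such that $\mathsf{K}$ contains no algebra isomorphic to a sum $\mathbf{A}_1+\dots+\mathbf{A}_n+\mathbf{2}$ with $\mathbf{A}_i\in\{\boldsymbol{D}_2^\ast,\boldsymbol{X}_2^\ast\}$ for every $i\leq n$.
   Context: Heyting algebras are algebras $\langle A;\wedge,\vee,\to,0,1\rangle$. A homomorphism $f\colon\mathbf{A}\to\mathbf{B}$ in a variety $\mathsf{K}$ is an epimorphism if for all $\mathbf{C}\in\mathsf{K}$ and homomorphisms $g,h\colon\mathbf{B}\to\mathbf{C}$, $g\circ f=h\circ f$ implies $g=h$; $\mathsf{K}$ has the ES property if all its epimorphisms are surjective. Sums: for Heyting algebras $\mathbf{A},\mathbf{B}$ (disjoint universes), $\mathbf{A}+\mathbf{B}$ is the Heyting algebra with universe $(A\smallsetminus\{0^{\mathbf{A}}\})\cup B$ obtained by placing $\mathbf{B}$ below $\mathbf{A}$, identifying the top of $\mathbf{B}$ with the bottom of $\mathbf{A}$: $b\leq a$ iff both in $A$ and $b\leq^{\mathbf{A}}a$, or both in $B$ and $b\leq^{\mathbf{B}}a$, or $b\in B$ and $a\in A$. This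 is associative, and $\mathbf{A}_1+\dots+\mathbf{A}_n$ has $\mathbf{A}_1$ on top. For a family $\{\mathbf{A}_n:n\in\omega\}$ with disjoint universes and a fresh element $\bot$, $\sum\mathbf{A}_n$ is the Heyting algebra with universe $\{\bot\}\cup\bigcup_n(A_n\smallsetminus\{0^{\mathbf{A}_n}\})$ and order: $a\leq b$ iff $a=\bot$, or $a,b\in A_n$ with $a\leq^{\mathbf{A}_n}b$, or $a\in A_n$, $b\in A_m$ with $n>m$. $\mathbf{2}$ is the two-element Boolean algebra; $\boldsymbol{D}_2^\ast$ is the four-element Boolean algebra; $\boldsymbol{X}_2^\ast$ is the Heyting algebra of all upsets of the four-element poset $\{a_1,a_2,b_1,b_2\}$ whose only strict order relations are $a_1<b_2$, $a_2<b_1$, $a_2<b_2$. $\boldsymbol{RN}$ is the free one-generated Heyting algebra (Rieger–Nishimura lattice); a Heyting algebra is one-generated iff it is a homomorphic image of $\boldsymbol{RN}$. The Kuznetsov–Gerčiu variety $\mathsf{KG}$ is the variety generated by all finite sums $\mathbf{A}_1+\dots+\mathbf{A}_n$ ($n\geq1$) of one-generated Heyting algebras. *)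

(* Defs.v *)
From HB Require Import structures.
From mathcomp Require Import all_boot all_order.
From mathcomp Require Import boolp classical_sets.

Set Implicit Arguments.
Unset Strict Implicit.
Unset Printing Implicit Defensive.

Import Order.Theory.
Local Open Scope order_scope.

#[key="T"]
HB.mixin Record TBDistrLattice_isHeyting d T of Order.TBDistrLattice d T := {
  himp : T -> T -> T;
  le_himp : forall x y z : T, (x <= himp y z) = (Order.meet x y <= z)
}.

#[short(type="heytingType")]
HB.structure Definition Heyting d :=
  { T of TBDistrLattice_isHeyting d T & Order.TBDistrLattice d T }.

(* The display is only a printing tag: fixing one makes all Heyting algebras
   inhabit a single type, so that classes of algebras are predicates on it.
   The one-element algebra is included. *)
Fact heyting_display : Order.disp_t. Proof. exact: Order.Disp tt tt. Qed.

Notation heyting := (heytingType heyting_display).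

Section Homomorphisms.
Context (A B : heyting).

Record heyting_hom (f : A -> B) : Prop := HeytingHom {
  hom_meet : {morph f : x y / x `&` y};
  hom_join : {morph f : x y / x `|` y};
  hom_imp : {morph f : x y / himp x y};
  hom_bot : f \bot = \bot;
  hom_top : f \top = \top
}.

Definition isomorphic := exists f : A -> B, heyting_hom f /\ bijective f.

End Homomorphisms.

Record subuniverse (A : heyting) (S : A -> Prop) : Prop := Subuniverse {
  sub_meet : forall x y, S x -> S y -> S (x `&` y);
  sub_join : forall x y, S x -> S y -> S (x `|` y);
  sub_imp : forall x y, S x -> S y -> S (himp x y);
  sub_bot : S \bot;
  sub_top : S \top
}.

Definition one_generated (A : heyting) :=
  exists a : A, forall S : A -> Prop, subuniverse S -> S a -> forall x, S x.

Inductive term : Type :=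
  | Var of nat
  | Meet of term & term
  | Join of term & term
  | Imp of term & term
  | Bot
  | Top.

Fixpoint eval (A : heyting) (v : nat -> A) (t : term) : A :=
  match t with
  | Var i => v i
  | Meet s t => eval v s `&` eval v t
  | Join s t => eval v s `|` eval v t
  | Imp s t => himp (eval v s) (eval v t)
  | Bot => \bot
  | Top => \top
  end.

Definition models (E : term -> term -> Prop) (A : heyting) :=
  forall s t, E s t -> forall v : nat -> A, eval v s = eval v t.

Definition variety (K : heyting -> Prop) :=
  exists E : term -> term -> Prop, forall A, K A <-> models E A.

Definition subclass (K L : heyting -> Prop) := forall A, K A -> L A.

Definition generated_variety (S : heyting -> Prop) (A : heyting) :=
  forall K : heyting -> Prop, variety K -> subclass S K -> K A.

Definition epimorphism (K : heyting -> Prop) (A B : heyting) (f : A -> B) :=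
  forall (C : heyting) (g h : B -> C), K C -> heyting_hom g -> heyting_hom h ->
    g \o f =1 h \o f -> g =1 h.

Definition ES_property (K : heyting -> Prop) :=
  forall (A B : heyting) (f : A -> B), K A -> K B -> heyting_hom f ->
    epimorphism K f -> forall b, exists a, f a = b.

(* The operations of a Heyting algebra are determined by its order; it is
   enough to show that the required infima, suprema and residuals exist. *)
Record heyting_order (T : Type) := HeytingOrder {
  ho_le : T -> T -> Prop;
  ho_refl : forall x, ho_le x x;
  ho_anti : forall x y, ho_le x y -> ho_le y x -> x = y;
  ho_trans : forall y x z, ho_le x y -> ho_le y z -> ho_le x z;
  ho_bot : exists b, forall x, ho_le b x;
  ho_top : exists t, forall x, ho_le x t;
  ho_meet : forall x y, exists m, forall z, ho_le z m <-> ho_le z x /\ ho_le z y;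
  ho_join : forall x y, exists j, forall z, ho_le j z <-> ho_le x z /\ ho_le y z;
  ho_imp : forall x y, exists i, forall z,
    ho_le z i <-> forall w, ho_le w z -> ho_le w x -> ho_le w y
}.

Definition order_carrier (T : Type) (h : heyting_order T) : Type := T.

Section HeytingOfOrder.
Context (T : Type) (h : heyting_order T).
Local Notation C := (order_carrier h).

HB.instance Definition _ := gen_eqMixin C.
HB.instance Definition _ := gen_choiceMixin C.

Definition order_leb (x y : C) : bool := `[< ho_le h x y >].

Fact order_leb_refl : reflexive order_leb.
Proof. by move=> x; apply/asboolP/ho_refl. Qed.

Fact order_leb_anti : antisymmetric order_leb.
Proof. by move=> x y /andP[/asboolP xy /asboolP yx]; exact: ho_anti xy yx. Qed.

Fact order_leb_trans : transitive order_leb.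
Proof.
by move=> y x z /asboolP xy /asboolP yz; apply/asboolP; exact: ho_trans xy yz.
Qed.

HB.instance Definition _ := Order.Le_isPOrder.Build heyting_display C
  order_leb_refl order_leb_anti order_leb_trans.

Definition order_meet (x y : C) : C := sval (cid (ho_meet h x y)).
Definition order_join (x y : C) : C := sval (cid (ho_join h x y)).
Definition order_imp (x y : C) : C := sval (cid (ho_imp h x y)).
Definition order_bot : C := sval (cid (ho_bot h)).
Definition order_top : C := sval (cid (ho_top h)).

Fact order_lexI (x y z : C) : (x <= order_meet y z) = (x <= y) && (x <= z).
Proof.
rewrite /order_meet; case: cid => m /= mP; apply/asboolP/andP.
  by move=> /mP[? ?]; split; apply/asboolP.
by move=> [/asboolP ? /asboolP ?]; apply/mP.
Qed.

Fact order_leUx (x y z : C) : (order_join x y <= z) = (x <= z) && (y <= z).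
Proof.
rewrite /order_join; case: cid => m /= mP; apply/asboolP/andP.
  by move=> /mP[? ?]; split; apply/asboolP.
by move=> [/asboolP ? /asboolP ?]; apply/mP.
Qed.

HB.instance Definition _ :=
  Order.POrder_MeetJoin_isLattice.Build heyting_display C order_lexI order_leUx.

Fact order_leP (x y : C) : reflect (ho_le h x y) (x <= y).
Proof. exact: asboolP. Qed.

Fact order_le_imp (x y z : C) : (x <= order_imp y z) = (x `&` y <= z).
Proof.
rewrite /order_imp; case: cid => m /= mP; apply/order_leP/order_leP.
  by move=> /mP xm; apply/xm; apply/order_leP; [exact: leIl|exact: leIr].
move=> /order_leP xyz; apply/mP => w /order_leP wx /order_leP wy.
by apply/order_leP; apply: le_trans xyz; rewrite lexI; apply/andP.
Qed.

Fact order_meetUl : left_distributive (@Order.meet _ C) (@Order.join _ C).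
Proof.
move=> x y z; apply: le_anti; apply/andP; split; last first.
  by rewrite leUx !leI2 ?leUl ?leUr.
by rewrite -order_le_imp leUx !order_le_imp leUl leUr.
Qed.

HB.instance Definition _ :=
  Order.Lattice_Meet_isDistrLattice.Build heyting_display C order_meetUl.

Fact order_le0x (x : C) : order_bot <= x.
Proof. by rewrite /order_bot; case: cid => b bP; apply/asboolP/bP. Qed.

Fact order_lex1 (x : C) : x <= order_top.
Proof. by rewrite /order_top; case: cid => b bP; apply/asboolP/bP. Qed.

HB.instance Definition _ := Order.hasBottom.Build heyting_display C order_le0x.
HB.instance Definition _ := Order.hasTop.Build heyting_display C order_lex1.
HB.instance Definition _ :=
  TBDistrLattice_isHeyting.Build heyting_display C order_le_imp.

Definition heyting_of_order : heyting := C.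

End HeytingOfOrder.

Section BooleanAlgebra.
Context (d : Order.disp_t) (B : ctbDistrLatticeType d).

Lemma boolean_meet (x y : B) :
  exists m, forall z, z <= m <-> z <= x /\ z <= y.
Proof. by exists (x `&` y) => z; rewrite lexI; split=> /andP. Qed.

Lemma boolean_join (x y : B) :
  exists j, forall z, j <= z <-> x <= z /\ y <= z.
Proof. by exists (x `|` y) => z; rewrite leUx; split=> /andP. Qed.

Lemma boolean_imp (x y : B) :
  exists i, forall z, z <= i <-> forall w, w <= z -> w <= x -> w <= y.
Proof.
exists (~` x `|` y) => z; split=> [zi w wz wx|H].
  have: w <= x `&` (~` x `|` y) by rewrite lexI wx (le_trans wz zi).
  by rewrite meetUr meetxC join0x lexI => /andP[].
have/(_ (leIl _ _) (leIr _ _)) zxy := H (z `&` x).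
rewrite -[z]meetx1 -(joinxC x) meetUr leUx.
by rewrite (le_trans zxy (leUr _ _)) (le_trans (leIr _ _) (leUl _ _)).
Qed.

Definition boolean_heyting : heyting :=
  heyting_of_order (@HeytingOrder B (fun x y => x <= y) (@lexx _ B)
    (fun x y xy yx => le_anti (introT andP (conj xy yx))) (@le_trans _ B)
    (ex_intro _ \bot (@le0x _ B)) (ex_intro _ \top (@lex1 _ B))
    boolean_meet boolean_join boolean_imp).

End BooleanAlgebra.

Definition two : heyting := boolean_heyting bool.
Definition D2 : heyting := boolean_heyting (bool *p bool)%type.

Section Upsets.
Context (d : Order.disp_t) (P : porderType d).
Local Open Scope classical_set_scope.

Definition upset (U : set P) := forall x y, U x -> x <= y -> U y.

Definition upsets : Type := {U : set P | upset U}.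

Definition upset_le (U V : upsets) := sval U `<=` sval V.

Lemma upset_anti U V : upset_le U V -> upset_le V U -> U = V.
Proof.
case: U V => [U hU] [V hV] UV VU; apply: eq_exist => /=.
by apply/seteqP; split.
Qed.

Lemma upset_bot : exists U, forall V, upset_le U V.
Proof. by have h : upset set0 by []; exists (exist _ _ h) => V x []. Qed.

Lemma upset_top : exists U, forall V, upset_le V U.
Proof. by have h : upset setT by []; exists (exist _ _ h) => V x. Qed.

Lemma upset_meet U V :
  exists M, forall W, upset_le W M <-> upset_le W U /\ upset_le W V.
Proof.
have h : upset (sval U `&` sval V).
  by move=> x y [Ux Vx] xy; split; [exact: svalP U _ _ Ux xy|exact: svalP V _ _ Vx xy].
by exists (exist _ _ h) => W; rewrite /upset_le /= subsetI.
Qed.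

Lemma upset_join U V :
  exists M, forall W, upset_le M W <-> upset_le U W /\ upset_le V W.
Proof.
have h : upset (sval U `|` sval V).
  move=> x y [Ux|Vx] xy; first by left; exact: svalP U _ _ Ux xy.
  by right; exact: svalP V _ _ Vx xy.
by exists (exist _ _ h) => W; rewrite /upset_le /= subUset.
Qed.

Lemma upset_imp U V : exists M, forall W,
  upset_le W M <-> forall X, upset_le X W -> upset_le X U -> upset_le X V.
Proof.
have h : upset [set x | forall y, x <= y -> sval U y -> sval V y].
  by move=> x y Mx xy z yz; apply: Mx; exact: le_trans xy yz.
exists (exist _ _ h) => W; split=> [WM X XW XU x Xx|H x Wx y xy Uy].
  exact: WM (XW _ Xx) _ (lexx _) (XU _ Xx).
have hx : upset [set z | y <= z] by move=> z t yz; exact: le_trans.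
apply: (H (exist _ _ hx)) (lexx y) => z /= yz; last exact: svalP U _ _ Uy yz.
exact: svalP W _ _ Wx (le_trans xy yz).
Qed.

Definition upset_heyting : heyting :=
  heyting_of_order (@HeytingOrder upsets upset_le (fun _ _ => id) upset_anti
    (fun V U W UV VW x Ux => VW x (UV x Ux)) upset_bot upset_top
    upset_meet upset_join upset_imp).

End Upsets.

Inductive X2_point := X2a1 | X2a2 | X2b1 | X2b2.

HB.instance Definition _ := gen_eqMixin X2_point.
HB.instance Definition _ := gen_choiceMixin X2_point.

Definition X2_le (x y : X2_point) : bool :=
  match x, y with
  | X2a1, X2a1 | X2a2, X2a2 | X2b1, X2b1 | X2b2, X2b2 => true
  | X2a1, X2b2 | X2a2, X2b1 | X2a2, X2b2 => true
  | _, _ => false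
  end.

Fact X2_le_refl : reflexive X2_le. Proof. by case. Qed.
Fact X2_le_anti : antisymmetric X2_le. Proof. by do 2 case. Qed.
Fact X2_le_trans : transitive X2_le. Proof. by do 3 case. Qed.

HB.instance Definition _ := Order.Le_isPOrder.Build (Order.Disp tt tt) X2_point
  X2_le_refl X2_le_anti X2_le_trans.

Definition X2 : heyting := upset_heyting X2_point.

Definition nonbot (A : heyting) : Type := {a : A | a != \bot}.

Definition mk_nonbot (A : heyting) (a : A) (a0 : a != \bot) : nonbot A :=
  exist _ a a0.

Section BinarySum.
Context (A B : heyting).

Definition sum_carrier : Type := (nonbot A + B)%type.

Definition sum_le (x y : sum_carrier) : Prop :=
  match x, y with
  | inl a, inl a' => val a <= val a'
  | inr b, inr b' => b <= b'
  | inr _, inl _ => True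
  | inl _, inr _ => False
  end.

(* The image of A in the sum: the bottom of A is identified with the top of B. *)
Definition sum_emb (a : A) : sum_carrier := oapp inl (inr \top) (insub a).

Lemma sum_embE (a : nonbot A) : sum_emb (val a) = inl a.
Proof. by rewrite /sum_emb valK. Qed.

Lemma sum_emb_inl (u : nonbot A) a : sum_le (inl u) (sum_emb a) <-> val u <= a.
Proof.
rewrite /sum_emb; case: insubP => [v _ <- //|/negPn/eqP->] /=.
by rewrite lex0 (negPf (valP u)).
Qed.

Lemma sum_emb_inr b a : sum_le (inr b) (sum_emb a).
Proof. by rewrite /sum_emb; case: insubP => //= _; exact: lex1. Qed.

Lemma sum_refl x : sum_le x x. Proof. by case: x => a /=. Qed.

Lemma sum_anti x y : sum_le x y -> sum_le y x -> x = y.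
Proof.
case: x y => [a|b] [a'|b'] //= h h'; congr (_ _); last by apply: le_anti; rewrite h.
by apply/val_inj/le_anti; rewrite h.
Qed.

Lemma sum_trans y x z : sum_le x y -> sum_le y z -> sum_le x z.
Proof. by case: x y z => [x|x] [y|y] [z|z] //=; apply: le_trans. Qed.

Lemma sum_bot : exists b, forall x, sum_le b x.
Proof. by exists (inr \bot) => -[a|b] //=; exact: le0x. Qed.

Lemma sum_top : exists t, forall x, sum_le x t.
Proof.
exists (sum_emb \top) => -[a|b]; last exact: sum_emb_inr.
by apply/sum_emb_inl; exact: lex1.
Qed.

Lemma sum_meet x y : exists m, forall z, sum_le z m <-> sum_le z x /\ sum_le z y.
Proof.
case: x y => [a|b] [a'|b'].
- exists (sum_emb (val a `&` val a')) => -[u|v].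
    by rewrite sum_emb_inl lexI; split=> /andP.
  by split=> // _; exact: sum_emb_inr.
- by exists (inr b') => -[u|v] /=; split=> // -[].
- by exists (inr b) => -[u|v] /=; split=> // -[].
- exists (inr (b `&` b')) => -[u|v] /=; first by split=> // -[].
  by rewrite lexI; split=> /andP.
Qed.

Lemma sum_join x y : exists j, forall z, sum_le j z <-> sum_le x z /\ sum_le y z.
Proof.
case: x y => [a|b] [a'|b'].
- have h : val a `|` val a' != \bot.
    by apply: contraNneq (valP a) => e; have := leUl (val a) (val a'); rewrite e lex0.
  exists (inl (mk_nonbot h)) => -[u|v] /=; last by split=> // -[].
  by rewrite leUx; split=> /andP.
- by exists (inl a) => -[u|v] /=; split=> // -[].
- by exists (inl a') => -[u|v] /=; split=> // -[].
- exists (inr (b `|` b')) => -[u|v] /=; first by split.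
  by rewrite leUx; split=> /andP.
Qed.

Lemma sum_imp x y : exists i, forall z,
  sum_le z i <-> forall w, sum_le w z -> sum_le w x -> sum_le w y.
Proof.
case: (pselect (sum_le x y)) => [xy|].
  have [t tP] := sum_top; exists t => z; split=> // _ w _ wx.
  exact: sum_trans wx xy.
case: x y => [a|b] [a'|b'] //= nle.
- exists (sum_emb (himp (val a) (val a'))) => -[u|v]; last first.
    by split=> [_ [w|w] //|_]; exact: sum_emb_inr.
  rewrite sum_emb_inl le_himp; split=> [h [w|w] //= wu wa|H].
    by apply: le_trans h; rewrite lexI wu.
  have [e|ne] := eqVneq (val u `&` val a) \bot; first by rewrite e le0x.
  exact: (H (inl (mk_nonbot ne))) (leIl _ _) (leIr _ _).
- have [->|b'1] := eqVneq b' \top.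
    exists (sum_emb (himp (val a) \bot)) => -[u|v]; last first.
      by split=> [_ [w|w] //=|_]; exact: sum_emb_inr.
    rewrite sum_emb_inl le_himp lex0; split=> [/eqP e [w|w] //= wu wa|H].
      have : val w <= val u `&` val a by rewrite lexI wu.
      by rewrite e lex0 (negPf (valP w)).
    by apply: contrapT => /negP ne; exact: (H (inl (mk_nonbot ne))) (leIl _ _) (leIr _ _).
  exists (inr b') => -[u|v] /=.
    split=> // H; have /= := H (inr \top) I I.
    by rewrite le1x (negPf b'1).
  split=> [vb' [w|w] //= wv _|H]; first exact: le_trans wv vb'.
  exact: (H (inr v) (lexx _) I).
- exists (inr (himp b b')) => -[u|v] /=.
    by split=> // H; case: nle; exact: (H (inr b) I (lexx _)).
  rewrite le_himp; split=> [h [w|w] //= wv wb|H].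
    by apply: le_trans h; rewrite lexI wv.
  exact: (H (inr (v `&` b))) (leIl _ _) (leIr _ _).
Qed.

Definition hsum : heyting :=
  heyting_of_order (HeytingOrder sum_refl sum_anti sum_trans sum_bot sum_top
    sum_meet sum_join sum_imp).

End BinarySum.

Section InfiniteSum.
Context (A : nat -> heyting).

(* None is the fresh bottom element. *)
Definition osum_carrier : Type := option {n : nat & nonbot (A n)}.

Definition in_layer n (a : nonbot (A n)) : osum_carrier :=
  Some (existT (fun n => nonbot (A n)) n a).

Inductive osum_le : osum_carrier -> osum_carrier -> Prop :=
  | osum_le_bot y : osum_le None y
  | osum_le_layer n (a b : nonbot (A n)) :
      val a <= val b -> osum_le (in_layer a) (in_layer b)
  | osum_le_below n m (a : nonbot (A n)) (b : nonbot (A m)) :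
      (m < n)%N -> osum_le (in_layer a) (in_layer b).

Lemma osum_le_None x : osum_le x None -> x = None.
Proof. by move=> h; inversion h. Qed.

Lemma osum_le_inv n m (a : nonbot (A n)) (b : nonbot (A m)) :
  osum_le (in_layer a) (in_layer b) ->
  (m < n)%N \/ exists e : n = m, val (eq_rect n (fun k => nonbot (A k)) a m e) <= val b.
Proof.
move=> h; inversion h as [|k u v uv [en eu] [em ev]|]; last by left.
subst k; subst m; right; exists erefl => /=.
by rewrite -(eq_from_Tagged eu).
Qed.

Lemma osum_leE n (a b : nonbot (A n)) :
  osum_le (in_layer a) (in_layer b) <-> val a <= val b.
Proof.
split=> [/osum_le_inv[|[e]]|]; last exact: osum_le_layer.
  by rewrite ltnn.
by rewrite (Prop_irrelevance e erefl).
Qed.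

Lemma osum_le_lt n m (a : nonbot (A n)) (b : nonbot (A m)) :
  n <> m -> osum_le (in_layer a) (in_layer b) <-> (m < n)%N.
Proof.
by move=> nm; split=> [/osum_le_inv[//|[e]]|]; last exact: osum_le_below.
Qed.

Lemma osum_refl x : osum_le x x.
Proof. by case: x => [[n a]|]; constructor. Qed.

Lemma osum_anti x y : osum_le x y -> osum_le y x -> x = y.
Proof.
case: x y => [[n a]|] [[m b]|] //; try by move=> h h'; inversion h; inversion h'.
have [e|/eqP nm] := eqVneq n m.
  subst m; move=> /osum_leE ab /osum_leE ba.
  by rewrite (_ : a = b) //; apply/val_inj/le_anti; rewrite ab.
move=> /(osum_le_lt _ _ nm) h /(osum_le_lt _ _ (nesym nm)) h'.
by move: (ltn_trans h h'); rewrite ltnn.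
Qed.

Lemma osum_trans y x z : osum_le x y -> osum_le y z -> osum_le x z.
Proof.
case: x => [[n a]|]; last by constructor.
case: y => [[m b]|]; last by move=> h; inversion h.
case: z => [[k c]|]; last by move=> _ h; inversion h.
move=> /osum_le_inv[mn|[e ab]] /osum_le_inv[km|[e' bc]]; subst.
- by apply: osum_le_below; exact: ltn_trans km mn.
- exact: osum_le_below.
- exact: osum_le_below.
- by apply: osum_le_layer; exact: le_trans ab bc.
Qed.

Lemma osum_bot : exists b, forall x, osum_le b x.
Proof. by exists None; exact: osum_le_bot. Qed.

Definition below n (x : osum_carrier) :=
  if x is Some (existT m _) then (n <= m)%N else true.

Lemma below_le n x y : osum_le x y -> below n y -> below n x.
Proof.
case: x => [[m a]|] //; case: y => [[k b]|]; last by move=> h; inversion h.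
by move=> /osum_le_inv[km|[e _]] /= nk; [exact: leq_trans nk (ltnW km)|subst].
Qed.

(* The greatest element among those lying in layers of index at least n. *)
Lemma osum_below_top n :
  exists t, below n t /\ forall x, below n x -> osum_le x t.
Proof.
have [ex|nex] := pselect (exists m, `[< (n <= m)%N /\ exists a : A m, a != \bot >]).
  case: (ex_minnP ex) => m /asboolP[nm [a a0]] mmin.
  have h : (\top : A m) != \bot.
    by apply: contraNneq a0 => e; rewrite -lex0 -e lex1.
  exists (in_layer (mk_nonbot h)); split=> // -[[k b]|] /=; last by constructor.
  move=> nk; have [e|/eqP km] := eqVneq k m.
    by subst k; apply/osum_leE; exact: lex1.
  apply: osum_le_below; rewrite ltn_neqAle; apply/andP; split; first exact/eqP/nesym.
  by apply: mmin; apply/asboolP; split=> //; exists (val b); exact: valP b.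
exists None; split=> // -[[k b]|] nk; last by constructor.
by case: nex; exists k; apply/asboolP; split=> //; exists (val b); exact: valP b.
Qed.

Lemma osum_top : exists t, forall x, osum_le x t.
Proof.
have [t [_ tP]] := osum_below_top 0.
by exists t => x; apply: tP; case: x => [[]|].
Qed.

Lemma osum_below_layer n (a : nonbot (A n)) x : below n.+1 x -> osum_le x (in_layer a).
Proof. by case: x => [[m b]|] /= h; constructor. Qed.

Lemma osum_not_below n (u : nonbot (A n)) x : below n.+1 x -> ~ osum_le (in_layer u) x.
Proof.
by case: x => [[m b]|] /= h h'; [have /= := below_le h' h; rewrite ltnn|inversion h'].
Qed.

Variant layer_spec n : osum_carrier -> Prop :=
  | LayerAbove m (a : nonbot (A m)) of (m < n)%N : layer_spec n (in_layer a)
  | LayerIn (a : nonbot (A n)) : layer_spec n (in_layer a)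
  | LayerBelow x of below n.+1 x : layer_spec n x.

Lemma layerP n x : layer_spec n x.
Proof.
case: x => [[m a]|]; last exact: LayerBelow.
case: (ltngtP m n) => [mn|nm|e]; first exact: LayerAbove.
  exact: LayerBelow.
by subst; exact: LayerIn.
Qed.

(* Every element a of layer n, including its bottom, is represented in the sum. *)
Lemma osum_emb n (a : A n) : exists e : osum_carrier,
  [/\ forall u : nonbot (A n), osum_le (in_layer u) e <-> val u <= a,
      forall x, below n.+1 x -> osum_le x e & below n e].
Proof.
have [->|a0] := eqVneq a \bot.
  have [t [tn tP]] := osum_below_top n.+1; exists t; split=> //.
    move=> u; rewrite lex0 (negPf (valP u)); split=> // /osum_not_below.
    by move/(_ tn).
  by case: t tn {tP} => [[m b]|] //= /ltnW.
exists (in_layer (mk_nonbot a0)); split=> [u|x|] /=.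
- by rewrite osum_leE.
- exact: osum_below_layer.
- exact: leqnn.
Qed.

Lemma osum_above n m (a : nonbot (A m)) x :
  (m < n)%N -> below n x -> ~ osum_le (in_layer a) x.
Proof. by move=> mn xn /below_le/(_ xn) /=; rewrite leqNgt mn. Qed.

Lemma osum_meet x y : exists m, forall z, osum_le z m <-> osum_le z x /\ osum_le z y.
Proof.
have [xy|nxy] := pselect (osum_le x y).
  by exists x => z; split=> [zx|[]//]; split=> //; exact: osum_trans zx xy.
have [yx|nyx] := pselect (osum_le y x).
  by exists y => z; split=> [zy|[]//]; split=> //; exact: osum_trans zy yx.
case: x y nxy nyx => [[n a]|] [[m b]|] nxy nyx;
  try by [case: nxy; constructor | case: nyx; constructor].
case: (ltngtP m n) => [mn|nm|e].
- by case: nxy; constructor.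
- by case: nyx; constructor.
subst m; have [e [eu ex en]] := osum_emb (val a `&` val b).
exists e => z; case: (layerP n z) => [m c mn|u|{}z zn].
- split=> [/(osum_above mn en)//|[h _]].
  by case: (osum_above mn _ h); exact: leqnn.
- by rewrite eu !osum_leE lexI; split=> /andP.
- by split=> [_|_]; [split; exact: osum_below_layer|exact: ex].
Qed.

Lemma osum_join x y : exists j, forall z, osum_le j z <-> osum_le x z /\ osum_le y z.
Proof.
have [xy|nxy] := pselect (osum_le x y).
  by exists y => z; split=> [yz|[]//]; split=> //; exact: osum_trans xy yz.
have [yx|nyx] := pselect (osum_le y x).
  by exists x => z; split=> [xz|[]//]; split=> //; exact: osum_trans yx xz.
case: x y nxy nyx => [[n a]|] [[m b]|] nxy nyx;
  try by [case: nxy; constructor | case: nyx; constructor].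
case: (ltngtP m n) => [mn|nm|e].
- by case: nxy; constructor.
- by case: nyx; constructor.
subst m; have h : val a `|` val b != \bot.
  by apply: contraNneq (valP a) => e; have := leUl (val a) (val b); rewrite e lex0.
exists (in_layer (mk_nonbot h)) => z.
case: (layerP n z) => [m c mn|u|{}z zn].
- by split=> // _; [split|]; constructor.
- by rewrite !osum_leE leUx; split=> /andP.
- by split=> [/(osum_not_below zn)//|[/(osum_not_below zn)//]].
Qed.

Lemma osum_imp x y : exists i, forall z,
  osum_le z i <-> forall w, osum_le w z -> osum_le w x -> osum_le w y.
Proof.
have [xy|nxy] := pselect (osum_le x y).
  have [t tP] := osum_top; exists t => z; split=> // _ w _ wx.
  exact: osum_trans wx xy.
case: x nxy => [[n a]|] nxy; last by case: nxy; constructor.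
rewrite -/(in_layer a) in nxy *.
case: (layerP n y) nxy => [m b mn|b nab|{}y yn nay]; first by case; constructor.
  have [e [eu ex en]] := osum_emb (himp (val a) (val b)).
  exists e => z; case: (layerP n z) => [m c mn|u|{}z zn].
  - split=> [/(osum_above mn en)//|H]; case: nab.
    by apply: H (osum_refl _); constructor.
  - rewrite eu le_himp; split=> [h w wu wa|H].
      case: (layerP n w) wu wa => [m c mn|v|{}w wn].
      + by move=> h'; case: (osum_above mn _ h'); exact: leqnn.
      + by rewrite !osum_leE => vu va; apply: le_trans h; rewrite lexI vu.
      + by move=> _ _; exact: osum_below_layer.
    have [->|ne] := eqVneq (val u `&` val a) \bot; first exact: le0x.
    have := H (in_layer (mk_nonbot ne)).
    by rewrite !osum_leE; apply; [exact: leIl|exact: leIr].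
  - split=> [_ w wz _|_]; last exact: ex.
    exact/osum_below_layer/(below_le wz).
have [t [tn tP]] := osum_below_top n.+1.
have [ty|nty] := pselect (osum_le t y); last first.
  exists y => z; split=> [zy w wz _|H]; first exact: osum_trans wz zy.
  have ta : osum_le t (in_layer a) by exact: osum_below_layer.
  case: (layerP n z) H => [m c mn|u|{}z zn] H.
  - by case: nty; apply: H (ta); apply: osum_trans (ta) _; constructor.
  - by case: nty; apply: H (ta); exact: osum_below_layer.
  - by apply: H (osum_refl _) _; exact: osum_below_layer.
have [e [eu ex en]] := osum_emb (himp (val a) \bot).
exists e => z; case: (layerP n z) => [m c mn|u|{}z zn].
- split=> [/(osum_above mn en)//|H]; case: nay.
  by apply: H (osum_refl _); constructor.
- rewrite eu le_himp lex0; split=> [/eqP h w wu wa|H].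
    case: (layerP n w) wu wa => [m c mn|v|{}w wn].
    + by move=> h'; case: (osum_above mn _ h'); exact: leqnn.
    + rewrite !osum_leE => vu va.
      have : val v <= val u `&` val a by rewrite lexI vu.
      by rewrite h lex0 (negPf (valP v)).
    + by move=> _ _; exact: osum_trans (tP _ wn) ty.
  apply: contrapT => /negP ne.
  have := H (in_layer (mk_nonbot ne)).
  rewrite !osum_leE => /(_ (leIl _ _) (leIr _ _)).
  exact: osum_not_below.
- split=> [_ w wz _|_]; last exact: ex.
  by apply: osum_trans ty; exact/tP/(below_le wz).
Qed.

Definition osum : heyting :=
  heyting_of_order (HeytingOrder osum_refl osum_anti osum_trans osum_bot
    osum_top osum_meet osum_join osum_imp).

End InfiniteSum.

(* Since \big is a right fold and hsum A B places B below A, the term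
   \big[hsum/B]_(i < n) A i is A 0 + (A 1 + ... + (A (n - 1) + B)). *)
Definition KG : heyting -> Prop :=
  generated_variety (fun C => exists n (A : 'I_n -> heyting) (B : heyting),
    [/\ forall i, one_generated (A i), one_generated B
      & C = \big[hsum/B]_(i < n) A i]).

Definition D2_or_X2 (A : heyting) : Prop := A = D2 \/ A = X2.

(* Main.v *)
(* A non-surjective epimorphism f : A -> B gives two prime filters of B with the
   same trace on A. The equations of KG force the prime filters above a given
   one to form a linear sum of points and of Rieger-Nishimura ladders. Going up
   from an incomparable pair of prime filters one either meets a prime filter
   comparable to all others, or reaches the top, or never stops. In the first two
   cases the prime filters in between are separated by their traces on A, since
   otherwise two distinct homomorphisms agreeing on A could be defined; so some
   ascent is endless. It yields an infinite upward zigzag whose algebra is in K,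
   and this zigzag is cut into blocks that map onto arbitrarily high stacks of
   copies of D2 and X2. By Koenig's lemma, such stacks give an infinite sum in K.

   Conversely, an infinite sum of copies of D2 and X2 is the algebra of upsets of
   a zigzag z_0, z_1, ..., and identifying z_{2i-1} with z_{2i} defines a proper
   subalgebra, a chain. If its inclusion is not an epimorphism in K, then two
   homomorphisms agreeing on the chain produce an unbroken infinite ladder, whose
   algebra lies in K; for that ladder the inclusion of the chain is an
   epimorphism because KG has width two. *)

From HB Require Import structures.
Require Import Defs.
From mathcomp Require Import all_boot all_order.
From mathcomp Require Import boolp classical_sets.
From mathcomp Require Import zify.

Set Implicit Arguments.
Unset Strict Implicit.
Unset Printing Implicit Defensive.

Import Order.Theory.
Local Open Scope classical_set_scope.
Local Open Scope order_scope.

(** No topological duality is set up: prime filters serve as points, and membership of an algebra in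
    [K] is always derived from a relation that makes it a quotient of a subalgebra of a known
    member. [KG] enters only through three equations, and these constrain only prime filters lying
    above a common one. Since no common lower bound is known for a pair with equal traces, the
    epimorphism property is used to move such a pair above a single prime filter. Traces can only be
    separated downwards from the end of an ascent, hence terminating ascents form an inductive
    predicate and the endless ones are its negation. For two comparable prime filters there is no
    ascent to follow, and the primes between them may be densely ordered; cutting that interval at
    one element of the algebra yields two consecutive primes. In the converse direction the paired
    points straddle the layers: layers have two or four points, so a break can occur only inside a
    pair, and the points [2 * i] and [2 * i + 1] of neighbouring pairs are always incomparable. Two
    homomorphisms agreeing on the chain give each prime filter two positions in the zigzag, and
    width two limits which positions can occur together. *)

Notation "p [<=] q" := (subset p q) (at level 70, no associativity).
Notation "p [<] q" := (proper p q) (at level 70, no associativity).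
Notation "p [#] q" := (~ p [<=] q /\ ~ q [<=] p) (at level 70, no associativity).

(** * Inclusion, strict inclusion and incomparability of sets *)

Section Orders.
Context (T : Type).
Implicit Types p q s : set T.

Lemma sub_eq p q : p [<=] q -> q [<=] p -> p = q.
Proof. by move=> pq qp; apply/seteqP. Qed.

Lemma sub_cases p q : p [<=] q -> p = q \/ p [<] q.
Proof.
move=> pq; have [qp|nqp] := pselect (q [<=] p); last by right.
by left; exact: sub_eq.
Qed.

Lemma inc_sym p q : p [#] q -> q [#] p. Proof. by case. Qed.

Lemma inc_cases p q : [\/ p = q, p [<] q, q [<] p | p [#] q].
Proof.
have [pq|npq] := pselect (p [<=] q); have [qp|nqp] := pselect (q [<=] p).
- by apply: Or41; exact: sub_eq.
- by apply: Or42.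
- by apply: Or43.
- by apply: Or44.
Qed.

Lemma sub_proper p q s : p [<=] q -> q [<] s -> p [<] s.
Proof.
move=> pq [qs sq]; split; first exact: subset_trans pq qs.
by move=> sp; apply: sq; exact: subset_trans sp pq.
Qed.

Lemma proper_sub p q s : p [<] q -> q [<=] s -> p [<] s.
Proof.
move=> [pq qp] qs; split; first exact: subset_trans pq qs.
by move=> sp; apply: qp; exact: subset_trans qs sp.
Qed.

Lemma strict_trans p q s : p [<] q -> q [<] s -> p [<] s.
Proof. by move=> pq [qs _]; exact: proper_sub pq qs. Qed.

Lemma proper_witness p q : ~ q [<=] p -> exists d, q d /\ ~ p d.
Proof.
move=> nqp; apply: contrapT => H; apply: nqp => x qx.
by apply: contrapT => px; apply: H; exists x.
Qed.

End Orders.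

Section HeytingBasics.
Context (H : heyting).
Implicit Types x y z : H.

Lemma himpP x y : himp x y `&` x <= y.
Proof. by rewrite -le_himp lexx. Qed.

Lemma himp_top x y : (himp x y == \top) = (x <= y).
Proof. by rewrite -le1x le_himp meet1x. Qed.

End HeytingBasics.

(** * Prime filters *)

Record prime (H : heyting) (p : set H) : Prop := Prime {
  prime_top : p \top;
  prime_bot : ~ p \bot;
  prime_meet : forall x y, p (x `&` y) <-> p x /\ p y;
  prime_join : forall x y, p (x `|` y) <-> p x \/ p y
}.

Record filter (H : heyting) (F : set H) : Prop := Filter {
  filter_top : F \top;
  filter_meet : forall x y, F x -> F y -> F (x `&` y);
  filter_up : forall x y, F x -> x <= y -> F y
}.

Section Primes.
Context (H : heyting).
Implicit Types (x y z : H) (p q F I : set H).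

Lemma prime_up p x y : prime p -> p x -> x <= y -> p y.
Proof. by move=> pp px /meet_idPl e; move: px; rewrite -e => /(prime_meet pp)[]. Qed.

Lemma prime_filter p : prime p -> filter p.
Proof.
move=> pp; split; first exact: prime_top.
  by move=> x y px py; apply/(prime_meet pp).
by move=> x y; exact: prime_up.
Qed.

Lemma prime_mp p x y : prime p -> p (himp x y) -> p x -> p y.
Proof.
by move=> pp pxy px; apply: (prime_up pp) (himpP x y); apply/(prime_meet pp).
Qed.

(** A set maximal among those closed under meets with no member below an element of [I] is prime:
    each element outside it has a meet with some member that falls below [I]. *)
Lemma prime_filter_theorem F I :
  F \top -> (forall x y, F x -> F y -> F (x `&` y)) ->
  I \bot -> (forall x y, I x -> I y -> I (x `|` y)) ->
  (forall x y, F x -> I y -> ~ x <= y) ->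
  exists p, [/\ prime p, F [<=] p & forall x, I x -> ~ p x].
Proof.
move=> F1 FI I0 IU FIdisj.
pose ok (G : set H) :=
  (forall x y, G x -> G y -> G (x `&` y)) /\ forall x y, G x -> I y -> ~ x <= y.
(* The union with [F] is built into the candidates because this form of Zorn's lemma also asks for
   the union of the empty chain. *)
have [|M [okM Mmax]] := @Zorn_bigcup H [set S | ok (S `|` F)%classic].
  move=> C CokP Ctot; have Cok S : C S -> ok (S `|` F)%classic by exact: CokP.
  split.
    have aux (x : H) : ((\bigcup_(X in C) X) `|` F)%classic x ->
        F x \/ exists2 S, C S & S x.
      by move=> [[S CS Sx]|]; [right; exists S|left].
    have aux2 S (x : H) : C S -> (S `|` F)%classic x ->
        ((\bigcup_(X in C) X) `|` F)%classic x.
      by move=> CS [Sx|Fx]; [left; exists S|right].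
    move=> x y /aux[Fx|[S CS Sx]] /aux[Fy|[S' CS' Sy]].
    - by right; exact: FI.
    - by apply: (aux2 _ _ CS'); apply: (Cok _ CS').1; [right|left].
    - by apply: (aux2 _ _ CS); apply: (Cok _ CS).1; [left|right].
    - case: (Ctot _ _ CS CS') => SS.
        by apply: (aux2 _ _ CS'); apply: (Cok _ CS').1; left; [exact: SS|].
      by apply: (aux2 _ _ CS); apply: (Cok _ CS).1; left; [|exact: SS].
  move=> x y [[S CS Sx]|Fx] Iy; last exact: FIdisj.
  by apply: (Cok _ CS).2 Iy; left.
set P := (M `|` F)%classic in okM.
have P1 : P \top by right.
have ext z : ~ P z -> exists m i, [/\ P m, I i & m `&` z <= i].
  move=> nPz; apply: contrapT => no.
  pose N : set H := [set w | exists2 m, P m & m `&` z <= w].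
  have PN : P [<=] N by move=> m Pm; exists m => //; exact: leIl.
  have NF : (N `|` F)%classic = N.
    by apply/seteqP; split=> [w [//|Fw]|w Nw]; [apply: PN; right|left].
  apply: (Mmax N).
    split; first by move=> w Mw; apply: PN; left.
    move=> NM; apply: nPz; left; apply: NM; exists \top => //.
    by rewrite meet1x.
  rewrite /= NF; split.
    move=> x y [m Pm mx] [m' Pm' my]; exists (m `&` m'); first exact: okM.1.
    by rewrite lexI (le_trans _ mx) ?(le_trans _ my) // leI2 ?leIl ?leIr.
  move=> x y [m Pm mx] Iy xy; apply: no; exists m, y; split=> //.
  exact: le_trans mx xy.
have Pup x y : P x -> x <= y -> P y.
  move=> Px xy; apply: contrapT => /ext[m [i [Pm Ii mi]]].
  apply: (okM.2 _ _ (okM.1 _ _ Pm Px) Ii).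
  by apply: le_trans mi; rewrite leI2.
exists P; split; last first.
- by move=> x Ix Px; exact: okM.2 Px Ix (lexx _).
- by move=> x Fx; right.
split=> //.
- by move=> P0; exact: okM.2 P0 I0 (lexx _).
- move=> x y; split=> [Pxy|[Px Py]]; last exact: okM.1.
  by split; apply: Pup Pxy _; [exact: leIl|exact: leIr].
- move=> x y; split=> [Pxy|[Px|Py]]; last 2 first.
  + by apply: Pup Px (leUl _ _).
  + by apply: Pup Py (leUr _ _).
  apply: contrapT => /not_orP[/ext[m [i [Pm Ii mi]]] /ext[m' [i' [Pm' Ii' mi']]]].
  apply: (okM.2 _ _ (okM.1 _ _ (okM.1 _ _ Pm Pm') Pxy) (IU _ _ Ii Ii')).
  rewrite meetUr leUx; apply/andP; split.
    by apply: le_trans (leUl _ _); apply: le_trans mi; rewrite leI2 ?leIl.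
  by apply: le_trans (leUr _ _); apply: le_trans mi'; rewrite leI2 ?leIr.
Qed.

Lemma prime_above F y : filter F -> ~ F y ->
  exists p, [/\ prime p, F [<=] p & ~ p y].
Proof.
move=> [F1 FM Fu] nFy.
have [|||||p [pp Fp Ip]] := @prime_filter_theorem F [set z | z <= y] => //=.
- by move=> a b ay byy; rewrite leUx ay.
- by move=> a b Fa bye ab; apply: nFy; exact: Fu Fa (le_trans ab bye).
by exists p; split=> //; exact: (Ip y (lexx y)).
Qed.

Lemma prime_separates x y : ~ x <= y -> exists p, [/\ prime p, p x & ~ p y].
Proof.
move=> nxy; have [||p [pp xp py]] := @prime_above [set z | x <= z] y => //.
  split=> /=; first exact: lex1.
    by move=> a b xa xb; rewrite lexI xa.
  by move=> a b; exact: le_trans.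
by exists p; split=> //; apply: xp => /=.
Qed.

(** When [himp x y] is missing, the filter generated by [p] and [x] omits [y] and extends to a prime
    filter omitting it. *)
Lemma prime_imp p x y : prime p ->
  p (himp x y) <-> forall q, prime q -> p [<=] q -> q x -> q y.
Proof.
move=> pp; split=> [pxy q qq pq qx|all_q].
  by apply: (prime_mp qq) qx; exact: pq.
apply: contrapT => npxy.
have [||q [qq sq qy]] := @prime_above [set z | exists2 u, p u & u `&` x <= z] y.
- split; first by exists \top; [exact: prime_top|exact: lex1].
    move=> a b [u pu ua] [v pv vb]; exists (u `&` v).
      by apply/(prime_meet pp).
    by rewrite lexI (le_trans _ ua) ?(le_trans _ vb) // leI2 ?leIl ?leIr.
  by move=> a b [u pu ua] ab; exists u => //; exact: le_trans ab.
- move=> [u pu uxy]; apply: npxy; apply: (prime_up pp) pu _.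
  by rewrite le_himp.
apply: qy; apply: all_q => // [z pz|]; apply: sq.
  by exists z => //; exact: leIl.
by exists \top; [exact: prime_top|exact: leIr].
Qed.

Lemma prime_ext x y : (forall p, prime p -> p x <-> p y) -> x = y.
Proof.
move=> h; apply: le_anti; apply/andP; split; apply: contrapT => /prime_separates[p [pp]].
  by move=> px []; exact: (h p pp).1.
by move=> px []; exact: (h p pp).2.
Qed.

Lemma not_prime_imp p x y : prime p -> ~ p (himp x y) ->
  exists q, [/\ prime q, p [<=] q, q x & ~ q y].
Proof.
move=> pp npxy; apply: contrapT => no; apply: npxy; apply/(prime_imp _ _ pp).
by move=> q qq pq qx; apply: contrapT => qy; apply: no; exists q.
Qed.

Lemma not_top_prime x : x <> \top -> exists p, prime p /\ ~ p x.
Proof.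
move=> x1; have [|p [pp _ px]] := @prime_separates \top x; last by exists p.
by rewrite le1x => /eqP.
Qed.

End Primes.

(** * Traces of prime filters along a homomorphism *)

Section HomPrimes.
Context (A B : heyting) (f : A -> B) (fhom : heyting_hom f).
Implicit Types (p q : set B).

Definition restr p : set A := [set a | p (f a)].

Lemma hom_le x y : x <= y -> f x <= f y.
Proof. by move=> /meet_idPl e; apply/meet_idPl; rewrite -hom_meet // e. Qed.

Lemma restr_prime p : prime p -> prime (restr p).
Proof.
move=> pp; split; rewrite /restr /=.
- by rewrite hom_top //; exact: prime_top.
- by rewrite hom_bot //; exact: prime_bot.
- by move=> x y; rewrite hom_meet //; exact: prime_meet.
- by move=> x y; rewrite hom_join //; exact: prime_join.
Qed.

(** The back condition of the dual map. The filter generated by [p] and the image of [q] misses the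
    ideal generated by the image of the complement of [q]: if [u] is in [p], [a] in [q] and the meet
    of [u] and [f a] is below [f b], then [u] is below [f (himp a b)], so [himp a b] and hence [b]
    belong to [q]. *)
Lemma restr_lift p (q : set A) : prime p -> prime q -> restr p [<=] q ->
  exists p', [/\ prime p', p [<=] p' & restr p' = q].
Proof.
move=> pp qq pq.
have [|||||p' [pp' Fp' Ip']] := @prime_filter_theorem B
  [set z | exists u a, [/\ p u, q a & u `&` f a <= z]]
  [set z | exists2 a, ~ q a & z <= f a].
- by exists \top, \top; split; [exact: prime_top|exact: prime_top|exact: lex1].
- move=> x y [u [a [pu qa ux]]] [v [b [pv qb vy]]].
  exists (u `&` v), (a `&` b); split; [exact/(prime_meet pp)|exact/(prime_meet qq)|].
  rewrite hom_meet // lexI (le_trans _ ux) ?(le_trans _ vy) // leI2 ?leIl ?leIr //.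
- by exists \bot; [exact: prime_bot|exact: le0x].
- move=> x y [a qa xa] [b qb yb]; exists (a `|` b).
    by move=> /(prime_join qq)[].
  by rewrite hom_join // leU2.
- move=> x y [u [a [pu qa ux]]] [b qb yb] xy; apply: qb.
  apply: (prime_mp qq) qa; apply: pq; rewrite /restr /= hom_imp //.
  by apply: (prime_up pp) pu _; rewrite le_himp; exact: le_trans ux (le_trans xy yb).
exists p'; split=> //.
  move=> u pu; apply: Fp'; exists u, \top; split=> //; [exact: prime_top|exact: leIl].
apply/seteqP; split=> a /=.
  by move=> p'a; apply: contrapT => nqa; apply: Ip' p'a; exists a.
move=> qa; apply: Fp'; exists \top, a; split=> //; [exact: prime_top|exact: leIr].
Qed.

(** The values of [f] above [b] generate a filter without [b], which extends to a prime [q] omitting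
    [b]. A prime containing [b] and avoiding all values of [f] outside [q] has its trace inside that
    of [q], and lifting makes the traces equal. *)
Lemma restr_separates b : ~ (exists a, f a = b) ->
  exists p q, [/\ prime p, prime q, restr p = restr q, p b & ~ q b].
Proof.
move=> nb.
have [||q [qq Gq qb]] := @prime_above B [set x | exists2 a, b <= f a & f a <= x] b.
- split; first by exists \top; [rewrite hom_top ?lex1|exact: lex1].
    move=> x y [a ba ax] [a' ba' ay]; exists (a `&` a'); rewrite hom_meet //.
      by rewrite lexI ba.
    exact: leI2.
  by move=> x y [a ba ax] xy; exists a => //; exact: le_trans xy.
- by move=> [a ba ab]; apply: nb; exists a; apply: le_anti; rewrite ba ab.
have [|||||p [pp Fp Ip]] := @prime_filter_theorem B
  [set x | b <= x] [set x | exists2 a, ~ q (f a) & x <= f a].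
- exact: lex1.
- by move=> x y /= bx bY; rewrite lexI bx.
- by exists \bot; [rewrite hom_bot //; exact: prime_bot|exact: le0x].
- move=> x y [a qa xa] [a' qa' ya]; exists (a `|` a'); rewrite hom_join //.
    by move=> /(prime_join qq)[].
  exact: leU2.
- move=> x y /= bx [a qa ya] xy; apply: qa; apply: Gq; exists a => //.
  exact: le_trans bx (le_trans xy ya).
have pb : p b by apply: Fp => /=.
have [||p' [pp' pp'' e]] := @restr_lift p (restr q) pp.
- exact: restr_prime.
- move=> a pa; apply: contrapT => nqa; apply: Ip pa; by exists a.
by exists p', q; split=> //; exact: pp''.
Qed.

End HomPrimes.

(** * Closure of varieties under quotients of subalgebras *)

(** [R] is the graph of a homomorphism from a subalgebra of [B] onto [H]; a relation spares the
    construction of that subalgebra. *)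
Lemma relation_variety (K : heyting -> Prop) (B H : heyting) (R : B -> H -> Prop) :
  variety K -> K B ->
  (forall x, exists b, R b x) ->
  (forall b x y, R b x -> R b y -> x = y) ->
  R \bot \bot -> R \top \top ->
  (forall b x c y, R b x -> R c y -> R (b `&` c) (x `&` y)) ->
  (forall b x c y, R b x -> R c y -> R (b `|` c) (x `|` y)) ->
  (forall b x c y, R b x -> R c y -> R (himp b c) (himp x y)) ->
  K H.
Proof.
move=> [E EP] KB tot fn R0 R1 RI RU Rimp; apply/EP => s t Est v.
have [w wP] := choice (fun i => tot (v i)).
have ev u : R (eval w u) (eval v u) by elim: u => //= *; auto.
apply: (fn (eval w s)) => //.
by rewrite (((EP B).1 KB) _ _ Est).
Qed.

Section Quotient.
Context (B : heyting) (F : set B) (fF : filter F).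

Let eqv (x y : B) := F (himp x y) /\ F (himp y x).
Let rep (x : B) : B := xget \top [set y | eqv x y].

Let imp_refl x : F (himp x x).
Proof. by have /eqP-> : himp x x == \top; [rewrite himp_top|exact: filter_top]. Qed.

Let imp_trans y x z : F (himp x y) -> F (himp y z) -> F (himp x z).
Proof.
move=> xy yz; apply: (filter_up fF) (filter_meet fF xy yz) _.
rewrite le_himp; apply: le_trans (himpP y z); rewrite lexI; apply/andP; split.
  by rewrite -meetA; apply: le_trans (leIr _ _) (leIl _ _).
by apply: le_trans (himpP x y); rewrite leI2 ?leIl.
Qed.

Let imp_le x y : x <= y -> F (himp x y).
Proof. by rewrite -himp_top => /eqP->; exact: filter_top. Qed.

Let rep_eqv x : eqv x (rep x).
Proof. by rewrite /rep; case: xgetP => [y -> //|/(_ x)[]]; split. Qed.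

Let rep_id x y : eqv x y -> rep x = rep y.
Proof.
move=> [xy yx]; rewrite /rep; congr (xget _ _); apply/seteqP; split=> z [a b]; split.
- exact: imp_trans yx a.
- exact: imp_trans b xy.
- exact: imp_trans xy a.
- exact: imp_trans b yx.
Qed.

Let T := {x : B | rep x = x}.
Let cls (x : B) : T := exist _ (rep x) (esym (rep_id (rep_eqv x))).
Let le (x y : T) := F (himp (sval x) (sval y)).

Let le_cls x y : le (cls x) (cls y) <-> F (himp x y).
Proof.
have [xr rx] := rep_eqv x; have [yr ry] := rep_eqv y; rewrite /le /=.
by split=> h; [exact: imp_trans xr (imp_trans h ry)|exact: imp_trans rx (imp_trans h yr)].
Qed.

Let cls_sval (x : T) : cls (sval x) = x.
Proof. by case: x => x e; exact: eq_exist. Qed.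

Let le_refl x : le x x. Proof. exact: imp_refl. Qed.

Let le_anti x y : le x y -> le y x -> x = y.
Proof.
move=> xy yx; rewrite -(cls_sval x) -(cls_sval y); apply: eq_exist.
exact: rep_id.
Qed.

Let le_tr y x z : le x y -> le y z -> le x z.
Proof. exact: imp_trans. Qed.

Let has_bot : exists b, forall x, le b x.
Proof. by exists (cls \bot) => x; rewrite -(cls_sval x); apply/le_cls/imp_le/le0x. Qed.

Let has_top : exists b, forall x, le x b.
Proof. by exists (cls \top) => x; rewrite -(cls_sval x); apply/le_cls/imp_le/lex1. Qed.

Let has_meet x y : exists m, forall z, le z m <-> le z x /\ le z y.
Proof.
exists (cls (sval x `&` sval y)) => z; rewrite -(cls_sval z) -{2}(cls_sval x) -{2}(cls_sval y).
rewrite !le_cls; split=> [h|[h h']].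
  by split; apply: imp_trans h _; apply: imp_le; [exact: leIl|exact: leIr].
apply: (filter_up fF) (filter_meet fF h h') _; rewrite le_himp lexI.
by rewrite (le_trans _ (himpP (sval z) (sval x))) ?(le_trans _ (himpP (sval z) (sval y))) //
  leI2 ?leIl ?leIr.
Qed.

Let has_join x y : exists m, forall z, le m z <-> le x z /\ le y z.
Proof.
exists (cls (sval x `|` sval y)) => z; rewrite -(cls_sval z) -{2}(cls_sval x) -{2}(cls_sval y).
rewrite !le_cls; split=> [h|[h h']].
  by split; apply: imp_trans h; apply: imp_le; [exact: leUl|exact: leUr].
apply: (filter_up fF) (filter_meet fF h h') _; rewrite le_himp meetUr leUx.
by rewrite (le_trans _ (himpP (sval x) (sval z))) ?(le_trans _ (himpP (sval y) (sval z))) //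
  leI2 ?leIl ?leIr.
Qed.

Let has_imp x y : exists i, forall z,
  le z i <-> forall w, le w z -> le w x -> le w y.
Proof.
exists (cls (himp (sval x) (sval y))) => z.
rewrite -{1}(cls_sval z) le_cls; split=> [h w wz wx|h].
  apply: (filter_up fF) (filter_meet fF (imp_trans wz h) wx) _.
  rewrite le_himp; apply: le_trans (himpP (sval x) (sval y)).
  rewrite lexI (le_trans _ (himpP (sval w) (himp (sval x) (sval y)))) //
    ?(le_trans _ (himpP (sval w) (sval x))) //
    leI2 ?leIl ?leIr //.
have := h (cls (sval z `&` sval x)).
have le_clsl (u : B) (v : T) : le (cls u) v <-> F (himp u (sval v)).
  by rewrite -{1}(cls_sval v) le_cls.
rewrite !le_clsl => /(_ (imp_le (leIl _ _)) (imp_le (leIr _ _))) hh.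
apply: (filter_up fF) hh _; rewrite !le_himp -meetA.
exact: himpP.
Qed.

Definition quotient : heyting := heyting_of_order
  (HeytingOrder le_refl le_anti le_tr has_bot has_top has_meet has_join has_imp).

Definition proj (x : B) : quotient := cls x.

Lemma proj_le x y : (proj x <= proj y) <-> F (himp x y).
Proof.
rewrite -le_cls; split=> [/(@order_leP _ _ (cls x) (cls y))//|h].
exact/order_leP.
Qed.

Lemma proj_onto (c : quotient) : exists x, proj x = c.
Proof. by exists (sval c); exact: cls_sval. Qed.

Lemma proj_eq x y : proj x = proj y <-> F (himp x y) /\ F (himp y x).
Proof.
rewrite -!proj_le; split=> [->//|[h h']].
by apply: Order.POrderTheory.le_anti; rewrite h h'.
Qed.

Lemma proj_hom : heyting_hom proj.
Proof.
have mono x y : x <= y -> proj x <= proj y by move=> /imp_le/proj_le.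
have glb x y : proj (x `&` y) = proj x `&` proj y.
  apply: Order.POrderTheory.le_anti; rewrite lexI !mono ?leIl ?leIr //=.
  have [z ez] := proj_onto (proj x `&` proj y); rewrite -ez.
  have /proj_le zx : proj z <= proj x by rewrite ez leIl.
  have /proj_le zy : proj z <= proj y by rewrite ez leIr.
  apply/proj_le; apply: (filter_up fF) (filter_meet fF zx zy) _; rewrite le_himp lexI.
  by rewrite (le_trans _ (himpP z x)) ?(le_trans _ (himpP z y)) // leI2 ?leIl ?leIr.
split=> //.
- move=> x y; apply: Order.POrderTheory.le_anti.
  rewrite [X in _ && X]leUx !mono ?leUl ?leUr //= andbT.
  have [z ez] := proj_onto (proj x `|` proj y); rewrite -ez.
  have /proj_le zx : proj x <= proj z by rewrite ez leUl.
  have /proj_le zy : proj y <= proj z by rewrite ez leUr.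
  apply/proj_le; apply: (filter_up fF) (filter_meet fF zx zy) _.
  rewrite le_himp meetUr leUx.
  by rewrite (le_trans _ (himpP x z)) ?(le_trans _ (himpP y z)) // leI2 ?leIl ?leIr.
- move=> x y; apply: Order.POrderTheory.le_anti.
  rewrite le_himp -glb mono ?himpP //=.
  have [z ez] := proj_onto (himp (proj x) (proj y)); rewrite -ez.
  have : proj z `&` proj x <= proj y by rewrite -le_himp ez.
  rewrite -glb => /proj_le h; apply/proj_le; apply: (filter_up fF) h _.
  by rewrite !le_himp -meetA himpP.
- apply: Order.POrderTheory.le_anti; rewrite le0x andbT.
  by have [z <-] := proj_onto \bot; apply: mono; exact: le0x.
- apply: Order.POrderTheory.le_anti; rewrite lex1 /=.
  by have [z <-] := proj_onto \top; apply: mono; exact: lex1.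
Qed.

Lemma quotient_variety (K : heyting -> Prop) : variety K -> K B -> K quotient.
Proof.
move=> vK KB; apply: (@relation_variety K B quotient (fun b c => proj b = c)) => //.
- exact: proj_onto.
- by move=> b x y -> ->.
- exact: hom_bot proj_hom.
- exact: hom_top proj_hom.
- by move=> b x c y <- <-; exact: (hom_meet proj_hom).
- by move=> b x c y <- <-; exact: (hom_join proj_hom).
- by move=> b x c y <- <-; exact: (hom_imp proj_hom).
Qed.

End Quotient.

(** * One-generated algebras *)

Section RiegerNishimura.
Context (H : heyting) (a : H).

(** The Rieger-Nishimura terms. The state consists of the n-th term, of the join of the terms with
    index at most [n - 2], and of the same join for [n + 1]; the next term is the implication from
    the first to the second. On the ladder dual to [RN], the n-th term is the upset generated by the
    n-th point from above, so the least term in a prime filter tells its position. *)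
Fixpoint rn (n : nat) : H * H * H :=
  if n is m.+1 then
    let: (al, be, be') := rn m in (himp al be, be', be' `|` al)
  else (a, \bot, \bot).

Definition rn_elt n : H := (rn n).1.1.
Definition rn_join n : H := (rn n).1.2.

Lemma rn_eltS n : rn_elt n.+1 = himp (rn_elt n) (rn_join n).
Proof. by rewrite /rn_elt /rn_join /=; case: (rn n) => [[al be] be']. Qed.

Lemma prime_rn_join (p : set H) n : prime p ->
  p (rn_join n) <-> exists2 j, (j.+2 <= n)%N & p (rn_elt j).
Proof.
move=> pp.
have joinSS m : rn_join m.+2 = rn_join m.+1 `|` rn_elt m.
  by rewrite /rn_elt /rn_join /=; case: (rn m) => [[al be] be'].
case: n => [|n]; first by split=> [/(prime_bot pp)|[j]].
elim: n => [|n IH]; first by split=> [/(prime_bot pp)|[j]].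
rewrite joinSS; split=> [/(prime_join pp)[/IH[j jn pj]|pn]|[j]].
- by exists j => //; apply: leq_trans jn _.
- by exists n.
rewrite ltnS leq_eqVlt => /orP[/eqP[->] pn|jn pj]; apply/(prime_join pp).
  by right.
by left; apply/IH; exists j.
Qed.

Definition rn_level (p : set H) n :=
  p (rn_elt n) /\ forall j, (j < n)%N -> ~ p (rn_elt j).

Lemma rn_level_inj p n m : rn_level p n -> rn_level p m -> n = m.
Proof.
move=> [pn nmin] [pm mmin]; case: (ltngtP n m) => // [/mmin|/nmin] //.
Qed.

Lemma rn_level_ex p n : p (rn_elt n) -> exists2 m, (m <= n)%N & rn_level p m.
Proof.
move=> pn; have ex : exists m, `[< p (rn_elt m) >] by exists n; apply/asboolP.
case: (ex_minnP ex) => m /asboolP pm mmin; exists m.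
  by apply: mmin; apply/asboolP.
split=> // j jm pj; have /mmin : `[< p (rn_elt j) >] by apply/asboolP.
by rewrite leqNgt jm.
Qed.

(** The case [n = m.+1] is impossible: [q] would contain [rn_elt m] and its implication to
    [rn_join m], hence a term of index below [m]. *)
Lemma rn_level_le p q n m : prime q -> p [<=] q ->
  rn_level p n -> rn_level q m -> m = n \/ (m.+2 <= n)%N.
Proof.
move=> pq sub [pn _] [qm mmin].
have mn : (m <= n)%N by rewrite leqNgt; apply/negP => /mmin; apply; exact: sub.
move: mn; rewrite leq_eqVlt => /orP[/eqP->|]; first by left.
rewrite leq_eqVlt => /orP[/eqP e|]; last by right.
move: (sub _ pn); rewrite -e rn_eltS => /(prime_mp pq)/(_ qm).
move=> /(prime_rn_join _ pq)[j jm].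
by have /mmin : (j < m)%N by lia.
Qed.

(** Some extension contains [rn_elt m] but not [rn_join m], so no term of index at most [m - 2]. The
    term of index [m - 1] is missing too: together with [rn_elt m] it would yield [rn_join m.-1],
    whose terms all occur in [rn_join m]. *)
Lemma rn_level_see p m : prime p -> ~ p (rn_elt m.+1) ->
  exists q, [/\ prime q, p [<=] q & rn_level q m].
Proof.
move=> pp; rewrite rn_eltS => /(not_prime_imp pp)[q [pq sub qm nq]].
exists q; split=> //; split=> // j jm qj.
have [jm2|] := leqP j.+2 m; first by apply: nq; apply/(prime_rn_join _ pq); exists j.
move=> mj; have e : m = j.+1 by lia.
subst m; apply: nq; move: qm; rewrite rn_eltS => /(prime_mp pq)/(_ qj).
by move=> /(prime_rn_join _ pq)[k kj qk]; apply/(prime_rn_join _ pq); exists k => //; lia.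
Qed.

Definition same_level p q := forall n, rn_level p n <-> rn_level q n.

(** This makes [same_level] a bisimulation. Let [m] be the level of [q']. If [p] omits
    [rn_elt m.+1], it sees a prime filter of level [m]; otherwise its level, shared by [q], is at
    most [m.+1], and the inclusion of [q] in [q'] leaves only [m]. *)
Lemma same_level_back p q q' : prime p -> prime q' -> same_level p q ->
  q [<=] q' -> exists p', [/\ prime p', p [<=] p' & same_level p' q'].
Proof.
move=> pp pq' e sub.
have [[m lm]|no] := pselect (exists m, rn_level q' m); last first.
  exists p; split=> // n; split=> [ln|ln]; last by case: no; exists n.
  case: no; have [qn _] := (e n).1 ln.
  by have [m _ lm] := rn_level_ex (sub _ qn); exists m.
have lev_eq p' : rn_level p' m -> same_level p' q'.
  by move=> lp' n; split=> [/(rn_level_inj lp')<-|/(rn_level_inj lm)<-].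
have [pm|] := pselect (p (rn_elt m.+1)); last first.
  by move=> /(rn_level_see pp)[p' [? ? ?]]; exists p'; split=> //; exact: lev_eq.
have [n nm ln] := rn_level_ex pm.
have [mn|mn] := rn_level_le pq' sub ((e n).1 ln) lm; last by lia.
by exists p; split=> //; apply: lev_eq; rewrite mn.
Qed.

Lemma same_level_subuniverse :
  subuniverse (fun x => forall p q, prime p -> prime q -> same_level p q -> p x -> q x).
Proof.
split.
- move=> x y Sx Sy p q pp pq e /(prime_meet pp)[px py].
  by apply/(prime_meet pq); split; [exact: Sx e px|exact: Sy e py].
- move=> x y Sx Sy p q pp pq e /(prime_join pp)[px|py]; apply/(prime_join pq).
    by left; exact: Sx e px.
  by right; exact: Sy e py.
- move=> x y Sx Sy p q pp pq e pxy; apply: contrapT.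
  move=> /(not_prime_imp pq)[q' [pq' sub q'x q'y]].
  have [p' [pp' pp1 e']] := same_level_back pp pq' e sub.
  have e'' : same_level q' p' by move=> n; symmetry; exact: e'.
  apply: q'y; apply: Sy e' _ => //; apply: (prime_mp pp') (Sx _ _ pq' pp' e'' q'x).
  exact: pp1.
- by move=> p q pp _ _ /(prime_bot pp).
- by move=> p q _ pq _ _; exact: prime_top.
Qed.

Hypothesis gen : forall S : H -> Prop, subuniverse S -> S a -> forall x, S x.

(** The elements that bisimilar prime filters cannot tell apart form a subuniverse containing the
    generator. *)
Lemma same_level_eq p q : prime p -> prime q -> same_level p q -> p = q.
Proof.
have Sx := gen same_level_subuniverse.
have Sa : forall p q, prime p -> prime q -> same_level p q -> p a -> q a.
  move=> {}p {}q pp pq e pa; have : rn_level p 0 by split.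
  by move=> /e[].
move=> pp pq e; apply: sub_eq => x; apply: Sx => //.
by move=> n; symmetry; exact: e.
Qed.

End RiegerNishimura.

(* [L p c m]: the prime filter [p] is the [m]-th point, counted from above, of
   the [c]-th Rieger-Nishimura ladder; the root of an infinite ladder has no
   number. *)
Definition ladder (H : heyting) := exists L : set H -> nat -> nat -> Prop,
  [/\ forall p c c' m m', L p c m -> L p c' m' -> c = c' /\ m = m',
      forall p q, prime p -> prime q -> p [#] q -> exists c m,
        L p c m /\ L q c m.+1 \/ L p c m.+1 /\ L q c m
    & forall p q c m k, prime p -> prime q -> p [<] q ->
        L p c m -> L q c k -> (k.+2 <= m)%N].

Lemma one_generated_ladder (H : heyting) : one_generated H -> ladder H.
Proof.
move=> [a gen]; exists (fun p c m => c = 0 /\ rn_level a p m); split.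
- by move=> p c c' m m' [-> lm] [-> lm']; split=> //; exact: rn_level_inj lm lm'.
(* If [p] omitted [rn_elt a n.+1], it would see a prime filter of level [n], which is [q] because
   the level determines the filter. Applied both ways, this bounds the difference of the two levels
   by one. *)
- have key p q n : prime p -> prime q -> ~ p [<=] q -> rn_level a q n ->
      exists2 m, rn_level a p m & (m <= n.+1)%N.
    move=> pp pq npq lq.
    have [pn|] := pselect (p (rn_elt a n.+1)).
      by have [m mn lm] := rn_level_ex pn; exists m.
    move=> /(rn_level_see pp)[q' [pq' sub lq']]; case: npq.
    rewrite -(same_level_eq gen pq' pq) // => m.
    by split=> [/(rn_level_inj lq')<-|/(rn_level_inj lq)<-].
  move=> p q pp pq [npq nqp].
  have [[n ln]|no] := pselect (exists n, rn_level a q n); last first.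
    have [[m lm]|no'] := pselect (exists m, rn_level a p m).
      by have [n ln _] := key _ _ _ pq pp nqp lm; case: no; exists n.
    case: npq; rewrite (same_level_eq gen pp pq) // => m.
    by split=> ?; [case: no'|case: no]; exists m.
  have [m lm mn] := key _ _ _ pp pq npq ln.
  have [n' ln' nm] := key _ _ _ pq pp nqp lm.
  have e := rn_level_inj ln ln'; subst n'; exists 0.
  have nm' : n <> m.
    move=> e; case: npq; rewrite (same_level_eq gen pp pq) // => k; subst m.
    by split=> [/(rn_level_inj lm)<-|/(rn_level_inj ln)<-].
  have [e|e] : m = n.+1 \/ n = m.+1 by lia.
    by subst m; exists n; right.
  by subst n; exists m; left.
- move=> p q c m k pp pq [sub nsub] [_ lm] [_ lk].
  have [e|//] := rn_level_le pq sub lm lk.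
  case: nsub; rewrite (same_level_eq gen pp pq) // => n; subst k.
  by split=> [/(rn_level_inj lm)<-|/(rn_level_inj lk)<-].
Qed.

(** * Prime filters of the members of KG *)

Section SumPrimes.
Context (A B : heyting).

Lemma hsum_leE (x y : hsum A B) : x <= y <-> sum_le x y.
Proof. by split=> [/order_leP|h]; last exact/order_leP. Qed.

Definition inB (b : B) : hsum A B := inr b.
Definition inA (a : A) : hsum A B := sum_emb B a.


Lemma inB_le b b' : inB b <= inB b' <-> b <= b'.
Proof. exact: hsum_leE. Qed.

Lemma inB_inA b a : inB b <= inA a.
Proof. by apply/hsum_leE; exact: sum_emb_inr. Qed.

Lemma inl_inA (u : nonbot A) a : (inl u : hsum A B) <= inA a <-> val u <= a.
Proof. by rewrite hsum_leE; exact: sum_emb_inl. Qed.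

Lemma inA_bot : inA \bot = inB \top.
Proof. by rewrite /inA /sum_emb insubF // eqxx. Qed.

Lemma inA_val (u : nonbot A) : inA (val u) = inl u.
Proof. exact: sum_embE. Qed.

Lemma hsum_case (x : hsum A B) :
  (exists2 a, a != \bot & x = inA a) \/ exists b, x = inB b.
Proof.
case: x => [u|b]; last by right; exists b.
by left; exists (val u); [exact: (valP u)|rewrite inA_val].
Qed.

Lemma hsum_ext (x y : hsum A B) : (forall z, z <= x <-> z <= y) -> x = y.
Proof. by move=> h; apply: le_anti; rewrite (h x).1 // (h y).2. Qed.

Lemma inA_le a a' : inA a <= inA a' <-> a <= a'.
Proof.
have [->|a0] := eqVneq a \bot.
  by rewrite inA_bot le0x; split=> // _; exact: inB_inA.
by rewrite -[a in inA a]/(val (mk_nonbot a0)) inA_val inl_inA.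
Qed.

Lemma inA_inB a b : inA a <= inB b <-> a = \bot /\ b = \top.
Proof.
split=> [|[-> ->]]; last by rewrite inA_bot.
have [->|a0] := eqVneq a \bot.
  by rewrite inA_bot inB_le le1x => /eqP.
by rewrite -[a in inA a]/(val (mk_nonbot a0)) inA_val hsum_leE.
Qed.

Lemma inA_meet a a' : inA (a `&` a') = inA a `&` inA a'.
Proof.
apply: hsum_ext => z; rewrite lexI; have [[c _ ->]|[b ->]] := hsum_case z.
  split=> [/inA_le|/andP[/inA_le h /inA_le h']].
    by rewrite lexI => /andP[h h']; apply/andP; split; apply/inA_le.
  by apply/inA_le; rewrite lexI h.
by rewrite !inB_inA.
Qed.

Lemma inB_meet b b' : inB (b `&` b') = inB b `&` inB b'.
Proof.
apply: hsum_ext => z; rewrite lexI; have [[c c0 ->]|[c ->]] := hsum_case z.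
  by split=> [/inA_inB[]|/andP[/inA_inB[]]] e; rewrite e eqxx in c0.
split=> [/inB_le|/andP[/inB_le h /inB_le h']].
  by rewrite lexI => /andP[h h']; apply/andP; split; apply/inB_le.
by apply/inB_le; rewrite lexI h.
Qed.

Lemma inA_join a a' : inA (a `|` a') = inA a `|` inA a'.
Proof.
apply: le_anti; rewrite [X in _ && X]leUx; apply/andP; split; last first.
  by apply/andP; split; apply/inA_le; [exact: leUl|exact: leUr].
have : inA a <= inA a `|` inA a' by exact: leUl.
have : inA a' <= inA a `|` inA a' by exact: leUr.
have [[c _ ->]|[b ->]] := hsum_case (inA a `|` inA a').
  by move=> /inA_le h /inA_le h'; apply/inA_le; rewrite leUx h h'.
by move=> /inA_inB[-> ->] /inA_inB[-> _]; rewrite joinxx inA_bot.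
Qed.

Lemma inB_join b b' : inB (b `|` b') = inB b `|` inB b'.
Proof.
apply: le_anti; rewrite [X in _ && X]leUx; apply/andP; split; last first.
  by apply/andP; split; apply/inB_le; [exact: leUl|exact: leUr].
have : inB b <= inB b `|` inB b' by exact: leUl.
have : inB b' <= inB b `|` inB b' by exact: leUr.
have [[c _ ->]|[c ->]] := hsum_case (inB b `|` inB b').
  by move=> _ _; exact: inB_inA.
by move=> /inB_le h /inB_le h'; apply/inB_le; rewrite leUx h h'.
Qed.

Lemma inA_top : inA \top = \top.
Proof.
apply/eqP; rewrite -le1x; have [[c _ ->]|[c ->]] := hsum_case \top.
  by apply/inA_le; exact: lex1.
exact: inB_inA.
Qed.

Lemma inB_bot : inB \bot = \bot.
Proof.
apply/eqP; rewrite -lex0; have [[c _ ->]|[c ->]] := hsum_case \bot.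
  exact: inB_inA.
by apply/inB_le; exact: le0x.
Qed.

Definition partA (p : set (hsum A B)) : set A := [set a | p (inA a)].
Definition partB (p : set (hsum A B)) : set B := [set b | p (inB b)].

Lemma partA_prime p : prime p -> ~ p (inB \top) -> prime (partA p).
Proof.
move=> pp np; split; rewrite /partA /=.
- by rewrite inA_top; exact: prime_top.
- by rewrite inA_bot.
- by move=> x y; rewrite inA_meet; exact: prime_meet.
- by move=> x y; rewrite inA_join; exact: prime_join.
Qed.

Lemma partB_prime p : prime p -> p (inB \top) -> prime (partB p).
Proof.
move=> pp np; split; rewrite /partB //=.
- by rewrite inB_bot; exact: prime_bot.
- by move=> x y; rewrite inB_meet; exact: prime_meet.
- by move=> x y; rewrite inB_join; exact: prime_join.
Qed.

Lemma partA_sub p q : prime p -> ~ p (inB \top) ->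
  p [<=] q <-> partA p [<=] partA q.
Proof.
move=> pp np; split=> sub a pa; first exact: sub.
have [[c _ e]|[b e]] := hsum_case a; rewrite e in pa *; first exact: sub.
by case: np; apply: (prime_up pp) pa _; apply/inB_le; exact: lex1.
Qed.

Lemma partB_sub p q : prime q -> q (inB \top) ->
  p [<=] q <-> partB p [<=] partB q.
Proof.
move=> pp np; split=> sub a pa; first exact: sub.
have [[c _ e]|[b e]] := hsum_case a; rewrite e in pa *; last exact: sub.
exact: (prime_up pp) np (inB_inA _ _).
Qed.

Lemma side_sub p q : prime p -> prime q -> ~ p (inB \top) -> q (inB \top) -> p [<=] q.
Proof.
move=> pp pq np nq x px; have [[c _ e]|[b e]] := hsum_case x; rewrite e in px *.
  exact: (prime_up pq) nq (inB_inA _ _).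
by case: np; apply: (prime_up pp) px _; apply/inB_le; exact: lex1.
Qed.

(** A prime filter of the sum is one of [B] if it contains the top of [B] and one of [A] otherwise,
    and all of the latter lie below all of the former. So incomparable pairs stay within one
    summand; even ladder numbers are reserved for [B] and odd ones for [A]. *)
Lemma hsum_ladder : one_generated A -> ladder B -> ladder (hsum A B).
Proof.
move=> /one_generated_ladder[LA [LA1 LA2 LA3]] [LB [LB1 LB2 LB3]].
exists (fun p c m => if pselect (p (inB \top))
   then exists2 c', c = (c'.+1 + c'.+1)%N & LB (partB p) c' m
   else exists2 c', c = (c' + c').+1 & LA (partA p) c' m); split.
- move=> p c c' m m'; case: pselect => _ [c1 -> h] [c2 -> h'].
    by have [-> ->] := LB1 _ _ _ _ _ h h'.
  by have [-> ->] := LA1 _ _ _ _ _ h h'.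
- move=> p q pp pq [npq nqp]; case: pselect => hp; case: pselect => hq.
  + have [|||c [m cm]] := LB2 (partB p) (partB q).
    * exact: partB_prime.
    * exact: partB_prime.
    * by split; [move=> /(partB_sub p pq hq)|move=> /(partB_sub q pp hp)].
    by exists (c.+1 + c.+1)%N, m; case: cm => [[? ?]|[? ?]]; [left|right]; split; exists c.
  + by case: nqp; exact: side_sub.
  + by case: npq; exact: side_sub.
  + have [|||c [m cm]] := LA2 (partA p) (partA q).
    * exact: partA_prime.
    * exact: partA_prime.
    * by split; [move=> /(partA_sub q pp hp)|move=> /(partA_sub p pq hq)].
    by exists (c + c).+1, m; case: cm => [[? ?]|[? ?]]; [left|right]; split; exists c.
- move=> p q c m k pp pq [sub nsub]; case: pselect => hp; case: pselect => hq.
  + move=> [c1 e h] [c2 e' h']; have ec : c2 = c1 by lia.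
    subst c2; apply: LB3 h h'; [exact: partB_prime|exact: partB_prime|].
    by split; [apply/(partB_sub p pq hq)|move=> /(partB_sub q pp hp)].
  + by move=> [c1 e h] [c2 e' h']; lia.
  + by move=> [c1 e h] [c2 e' h']; lia.
  + move=> [c1 e h] [c2 e' h']; have ec : c2 = c1 by lia.
    subst c2; apply: LA3 h h'; [exact: partA_prime|exact: partA_prime|].
    by split; [apply/(partA_sub q pp hp)|move=> /(partA_sub p pq hq)].
Qed.

End SumPrimes.

Lemma bigsum_ladder n (A : 'I_n -> heyting) (B : heyting) :
  (forall i, one_generated (A i)) -> one_generated B ->
  ladder (\big[hsum/B]_(i < n) A i).
Proof.
move=> hA hB; elim: n A hA => [|n IH] A hA.
  by rewrite big_ord0; exact: one_generated_ladder.
by rewrite big_ord_recl; apply: hsum_ladder; [exact: hA|exact: IH].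
Qed.

(** The equation [t = \top] defines a variety, and every generator of [KG] has ladders. *)
Lemma KG_term (t : term) (C : heyting) : KG C ->
  (forall H, ladder H -> forall v : nat -> H, eval v t = \top) ->
  forall v : nat -> C, eval v t = \top.
Proof.
move=> KGC lad v.
have h : models (fun s s' => s = t /\ s' = Top) C; last exact: (h t Top).
apply: KGC; first by exists (fun s s' => s = t /\ s' = Top).
move=> A [n [S [B [hS hB ->]]]] s s' [-> ->] w /=; apply: lad.
exact: bigsum_ladder.
Qed.

(** * Order constraints on the prime filters above a given one *)

Section KGSpectrum.
Context (C : heyting) (KGC : KG C) (r : set C) (rr : prime r).
Implicit Types p q : set C.

Let X p := prime p /\ r [<=] p.

Let val3 (x y z w : C) (i : nat) : C := nth \bot [:: x; y; z; w] i.

Let not_r_imp x y p : X p -> p x -> ~ p y -> ~ r (himp x y).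
Proof. by move=> [pp rp] px py /(prime_imp _ _ rr)/(_ p pp rp px). Qed.

Let meet_separator p q s : prime p -> prime q -> prime s ->
  ~ p [<=] q -> ~ p [<=] s -> exists x, [/\ p x, ~ q x & ~ s x].
Proof.
move=> pp pq ps /proper_witness[x [px qx]] /proper_witness[y [py sy]].
exists (x `&` y); split; first exact/(prime_meet pp).
  by move=> /(prime_meet pq)[].
by move=> /(prime_meet ps)[].
Qed.

(** A failure of the equation in an algebra with ladders gives three pairwise incomparable prime
    filters, whose numbers on one ladder would pairwise differ by one, against parity. In [C] it is
    refuted by three elements, each lying in exactly one of the given prime filters. *)
Lemma KG_width2 p q s : X p -> X q -> X s -> p [#] q -> p [#] s -> q [#] s -> False.
Proof.
move=> Xp Xq Xs [pq qp] [ps sp] [qs sq].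
have [x [px qx sx]] := meet_separator Xp.1 Xq.1 Xs.1 pq ps.
have [y [qy py sy]] := meet_separator Xq.1 Xp.1 Xs.1 qp qs.
have [z [sz pz qz]] := meet_separator Xs.1 Xp.1 Xq.1 sp sq.
have e : eval (val3 x y z z)
  (Join (Imp (Var 0) (Join (Var 1) (Var 2)))
  (Join (Imp (Var 1) (Join (Var 0) (Var 2)))
        (Imp (Var 2) (Join (Var 0) (Var 1))))) = \top.
  apply: (KG_term KGC) => H [L [L1 L2 L3]] v.
  apply: contrapT => /not_top_prime[u [pu]] /=; set a := v 0%N; set b := v 1%N; set c := v 2%N.
  move=> /(prime_join pu)/not_orP[/(not_prime_imp pu)[p1 [pp1 _ pa npa]]].
  move=> /(prime_join pu)/not_orP[/(not_prime_imp pu)[p2 [pp2 _ pb npb]]].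
  move=> /(not_prime_imp pu)[p3 [pp3 _ pc npc]].
  have Jn (P : set H) x1 x2 : prime P -> ~ P (x1 `|` x2) -> ~ P x1 /\ ~ P x2.
    by move=> pP /(prime_join pP)/not_orP.
  move: npa npb npc => /(Jn _ _ _ pp1)[? ?] /(Jn _ _ _ pp2)[? ?] /(Jn _ _ _ pp3)[? ?].
  have [c1 [m1 h1]] : exists c m, L p1 c m /\ L p2 c m.+1 \/ L p1 c m.+1 /\ L p2 c m.
    by apply: L2 => //; split=> s12; [have := s12 _ pa|have := s12 _ pb].
  have [c2 [m2 h2]] : exists c m, L p1 c m /\ L p3 c m.+1 \/ L p1 c m.+1 /\ L p3 c m.
    by apply: L2 => //; split=> s12; [have := s12 _ pa|have := s12 _ pc].
  have [c3 [m3 h3]] : exists c m, L p2 c m /\ L p3 c m.+1 \/ L p2 c m.+1 /\ L p3 c m.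
    by apply: L2 => //; split=> s12; [have := s12 _ pb|have := s12 _ pc].
  case: h1 h2 h3 => [] [g1 g2] [] [g3 g4] [] [g5 g6];
  have [_ e1] := L1 _ _ _ _ _ g1 g3; have [_ e2] := L1 _ _ _ _ _ g2 g5;
  have [_ e3] := L1 _ _ _ _ _ g4 g6; lia.
have : r \top by exact: prime_top.
rewrite -e /= => /(prime_join rr)[|/(prime_join rr)[|]].
- by apply: (not_r_imp Xp) => // /(prime_join Xp.1)[].
- by apply: (not_r_imp Xq) => // /(prime_join Xq.1)[].
- by apply: (not_r_imp Xs) => // /(prime_join Xs.1)[].
Qed.

(** Along a ladder the numbers drop by at least two at each strict inclusion, hence by four from
    [q1] to [q3], while both stay within one of the number of [p]. The nested implications of the
    term describe the chain of three. *)
Lemma KG_degree2 p q1 q2 q3 : X p -> X q1 -> X q2 -> X q3 ->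
  q1 [<] q2 -> q2 [<] q3 -> p [#] q1 -> p [#] q3 -> False.
Proof.
move=> Xp X1 X2 X3 [s12 /proper_witness[u [u2 u1]]] [s23 /proper_witness[w [w3 w2]]].
move=> [_ /proper_witness[f [f1 fp]]] [/proper_witness[e [ep e3]] _].
have eq : eval (val3 e f u w)
  (Join (Imp (Var 0) (Var 1))
  (Imp (Var 1) (Join (Var 2) (Imp (Var 2) (Join (Var 3) (Imp (Var 3) (Var 0))))))) = \top.
  apply: (KG_term KGC) => H [L [L1 L2 L3]] v.
  apply: contrapT => /not_top_prime[r' [pr]] /=.
  set a := v 0%N; set b := v 1%N; set c := v 2%N; set d := v 3%N.
  move=> /(prime_join pr)/not_orP[/(not_prime_imp pr)[x [px _ xa xb]]].
  move=> /(not_prime_imp pr)[y1 [py1 _ y1b]] /(prime_join py1)/not_orP[y1c].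
  move=> /(not_prime_imp py1)[y2 [py2 sy12 y2c]] /(prime_join py2)/not_orP[y2d].
  move=> /(not_prime_imp py2)[y3 [py3 sy23 y3d y3a]].
  have i1 : x [#] y1 by split=> s; [apply: y3a; apply/sy23/sy12/s|apply: xb; exact: s].
  have i2 : x [#] y2 by split=> s; [apply: y3a; apply/sy23/s|apply: xb; exact/s/sy12].
  have i3 : x [#] y3 by split=> s; [apply: y3a; apply/s|apply: xb; exact/s/sy23/sy12].
  have p12 : y1 [<] y2 by split=> // s; apply: y1c; exact: s.
  have p23 : y2 [<] y3 by split=> // s; apply: y2d; exact: s.
  have [c1 [m1 h1]] := L2 _ _ px py1 i1; have [c2 [m2 h2]] := L2 _ _ px py2 i2.
  have [c3 [m3 h3]] := L2 _ _ px py3 i3.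
  case: h1 h2 h3 => [] [g1 g2] [] [g3 g4] [] [g5 g6];
  have [ec1 e1] := L1 _ _ _ _ _ g1 g3; have [ec2 e2] := L1 _ _ _ _ _ g1 g5;
  subst; have := L3 _ _ _ _ _ py1 py2 p12 g2 g4; have := L3 _ _ _ _ _ py2 py3 p23 g4 g6;
  lia.
have : r \top by exact: prime_top.
rewrite -eq /= => /(prime_join rr)[|]; first exact: (not_r_imp Xp).
apply: (not_r_imp X1) => // /(prime_join X1.1)[//|].
move=> /s12/(prime_mp X2.1)/(_ u2)/(prime_join X2.1)[//|].
by move=> /s23/(prime_mp X3.1)/(_ w3).
Qed.

(** All four cross pairs are incomparable. On a ladder the numbers of [q1] and [q2] then lie one
    above and one below that of [p1]; symmetrically the number of [p1] is one above that of [q1], a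
    contradiction. *)
Lemma KG_no22 p1 p2 q1 q2 : X p1 -> X p2 -> X q1 -> X q2 ->
  p1 [<] p2 -> q1 [<] q2 -> ~ p1 [<=] q2 -> ~ q1 [<=] p2 -> False.
Proof.
move=> Xp1 Xp2 Xq1 Xq2 [sp /proper_witness[u [u2 u1]]] [sq /proper_witness[w [w2 w1]]].
move=> /proper_witness[e [ep eq]] /proper_witness[f [fq fp]].
have et : eval (val3 e f u w)
  (Join (Imp (Var 0) (Join (Var 2) (Imp (Var 2) (Var 1))))
                       (Imp (Var 1) (Join (Var 3) (Imp (Var 3) (Var 0))))) = \top.
  apply: (KG_term KGC) => H [L [L1 L2 L3]] v.
  apply: contrapT => /not_top_prime[r' [pr]] /=.
  set a := v 0%N; set b := v 1%N; set c := v 2%N; set d := v 3%N.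
  move=> /(prime_join pr)/not_orP[/(not_prime_imp pr)[x1 [px1 _ x1a]]].
  move=> /(prime_join px1)/not_orP[x1c /(not_prime_imp px1)[x2 [px2 sx x2c x2b]]].
  move=> /(not_prime_imp pr)[y1 [py1 _ y1b]] /(prime_join py1)/not_orP[y1d].
  move=> /(not_prime_imp py1)[y2 [py2 sy y2d y2a]].
  have i11 : x1 [#] y1 by split=> s; [apply: y2a; exact/sy/s|apply: x2b; exact/sx/s].
  have i12 : x1 [#] y2 by split=> s; [apply: y2a; exact/s|apply: x2b; exact/sx/s/sy].
  have i21 : x2 [#] y1 by split=> s; [apply: y2a; exact/sy/s/sx|apply: x2b; exact/s].
  have i22 : x2 [#] y2 by split=> s; [apply: y2a; exact/s/sx|apply: x2b; exact/s/sy].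
  have px : x1 [<] x2 by split=> // s; apply: x1c; exact: s.
  have py : y1 [<] y2 by split=> // s; apply: y1d; exact: s.
  have [c1 [m1 h1]] := L2 _ _ px1 py1 i11; have [c2 [m2 h2]] := L2 _ _ px1 py2 i12.
  have [c3 [m3 h3]] := L2 _ _ px2 py1 i21; have [c4 [m4 h4]] := L2 _ _ px2 py2 i22.
  case: h1 => [[g1 g2]|[g1 g2]]; case: h2 => [[g3 g4]|[g3 g4]];
  case: h3 => [[g5 g6]|[g5 g6]]; case: h4 => [[g7 g8]|[g7 g8]];
  have [ec1 e1] := L1 _ _ _ _ _ g1 g3; have [ec2 e2] := L1 _ _ _ _ _ g2 g6;
  have [ec3 e3] := L1 _ _ _ _ _ g4 g8; have [ec4 e4] := L1 _ _ _ _ _ g5 g7;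
  subst; have := L3 _ _ _ _ _ px1 px2 px g1 g5; have := L3 _ _ _ _ _ py1 py2 py g2 g4;
  lia.
have : r \top by exact: prime_top.
rewrite -et /= => /(prime_join rr)[|].
  apply: (not_r_imp Xp1) => // /(prime_join Xp1.1)[//|].
  by move=> /sp/(prime_mp Xp2.1)/(_ u2).
apply: (not_r_imp Xq1) => // /(prime_join Xq1.1)[//|].
by move=> /sq/(prime_mp Xq2.1)/(_ w2).
Qed.

End KGSpectrum.

(** * Algebras of upsets *)

Record frame := Frame {
  point :> Type;
  fle : point -> point -> Prop;
  fle_refl : forall x, fle x x;
  fle_trans : forall y x z, fle x y -> fle y z -> fle x z;
  fle_anti : forall x y, fle x y -> fle y x -> x = y
}.

Definition fupset (G : frame) (V : G -> Prop) := forall x y, V x -> fle x y -> V y.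

(* [rho] identifies [H] with the algebra of all upsets of [G]. *)
Record dual (H : heyting) (G : frame) (rho : H -> G -> Prop) : Prop := Dual {
  dual_up : forall x, fupset (rho x);
  dual_le : forall x y, x <= y <-> forall g, rho x g -> rho y g;
  dual_onto : forall V, fupset V -> exists x, forall g, rho x g <-> V g
}.

Section DualOps.
Context (H : heyting) (G : frame) (rho : H -> G -> Prop) (D : dual rho).

Lemma dual_eq x y : (forall g, rho x g <-> rho y g) -> x = y.
Proof.
by move=> e; apply: le_anti; apply/andP; split; apply/(dual_le D) => g; apply e.
Qed.

Lemma dual_top g : rho \top g.
Proof.
have [|x xP] := dual_onto D (V := fun _ => True); first by [].
by apply: ((dual_le D x \top).1 (lex1 _)); apply/xP.
Qed.

Lemma dual_bot g : ~ rho \bot g.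
Proof.
have [|x xP] := dual_onto D (V := fun _ => False); first by [].
by move=> /((dual_le D \bot x).1 (le0x _))/xP.
Qed.

Lemma dual_meet x y g : rho (x `&` y) g <-> rho x g /\ rho y g.
Proof.
have [|z zP] := dual_onto D (V := fun g => rho x g /\ rho y g).
  by move=> a b [xa ya] ab; split; [exact: dual_up D _ _ _ xa ab|exact: dual_up D _ _ _ ya ab].
suff -> : x `&` y = z by exact: zP.
apply: le_anti; apply/andP; split.
  apply/(dual_le D) => a h; apply/zP.
  by split; move: a h; apply/(dual_le D); [exact: leIl|exact: leIr].
by rewrite lexI; apply/andP; split; apply/(dual_le D) => a /zP[].
Qed.

Lemma dual_join x y g : rho (x `|` y) g <-> rho x g \/ rho y g.
Proof.
have [|z zP] := dual_onto D (V := fun g => rho x g \/ rho y g).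
  by move=> a b [xa|ya] ab; [left|right];
    [exact: dual_up D _ _ _ xa ab|exact: dual_up D _ _ _ ya ab].
suff -> : x `|` y = z by exact: zP.
apply: le_anti; apply/andP; split.
  by rewrite leUx; apply/andP; split; apply/(dual_le D) => a h; apply/zP; [left|right].
by apply/(dual_le D) => a /zP[]; move: a; apply/(dual_le D); [exact: leUl|exact: leUr].
Qed.

Lemma dual_imp x y g : rho (himp x y) g <->
  forall k, fle g k -> rho x k -> rho y k.
Proof.
have [|z zP] := dual_onto D (V := fun g => forall k, fle g k -> rho x k -> rho y k).
  by move=> a b h ab k bk; apply: h; exact: fle_trans ab bk.
suff -> : himp x y = z by exact: zP.
apply: le_anti; apply/andP; split.
  apply/(dual_le D) => a h; apply/zP => k ak xk.
  apply: ((dual_le D _ _).1 (himpP x y)); apply/dual_meet; split=> //.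
  exact: dual_up D _ _ _ h ak.
rewrite le_himp; apply/(dual_le D) => a /dual_meet[/zP h xa].
exact: h (fle_refl _) xa.
Qed.

Definition dual_point (g : G) : set H := [set x | rho x g].

Lemma dual_point_prime g : prime (dual_point g).
Proof.
split; rewrite /dual_point /=.
- exact: dual_top.
- exact: dual_bot.
- by move=> x y; exact: dual_meet.
- by move=> x y; exact: dual_join.
Qed.

End DualOps.

Definition frame_type (G : frame) : Type := G.

Section FrameAlgebra.
Context (G : frame).
Local Notation T := (frame_type G).

HB.instance Definition _ := gen_eqMixin T.
HB.instance Definition _ := gen_choiceMixin T.

Let leb (x y : T) : bool := `[< fle x y >].

Let leb_refl : reflexive leb. Proof. by move=> x; apply/asboolP/fle_refl. Qed.

Let leb_anti : antisymmetric leb.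
Proof. by move=> x y /andP[/asboolP xy /asboolP yx]; exact: fle_anti xy yx. Qed.

Let leb_trans : transitive leb.
Proof.
by move=> y x z /asboolP xy /asboolP yz; apply/asboolP; exact: fle_trans xy yz.
Qed.

HB.instance Definition _ := Order.Le_isPOrder.Build (Order.Disp tt tt) T
  leb_refl leb_anti leb_trans.

Lemma frame_dual : exists (H : heyting) (rho : H -> G -> Prop), dual rho.
Proof.
exists (upset_heyting T), (fun U g => sval (U : upsets T) g); split.
- move=> [U hU] x y /= Ux xy; apply: hU Ux _; exact/asboolP.
- by move=> x y; split=> [/order_leP //|h]; apply/order_leP.
- move=> V hV; have hV' : upset (V : set T).
    by move=> x y Vx /asboolP; exact: hV Vx.
  by exists (exist _ (V : set T) hV').
Qed.

End FrameAlgebra.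

(** * Partial p-morphisms and the frames of the algebras at hand *)

Section PMorphism.
Context (G G' : frame) (X : G -> Prop) (k : G -> G').

Record pmorphism : Prop := PMorphism {
  pm_up : fupset X;
  pm_mono : forall x y, X x -> fle x y -> fle (k x) (k y);
  pm_back : forall x y', X x -> fle (k x) y' -> exists2 y, fle x y & k y = y';
  pm_onto : forall y', exists2 y, X y & k y = y'
}.

(** Restriction to the upset [X] is a quotient of [H], and preimages under [k] embed the upsets of
    [G'] into those of [X]. *)
Lemma pmorphism_variety (K : heyting -> Prop) (H H' : heyting) rho rho' :
  @dual H G rho -> @dual H' G' rho' -> variety K -> pmorphism -> K H -> K H'.
Proof.
move=> D D' vK pm KH.
apply: (@relation_variety K H H'
  (fun x x' => forall g, X g -> rho x g <-> rho' x' (k g))) => //.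
- move=> x'; have [|x xP] := dual_onto D (V := fun g => X g /\ rho' x' (k g)).
    move=> a b [Xa ra] ab; split; first exact: (pm_up pm) Xa ab.
    exact: dual_up D' _ _ _ ra (pm_mono pm Xa ab).
  by exists x => g Xg; rewrite xP; split=> [[]|].
- move=> b x y bx bY; apply: (dual_eq D') => g; have [a Xa <-] := pm_onto pm g.
  by rewrite -bx // bY.
- by move=> g _; split=> [/(dual_bot D)|/(dual_bot D')].
- by move=> g _; split=> _; [exact: dual_top D' _|exact: dual_top D _].
- by move=> b x c y bx cy g Xg; rewrite (dual_meet D) (dual_meet D') bx // cy.
- by move=> b x c y bx cy g Xg; rewrite (dual_join D) (dual_join D') bx // cy.
- move=> b x c y bx cy g Xg; rewrite (dual_imp D) (dual_imp D'); split=> h a ga.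
    have [a' ga' <-] := pm_back pm Xg ga; have Xa' := pm_up pm Xg ga'.
    by rewrite -bx // -cy //; exact: h.
  have Xa := pm_up pm Xg ga.
  by rewrite bx // cy //; apply: h; exact: pm_mono.
Qed.

End PMorphism.

Definition unit_frame : frame.
Proof. by refine (@Frame unit (fun _ _ => True) _ _ _) => // -[] []. Defined.

Definition bool_frame : frame.
Proof. by refine (@Frame bool (fun x y => x = y) _ _ _) => // x y z -> ->. Defined.

Definition X2_frame : frame.
Proof.
refine (@Frame X2_point (fun x y => X2_le x y) X2_le_refl X2_le_trans _).
by move=> x y xy yx; apply: X2_le_anti; rewrite xy.
Defined.

Section SumFrame.
Context (G1 G2 : frame).

Definition sum_fle (x y : G1 + G2) : Prop :=
  match x, y with
  | inl a, inl b => fle a b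
  | inr a, inr b => fle a b
  | inl _, inr _ => True
  | inr _, inl _ => False
  end.

Definition sum_frame : frame.
Proof.
refine (@Frame (G1 + G2)%type sum_fle _ _ _).
- by case=> x; exact: fle_refl.
- by move=> [y|y] [x|x] [z|z] //=; exact: fle_trans.
- by move=> [x|x] [y|y] //= xy yx; congr (_ _); exact: fle_anti.
Defined.

End SumFrame.

Section OsumFrame.
Context (G : nat -> frame).

Inductive osum_fle : {n & G n} -> {n & G n} -> Prop :=
  | OsumLayer n (a b : G n) : fle a b -> osum_fle (existT _ n a) (existT _ n b)
  | OsumAbove n m (a : G n) (b : G m) : (n < m)%N ->
      osum_fle (existT _ n a) (existT _ m b).

Lemma osum_fle_inv n m (a : G n) (b : G m) :
  osum_fle (existT _ n a) (existT _ m b) ->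
  (n < m)%N \/ exists e : n = m, fle (eq_rect n (fun k => G k) a m e) b.
Proof.
move=> h; inversion h as [k u v uv [en eu] [em ev]|]; last by left.
subst k; subst m; right; exists erefl => /=.
by rewrite -(eq_from_Tagged eu).
Qed.

Lemma osum_fleE n (a b : G n) : osum_fle (existT _ n a) (existT _ n b) <-> fle a b.
Proof.
split=> [/osum_fle_inv[|[e]]|]; last exact: OsumLayer.
  by rewrite ltnn.
by rewrite (Prop_irrelevance e erefl).
Qed.

Definition osum_frame : frame.
Proof.
refine (@Frame {n & G n} osum_fle _ _ _).
- by case=> n a; apply: OsumLayer; exact: fle_refl.
- move=> [m b] [n a] [l c] /osum_fle_inv[nm|[e h]] /osum_fle_inv[ml|[e' h']]; subst.
  + by apply: OsumAbove; exact: ltn_trans ml.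
  + exact: OsumAbove.
  + exact: OsumAbove.
  + by apply: OsumLayer; exact: fle_trans h h'.
- move=> [n a] [m b] /osum_fle_inv[nm|[e h]] /osum_fle_inv[ml|[e' h']]; subst; try lia.
  by move: h h'; rewrite (Prop_irrelevance e' erefl) /= => h h'; rewrite (fle_anti h h').
Defined.

End OsumFrame.

Lemma two_dual : dual (fun (x : two) (_ : unit_frame) => (x : bool)).
Proof.
split.
- by move=> x g h xg _.
- move=> x y; split=> [/order_leP /= xy _|h]; first by move: x y xy => [] [].
  by apply/order_leP => /=; move: x y h => [] [] // /(_ tt isT).
- move=> V hV; have [Vt|nV] := pselect (V tt).
    by exists true => -[].
  by exists false => -[].
Qed.

Lemma D2_dual : dual (fun (x : D2) (g : bool_frame) =>
  (if g then (x : bool * bool).2 else (x : bool * bool).1) : Prop).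
Proof.
split.
- by move=> x g h xg <-.
- have leb (x y : bool) : (x <= y) <-> (x -> y).
    by case: x y => [] []; split=> // /(_ isT).
  move=> x y; split=> [/order_leP /=|h].
    by case: x y => [x1 x2] [y1 y2] /andP[/leb h1 /leb h2] [].
  apply/order_leP; case: x y h => [x1 x2] [y1 y2] h /=.
  by apply/andP; split; apply/leb; [exact: (h false)|exact: (h true)].
- move=> V hV; exists (`[< V false >], `[< V true >]) => -[] /=;
  by split=> [/asboolP //|h]; exact/asboolP.
Qed.

Lemma X2_dual : dual (fun (x : X2) (g : X2_frame) => sval (x : upsets X2_point) g).
Proof.
split.
- by move=> [U hU] x y /= Ux xy; apply: hU Ux _.
- by move=> x y; split=> [/order_leP //|h]; apply/order_leP.
- move=> V hV; have hV' : upset (V : set X2_point).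
    by move=> x y Vx; exact: hV Vx.
  by exists (exist _ (V : set X2_point) hV').
Qed.

Definition layer (b : bool) : heyting := if b then X2 else D2.
Definition layer_frame (b : bool) : frame := if b then X2_frame else bool_frame.

Lemma layer_dual b : exists rho : layer b -> layer_frame b -> Prop, dual rho.
Proof. by case: b; eexists; [exact: X2_dual|exact: D2_dual]. Qed.

(** The upper summand [A] supplies the lower points: a nonzero element of [A] lies above [B], so its
    upset contains all of [GB]. *)
Lemma hsum_dual A B GA GB rA rB : @dual A GA rA -> @dual B GB rB ->
  exists rho : hsum A B -> sum_frame GA GB -> Prop, dual rho.
Proof.
move=> DA DB.
exists (fun x g => match (x : sum_carrier A B), g with
  | inl a, inl g => rA (val a) g
  | inl _, inr _ => True
  | inr _, inl _ => False
  | inr b, inr g => rB b g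
  end); split.
- move=> [a|b] [x|x] [y|y] //=; [exact: dual_up DA _ _ _|exact: dual_up DB _ _ _].
- move=> [a|b] [a'|b']; rewrite hsum_leE /=.
  + rewrite (dual_le DA); split=> [h [g|g] //|h g]; first exact: h.
    exact: (h (inl g)).
  + split=> // h; have : val a != \bot by exact: (valP a).
    rewrite -lex0 => /negP[]; apply/(dual_le DA) => g ag.
    by case: (h (inl g) ag).
  + by split=> // _ [].
  + rewrite (dual_le DB); split=> [h [g|g] //|h g]; first exact: h.
    exact: (h (inr g)).
- move=> V hV.
  have [|a aP] := dual_onto DA (V := fun g => V (inl g)).
    by move=> x y Vx xy; apply: hV Vx _.
  have [|b bP] := dual_onto DB (V := fun g => V (inr g)).
    by move=> x y Vx xy; apply: hV Vx _.
  have [ea|a0] := eqVneq a \bot.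
    exists (inr b) => -[g|g]; last exact: bP.
    by rewrite -aP ea; split=> // /(dual_bot DA).
  exists (inl (mk_nonbot a0)) => -[g|g]; first exact: aP.
  split=> // _; apply: contrapT => nV.
  move: a0; rewrite -lex0 => /negP[]; apply/(dual_le DA) => g' /aP Vg'.
  by case: nV; apply: hV Vg' _.
Qed.

Lemma osum_dual (A : nat -> heyting) (G : nat -> frame) :
  (forall n, exists rho : A n -> G n -> Prop, dual rho) ->
  exists rho : osum A -> osum_frame G -> Prop, dual rho.
Proof.
move=> DA; pose rho n := sval (cid (DA n)).
have D n : dual (rho n) := svalP (cid (DA n)).
have le_iff (x y : osum A) : x <= y <-> osum_le x y.
  by split=> [/order_leP|h]; last exact/order_leP.
(* The upset generated by the points of [a] and by all later layers. The existential form avoids a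
   transport between the layer of [g] and layer [n]. *)
pose R (x : osum A) (g : osum_frame G) : Prop :=
  if (x : osum_carrier A) is Some (existT n a) then
    exists h : osum_frame G, fle h g /\
      ((exists2 m, (n < m)%N & exists u : G m, h = existT _ m u) \/
       exists2 u, rho n (val a) u & h = existT _ n u)
  else False.
have RE n (a : nonbot (A n)) m (g : G m) : R (in_layer a) (existT _ m g) <->
    (n < m)%N \/ exists e : m = n, rho n (val a) (eq_rect m (fun k => G k) g n e).
  split.
    move=> [h [hg [[l nl [u e]]|[u ru e]]]]; subst h.
      by case: (osum_fle_inv hg) => [lm|[e _]]; left; lia.
    case: (osum_fle_inv hg) => [nm|[e h]]; first by left.
    by subst m; right; exists erefl; exact: dual_up (D n) _ _ _ ru h.
  move=> [nm|[e ru]].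
    by exists (existT _ m g); split; [exact: fle_refl|left; exists m => //; exists g].
  subst m; exists (existT _ n g); split; first exact: fle_refl.
  by right; exists g.
have REn n (a : nonbot (A n)) (g : G n) : R (in_layer a) (existT _ n g) <-> rho n (val a) g.
  rewrite RE; split=> [[|[e]]|h]; first by rewrite ltnn.
    by rewrite (Prop_irrelevance e erefl).
  by right; exists erefl.
have nonempty n (a : nonbot (A n)) : exists g, rho n (val a) g.
  apply: contrapT => no; have : val a != \bot by exact: (valP a).
  rewrite -lex0 => /negP[]; apply/(dual_le (D n)) => g ag; case: no; by exists g.
exists R; split.
- move=> [[n a]|] x y //= [h [hx hP]] xy; exists h; split=> //.
  exact: (@fle_trans (osum_frame G) _ _ _ hx xy).
- move=> x y; rewrite le_iff; case: x => [[n a]|]; last by split=> // _; constructor.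
  rewrite -/(in_layer a); case: y => [[m b]|]; last first.
    split=> [h|h]; first by inversion h.
    have [g ag] := nonempty _ a; exfalso.
    by have := h (existT _ n g); apply; apply/REn.
  rewrite -/(in_layer b); split.
    move=> /osum_le_inv[mn|[e ab]] [l g].
      rewrite !RE => -[nl|[e _]]; first by left; lia.
      by left; lia.
    subst m; rewrite !RE => -[nl|[e h]]; first by left.
    by right; exists e; move: ab => /= /(dual_le (D n)); apply.
  move=> h; have [e|nm] := eqVneq n m.
    subst m; apply/osum_leE; apply/(dual_le (D n)) => g /REn/h/REn; exact.
  apply: osum_le_below; have [g /REn/h/RE[//|[e _]]] := nonempty _ a.
  by rewrite e eqxx in nm.
- move=> V hV.
  have [ex|nex] := pselect (exists n, `[< exists g : G n, V (existT _ n g) >]); last first.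
    exists None => -[n g]; split=> // Vg; case: nex; exists n; apply/asboolP; by exists g.
  (* The lowest layer met by [V] carries the representing element, as [V] contains every later
     layer. *)
  case: (ex_minnP ex) => n /asboolP[g Vg] nmin.
  have [|a aP] := dual_onto (D n) (V := fun g => V (existT _ n g)).
    by move=> x y Vx xy; apply: hV Vx _; exact: OsumLayer.
  have a0 : a != \bot.
    by apply: contraPneq Vg => ea Vg; move: Vg => /aP; rewrite ea => /(dual_bot (D n)).
  exists (in_layer (mk_nonbot a0)) => -[m h]; rewrite RE; split=> [[nm|[e]]|Vh].
  + by apply: hV Vg _; exact: OsumAbove.
  + by subst m => /= /aP.
  have : (n <= m)%N by apply: nmin; apply/asboolP; exists h.
  rewrite leq_eqVlt => /orP[/eqP e|]; last by left.
  by subst m; right; exists erefl; apply/aP.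
Qed.

(** * Stacks and infinite sums *)

Definition shift (T : Type) (c : nat -> T) (n : nat) := c n.+1.

Definition stack n (c : nat -> bool) : heyting := \big[hsum/two]_(i < n) layer (c i).

Fixpoint stack_frame n (c : nat -> bool) : frame :=
  if n is m.+1 then sum_frame (layer_frame (c 0)) (stack_frame m (shift c))
  else unit_frame.

Lemma stackS n c : stack n.+1 c = hsum (layer (c 0)) (stack n (shift c)).
Proof.
by rewrite /stack big_ord_recl.
Qed.

Lemma stack_dual n c : exists rho : stack n c -> stack_frame n c -> Prop, dual rho.
Proof.
elim: n c => [|n IH] c.
  by rewrite /stack big_ord0; eexists; exact: two_dual.
rewrite stackS; have [r D] := IH (shift c); have [r' D'] := layer_dual (c 0).
exact: hsum_dual D' D.
Qed.

Lemma eq_stack n c c' : (forall i, (i < n)%N -> c i = c' i) -> stack n c = stack n c'.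
Proof. by move=> e; apply: eq_bigr => i _; rewrite e. Qed.

Fixpoint stack_collapse n : forall c, stack_frame n.+1 c -> stack_frame n c :=
  match n with
  | 0 => fun _ _ => tt
  | m.+1 => fun c x =>
    match x with
    | inl g => inl g
    | inr y => inr (stack_collapse y)
    end
  end.

Lemma stack_collapse_pmorphism n c :
  pmorphism (fun _ => True) (@stack_collapse n c).
Proof.
elim: n c => [|n IH] c.
  split=> // [x [] _ _|[]]; [by exists x => //; exact: fle_refl|by exists (inr tt)].
have [_ mono back onto] := IH (shift c); split=> //.
- by move=> [x|x] [y|y] //= _; exact: mono.
- move=> [x|x] [y|y] //= _ h.
  + by exists (inl y).
  + by have [z _ <-] := onto y; exists (inr z).
  + by have [z xz <-] := back x y I h; exists (inr z).
- move=> [y|y]; first by exists (inl y).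
  by have [z _ <-] := onto y; exists (inr z).
Qed.

(** All layers of index at least [n] are merged into the top point. *)
Definition cutoff n (c : nat -> bool) (x : osum_frame (fun i => layer_frame (c i))) :
  stack_frame n c.
Proof.
elim: n c x => [|n IH] c; first by move=> _; exact: tt.
move=> [[|m] g]; first exact: (inl g).
exact: (inr (IH (shift c) (existT (fun i => layer_frame (shift c i)) m g))).
Defined.

Lemma cutoff_pmorphism n c : pmorphism (fun _ => True) (@cutoff n c).
Proof.
elim: n c => [|n IH] c.
  split=> // [x [] _ _|[]]; first by exists x => //; exact: fle_refl.
  by exists (existT _ 0 (if c 0 as b return layer_frame b then X2a1 else true)).
have [_ mono back onto] := IH (shift c).
have up m (g : layer_frame (shift c m)) m' (g' : layer_frame (shift c m')) :
  @fle (osum_frame (fun i => layer_frame (shift c i))) (existT _ m g) (existT _ m' g') <->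
  @fle (osum_frame (fun i => layer_frame (c i))) (existT _ m.+1 g) (existT _ m'.+1 g').
  split=> /osum_fle_inv[mm|[e h]].
  - exact: OsumAbove.
  - by subst m'; exact: OsumLayer.
  - exact: OsumAbove.
  - case: (e) => e'; subst m'; apply: OsumLayer.
    by move: h; rewrite (Prop_irrelevance e erefl).
split=> //.
- move=> [[|m] g] [[|m'] g'] _ //=.
  + by move=> /osum_fleE.
  + by move=> /osum_fle_inv[|[]].
  + by move=> /up h; exact: mono.
- move=> [[|m] g] [y|y] //= _ h.
  + by exists (existT _ 0 y) => //; exact: OsumLayer.
  + have [[m g'] _ e] := onto y.
    by exists (existT _ m.+1 g'); [exact: OsumAbove|rewrite -e].
  + have [[m' g'] hm e] := back (existT _ m g) y I h.
    by exists (existT _ m'.+1 g'); [exact/up|rewrite -e].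
- move=> [y|y]; first by exists (existT _ 0 y).
  by have [[m g] _ e] := onto y; exists (existT _ m.+1 g) => //; rewrite -e.
Qed.

Lemma cutoff_inj n c x y : @cutoff n c x = @cutoff n c y ->
  x = y \/ (n <= projT1 x)%N /\ (n <= projT1 y)%N.
Proof.
elim: n c x y => [|n IH] c; first by right.
move=> [[|m] g] [[|m'] g'] //=; first by move=> [->]; left.
move=> [/IH[e|b]]; [left|by right].
exact: (congr1 (fun z : {i & layer_frame (shift c i)} =>
  existT (fun i => layer_frame (c i)) (projT1 z).+1 (projT2 z)) e).
Qed.

Lemma pmorphism_eval (G G' : frame) (k : G -> G') (H H' : heyting) rho rho'
  (v : nat -> H) (v' : nat -> H') t :
  @dual H G rho -> @dual H' G' rho' -> pmorphism (fun _ => True) k ->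
  (forall i g, rho (v i) g <-> rho' (v' i) (k g)) ->
  forall g, rho (eval v t) g <-> rho' (eval v' t) (k g).
Proof.
move=> D D' pm vv'.
elim: t => [i|s Hs t Ht|s Hs t Ht|s Hs t Ht||] /= g; first exact: vv'.
- by rewrite (dual_meet D) (dual_meet D') Hs Ht.
- by rewrite (dual_join D) (dual_join D') Hs Ht.
- rewrite (dual_imp D) (dual_imp D'); split=> h a ga.
    have [a' ga' <-] := pm_back pm I ga.
    by rewrite -Hs -Ht; exact: h.
  by rewrite Hs Ht; apply: h; exact: (pm_mono pm).
- by split=> [/(dual_bot D)|/(dual_bot D')].
- by split=> _; [exact: dual_top D' _|exact: dual_top D _].
Qed.

Fixpoint var_bound t : nat :=
  match t with
  | Var i => i.+1
  | Meet s t | Join s t | Imp s t => maxn (var_bound s) (var_bound t)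
  | Bot | Top => 0
  end.

Lemma eq_eval (H : heyting) (v w : nat -> H) t :
  (forall i, (i < var_bound t)%N -> v i = w i) -> eval v t = eval w t.
Proof.
elim: t => //= [i|s Hs t Ht|s Hs t Ht|s Hs t Ht] e; first exact: e;
by rewrite Hs ?Ht // => i ib; apply: e; rewrite leq_max ib ?orbT.
Qed.

(** An equation has finitely many variables, and a nonempty upset contains every layer from some
    index on. So the relevant values of a valuation are preimages under one cutoff, and the equation
    is checked in a finite stack. *)
Lemma osum_variety (K : heyting -> Prop) c : variety K ->
  (forall n, K (stack n c)) -> K (osum (fun i => layer (c i))).
Proof.
move=> [E EP] KS; apply/EP => s t Est v.
have [rho D] := osum_dual (fun i => layer_dual (c i)).
set M := maxn (var_bound s) (var_bound t).
have cut (x : osum (fun i => layer (c i))) : exists N, forall n, (N <= n)%N ->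
    forall g h, @cutoff n c g = @cutoff n c h -> rho x g -> rho x h.
  have [[[m g0] xg0]|no] := pselect (exists g, rho x g); last first.
    by exists 0 => n _ g h _ xg; case: no; exists g.
  exists m.+1 => n mn g h /cutoff_inj[->//|[_ nh]] _.
  apply: (dual_up D xg0); case: h nh => m' h nh; apply: OsumAbove.
  exact: leq_trans mn nh.
have [N NP] : exists N, forall n, (N <= n)%N -> forall i, (i < M)%N ->
    forall g h, @cutoff n c g = @cutoff n c h -> rho (v i) g -> rho (v i) h.
  elim: M => [|M [N NP]]; first by exists 0.
  have [N' NP'] := cut (v M); exists (maxn N N') => n; rewrite geq_max => /andP[Nn N'n] i.
  by rewrite ltnS leq_eqVlt => /orP[/eqP->|]; [exact: NP'|exact: NP].
have [rho' D'] := stack_dual N c; have pm := cutoff_pmorphism N c.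
have lift i : exists x', forall g, (i < M)%N -> rho (v i) g <-> rho' x' (@cutoff N c g).
  have [|x' xP] := dual_onto D' (V := fun y => exists2 g, @cutoff N c g = y & rho (v i) g).
    move=> a b [g <- ig] /(pm_back pm I)[h gh <-]; exists h => //.
    exact: dual_up D _ _ _ ig gh.
  exists x' => g iM; rewrite xP; split=> [ig|[h e ih]]; first by exists g.
  exact: NP (leqnn N) _ iM _ _ e ih.
have [w wP] := choice lift.
(* Only the values of variables below [M] are known to come from the stack; the others are replaced
   by [\bot]. *)
pose v0 i := if (i < M)%N then v i else \bot.
pose w0 i := if (i < M)%N then w i else \bot.
have v0w0 i g : rho (v0 i) g <-> rho' (w0 i) (@cutoff N c g).
  rewrite /v0 /w0; case: ifP => [iM|_]; first exact: wP.
  by split=> [/(dual_bot D)|/(dual_bot D')].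
have vv0 u : (var_bound u <= M)%N -> eval v u = eval v0 u.
  by move=> uM; apply: eq_eval => i iu; rewrite /v0 (leq_trans iu uM).
rewrite !vv0 ?leq_maxl ?leq_maxr //; apply: (dual_eq D) => g.
rewrite !(pmorphism_eval _ D D' pm v0w0).
by rewrite (((EP _).1 (KS N)) _ _ Est).
Qed.

Lemma binary_konig (P : nat -> (nat -> bool) -> Prop) :
  (forall n c c', (forall i, (i < n)%N -> c i = c' i) -> P n c -> P n c') ->
  (forall n c, P n.+1 c -> P n c) -> (forall n, exists c, P n c) ->
  exists c, forall n, P n c.
Proof.
move=> ext dec ex.
have decr m n c : (n <= m)%N -> P m c -> P n c.
  elim: m => [|m IH]; first by rewrite leqn0 => /eqP->.
  by rewrite leq_eqVlt => /orP[/eqP->//|nm] /dec; exact: IH.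
pose good n s := forall m, exists2 c, (forall i, (i < n)%N -> c i = s i) & P m c.
pose upd (s : nat -> bool) n b i := if i == n then b else s i.
have step n s : exists b, good n s -> good n.+1 (upd s n b).
  have [g|ng] := pselect (good n s); last by exists true.
  apply: contrapT => no.
  have bad b : exists m, ~ exists2 c, (forall i, (i < n.+1)%N -> c i = upd s n b i) & P m c.
    by apply/existsNP => gb; apply: no; exists b.
  have [m1 h1] := bad true; have [m2 h2] := bad false.
  (* A sequence for the larger of the two heights continues with one of the two bits and contradicts
     the failure of that bit. *)
  have [c cs Pc] := g (maxn m1 m2).
  have agree : forall i, (i < n.+1)%N -> c i = upd s n (c n) i.
    move=> i; rewrite ltnS leq_eqVlt /upd => /orP[/eqP->|ilt]; first by rewrite eqxx.
    by rewrite (ltn_eqF ilt) cs.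
  case e : (c n); rewrite e in agree; [apply: h1|apply: h2]; exists c => //.
    by apply: decr Pc; exact: leq_maxl.
  by apply: decr Pc; exact: leq_maxr.
have [f fP] := choice (fun p : nat * (nat -> bool) => step p.1 p.2).
pose s := fix s n := if n is m.+1 then upd (s m) m (f (m, s m)) else fun=> true.
have sgood n : good n (s n).
  elim: n => [|n IH]; last exact: (fP (n, s n)).
  by move=> m; have [c Pc] := ex m; exists c.
have agree n i : (i < n)%N -> s n i = s i.+1 i.
  elim: n => // n IH; rewrite ltnS leq_eqVlt => /orP[/eqP->//|ilt].
  by rewrite -IH //= /upd (ltn_eqF ilt).
exists (fun n => s n.+1 n) => n; have [c cs Pc] := sgood n n.
by apply: ext Pc => i ilt; rewrite cs // agree.
Qed.

Lemma stack_pred (K : heyting -> Prop) n c : variety K -> K (stack n.+1 c) -> K (stack n c).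
Proof.
move=> vK; have [r D] := stack_dual n c; have [r' D'] := stack_dual n.+1 c.
exact: (pmorphism_variety D' D vK (stack_collapse_pmorphism n c)).
Qed.

Lemma stacks_osum (K : heyting -> Prop) : variety K ->
  (forall n, exists c, K (stack n c)) -> exists c, K (osum (fun i => layer (c i))).
Proof.
move=> vK ex; have [|||c cP] := @binary_konig (fun n c => K (stack n c)) => //.
- by move=> n c c' /eq_stack->.
- by move=> n c; exact: stack_pred.
by exists c; exact: osum_variety.
Qed.

(** * Zigzags *)

Section ZigzagFrame.
Context (br : nat -> Prop).

Definition zle (i j : nat) := [\/ i = j, (i.+2 <= j)%N | j = i.+1 /\ br i].

Lemma zle_leq i j : zle i j -> (i <= j)%N.
Proof. by case=> [->|h|[-> _]]; lia. Qed.

(* Consecutive points [i], [i.+1] are incomparable unless [br i]; all others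
   are ordered as natural numbers. *)
Definition zigzag : frame.
Proof.
refine (@Frame nat zle _ _ _).
- by move=> i; exact: Or31.
- move=> j i k [->//|ij|[-> bi]] [<-|jk|[-> bj]].
  + exact: Or32.
  + by apply: Or32; lia.
  + by apply: Or32; lia.
  + by apply: Or33.
  + by apply: Or32; lia.
  + by apply: Or32; lia.
- by move=> i j /zle_leq ij /zle_leq ji; lia.
Defined.

End ZigzagFrame.

Section ZigzagSpectrum.
Context (B : heyting) (r : set B) (rr : prime r).
Context (br : nat -> Prop) (z : nat -> set B).
Let X u := prime u /\ r [<=] u.
Hypothesis zX : forall i, X (z i).
Hypothesis z2 : forall i, z i [<] z i.+2.
Hypothesis zbr : forall i, br i -> z i [<] z i.+1.
Hypothesis zinc : forall i, ~ br i -> z i [#] z i.+1.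
Hypothesis zcover : forall i u, X u -> z i [<] u ->
  [\/ u = z i.+1, u = z i.+2 | z i.+1 [<] u].
Hypothesis zdown : forall i u, X u -> z i.+1 [<] u -> z i [<] u.

Let z_far i n : z i [<] z (i + n.+2)%N.
Proof.
elim/ltn_ind: n => -[|[|n]] IH.
- by rewrite !addnS addn0; exact: z2.
- rewrite addnS; apply: zdown; first exact: zX.
  by rewrite -!addnS addnS; rewrite !addnS addn0; exact: z2.
- by have := strict_trans (IH n _) (z2 (i + n.+2)%N); rewrite !addnS; apply.
Qed.

Let z_lt i j : (i.+2 <= j)%N -> z i [<] z j.
Proof. by move=> ij; have := z_far i (j - i.+2); rewrite (_ : (i + _)%N = j) //; lia. Qed.

Let z_le i j : z i [<=] z j <-> zle br i j.
Proof.
split=> [ij|[->//|ij|[-> bi]]]; last 2 first.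
- by case: (z_lt ij).
- by case: (zbr bi).
have [->|ne] := eqVneq i j; first exact: Or31.
have [h|h] := leqP i.+2 j; first exact: Or32.
have [h'|h'] := leqP j.+2 i; first by case: (z_lt h') => _ [].
have [e|e] : j = i.+1 \/ i = j.+1 by lia.
- subst j; apply: Or33; split=> //; apply: contrapT => /zinc[]; exact.
- subst i; have [/zbr[_ []//]|/zinc[_ []//]] := pselect (br j).
Qed.

Let z_inj i j : z i = z j -> i = j.
Proof.
move=> e; have /zle_leq ij : zle br i j by apply/z_le; rewrite e.
have /zle_leq ji : zle br j i by apply/z_le; rewrite e.
by lia.
Qed.

Let Y u := X u /\ (z 0 [<=] u \/ z 1 [<=] u).

Let Y_z i : Y (z i).
Proof.
split=> //; case: i => [|[|i]]; [by left|by right|left].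
by have [] : z 0 [<] z i.+2 by exact: z_lt.
Qed.

(** A prime filter strictly above [z i] and off the zigzag is pushed above [z i.+1] by [zcover],
    hence above every point. These prime filters together act as one limit point. *)
Let Y_cases u : Y u -> (exists i, u = z i) \/ forall i, z i [<=] u.
Proof.
move=> [Xu Yu]; have [ex|no] := pselect (exists i, u = z i); [by left|right].
have neq i : u <> z i by move=> e; apply: no; exists i.
have lt i : z i [<=] u -> z i [<] u.
  by move=> /sub_cases[/esym/neq|].
have z1u : z 1 [<] u.
  by case: Yu => /lt // /(zcover Xu)[/neq|/neq|].
elim=> [|i IH]; first by case: (zdown Xu z1u).
by case: (zcover Xu (lt _ IH)) => [/neq|/neq|[]].
Qed.

(** A nonempty [V] contains all points from some index on, so an element has to avoid only finitely
    many points and can be built from finite meets and joins. *)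
Let realize (V : nat -> Prop) : @fupset (zigzag br) V -> exists b,
  forall u, Y u -> u b <-> (exists2 i, u = z i & V i) \/ (forall i, u <> z i) /\ exists i, V i.
Proof.
move=> Vup; have [[m Vm]|no] := pselect (exists i, V i); last first.
  exists \bot => u [[pu _] _]; split=> [/(prime_bot pu)|[[i _ Vi]|[_ ex]]] //.
  by case: no; exists i.
have big k : (m.+2 <= k)%N -> V k by move=> mk; apply: Vup Vm _; exact: Or32.
have sep l : V l -> exists2 e, z l e & forall k, ~ V k -> ~ z k e.
  move=> Vl.
  have [e le eP] : exists2 e, z l e & forall k, (k < m.+2)%N -> ~ V k -> ~ z k e.
    elim: (m.+2) => [|M [e le eP]]; first by exists \top => //; exact: prime_top (zX l).1.
    have [VM|nVM] := pselect (V M).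
      exists e => // k; rewrite ltnS leq_eqVlt => /orP[/eqP->|]; [by []|exact: eP].
    have /proper_witness[d [ld Md]] : ~ z l [<=] z M.
      by move=> /z_le lM; apply: nVM; exact: Vup Vl lM.
    exists (e `&` d); first exact/(prime_meet (zX l).1).
    move=> k; rewrite ltnS leq_eqVlt => /orP[/eqP->|kM] nVk /(prime_meet (zX _).1)[] //.
    by move=> ke _; exact: eP ke.
  exists e => // k nVk; apply: eP => //.
  by rewrite ltnNge; apply/negP => /big.
(* Indices below [m.+4] suffice: beyond them [z l] contains [z m.+2], and [m.+2] is in [V]. *)
have [b bV bn] : exists2 b, (forall l, (l < m.+4)%N -> V l -> z l b) &
    forall k, ~ V k -> ~ z k b.
  elim: (m.+4) => [|M [b bV bn]].
    by exists \bot => // k _; exact: prime_bot (zX k).1.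
  have [VM|nVM] := pselect (V M); last first.
    exists b => // l; rewrite ltnS leq_eqVlt => /orP[/eqP->|]; [by []|exact: bV].
  have [e Me en] := sep M VM; exists (b `|` e).
    move=> l; rewrite ltnS leq_eqVlt => /orP[/eqP->|lM] Vl; apply/(prime_join (zX _).1).
      by right.
    by left; exact: bV.
  by move=> k nVk /(prime_join (zX _).1)[]; [exact: bn|exact: en].
have zb l : V l -> z l b.
  move=> Vl; have [lm|ml] := ltnP l m.+4; first exact: bV.
  have [+ _] := @z_lt m.+2 l ml; apply; apply: bV; [lia|exact: big].
exists b => u Yu; split=> [ub|[[i -> Vi]|[nu _]]]; last 2 first.
- exact: zb.
- have [[i e]|all_z] := Y_cases Yu; first by case: (nu i).
  by apply: (all_z m); exact: zb.
have [[i e]|no] := pselect (exists i, u = z i).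
  left; exists i => //; subst u; apply: contrapT => nVi; exact: bn nVi ub.
by right; split; [move=> i e; apply: no; exists i|exists m].
Qed.

(** [Y] is an upset of prime filters, hence gives a quotient of [B]. In it, the elements holding at
    the limit primes exactly when they hold somewhere on the zigzag form a subalgebra isomorphic to
    [H]. *)
Lemma zigzag_variety (K : heyting -> Prop) H rho :
  variety K -> K B -> @dual H (zigzag br) rho -> K H.
Proof.
move=> vK KB D.
pose val (x : H) u :=
  (exists2 i, u = z i & rho x i) \/ (forall i, u <> z i) /\ exists i, rho x i.
have valz x i : val x (z i) <-> rho x i.
  split=> [[[j /z_inj->//]|[/(_ i)]]|h] //; by left; exists i.
have valn x u : (forall i, u <> z i) -> val x u <-> exists i, rho x i.
  by move=> nu; split=> [[[i /nu]|[]]|h] //; right.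
have Yup u v : Y u -> prime v -> u [<=] v -> Y v.
  move=> [[pu ru] Yu] pv uv; split; first by split=> //; exact: subset_trans uv.
  by case: Yu => h; [left|right]; exact: subset_trans h uv.
have cofin x i j : rho x i -> (i.+2 <= j)%N -> rho x j.
  by move=> xi ij; apply: (dual_up D) xi _; exact: Or32.
have Ycase (P : set B -> Prop) : (forall i, P (z i)) ->
    (forall u, Y u -> (forall i, u <> z i) -> (forall i, z i [<=] u) -> P u) ->
    forall u, Y u -> P u.
  move=> Pz Pn u Yu; have [[i ->]//|no] := pselect (exists i, u = z i).
  have nu i : u <> z i by move=> e; apply: no; exists i.
  by apply: Pn => //; have [[i /nu]|] := Y_cases Yu.
apply: (@relation_variety K B H (fun b x => forall u, Y u -> u b <-> val x u)) => //.
- by move=> x; have [b bP] := realize (@dual_up _ _ _ D x); exists b.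
- move=> b x y bx bY; apply: (dual_eq D) => i.
  by rewrite -!valz -(bx _ (Y_z i)) (bY _ (Y_z i)).
- apply: (Ycase) => [i|u [[pu _] _] nu _].
    by rewrite valz; split=> [/(prime_bot (zX i).1)|/(dual_bot D)].
  by rewrite valn //; split=> [/(prime_bot pu)|[i /(dual_bot D)]].
- apply: (Ycase) => [i|u [[pu _] _] nu _].
    by rewrite valz; split=> _; [exact: (dual_top D)|exact: prime_top (zX i).1].
  by rewrite valn //; split=> _; [exists 0; exact: (dual_top D)|exact: prime_top].
- move=> b x c y bx cy; apply: (Ycase) => [i|u Yu nu _].
    by rewrite valz (dual_meet D) (prime_meet (zX i).1) bx ?cy ?valz.
  rewrite valn // (prime_meet Yu.1.1) bx // cy // !valn //; split.
    move=> [[i xi] [j yj]]; exists (i + j).+2; apply/(dual_meet D).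
    by split; [apply: cofin xi _|apply: cofin yj _]; lia.
  by move=> [i /(dual_meet D)[xi yi]]; split; exists i.
- move=> b x c y bx cy; apply: (Ycase) => [i|u Yu nu _].
    by rewrite valz (dual_join D) (prime_join (zX i).1) bx ?cy ?valz.
  rewrite valn // (prime_join Yu.1.1) bx // cy // !valn //; split.
    by move=> [[i xi]|[i yi]]; exists i; apply/(dual_join D); [left|right].
  by move=> [i /(dual_join D)[xi|yi]]; [left|right]; exists i.
- move=> b x c y bx cy; apply: (Ycase) => [i|u Yu nu zu].
    rewrite valz (dual_imp D) (prime_imp _ _ (zX i).1); split=> [h j ij xj|h].
      have := h (z j) (zX j).1 ((z_le i j).2 ij).
      by rewrite bx // cy // !valz; apply.
    move=> q pq iq; have Yq := Yup _ _ (Y_z i) pq iq; rewrite bx // cy //.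
    move: q Yq {pq} iq; apply: (Ycase) => [j /z_le ij|q Yq nq zq _].
      by rewrite !valz; exact: h.
    rewrite !valn // => -[j xj]; exists (i + j).+2; apply: h; first by apply: Or32; lia.
    by apply: cofin xj _; lia.
  rewrite valn // (prime_imp _ _ Yu.1.1); split.
    move=> /(_ u Yu.1.1 (fun _ => id)); rewrite bx // cy // !valn // => h.
    have [[i xi]|no] := pselect (exists i, rho x i).
      have [j yj] := h (ex_intro _ i xi).
      exists j.+2; apply/(dual_imp D) => k /zle_leq jk _; exact: cofin yj _.
    by exists 0; apply/(dual_imp D) => k _ xk; case: no; exists k.
  move=> [i /(dual_imp D) h] q pq uq; have Yq := Yup _ _ Yu pq uq.
  have nq j : q <> z j.
    by move=> e; case: (nu j); apply: sub_eq => //; rewrite -e.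
  rewrite bx // cy // !valn // => -[j xj]; exists (i + j).+2; apply: h.
    by apply: Or32; lia.
  by apply: cofin xj _; lia.
Qed.

End ZigzagSpectrum.

(** * Cutting a zigzag into layers *)

Section ZigzagToStack.
Context (br : nat -> Prop).

(* A p-morphism from the points [>= j] onto a stack of [n] layers; unless [b],
   every node of the stack is attained strictly above [j], so that a point
   [j.-1] incomparable to [j] still sees the whole stack. *)
Definition parse n j (b : Prop) := exists c (k : nat -> stack_frame n c),
  [/\ forall i m, (j <= i)%N -> zle br i m -> fle (k i) (k m),
      forall i g, (j <= i)%N -> fle (k i) g -> exists2 m, zle br i m & k m = g
    & forall g, exists m, [/\ (j <= m)%N, b \/ (j < m)%N & k m = g]].

Lemma parse0 j b : parse 0 j b.
Proof.
exists (fun=> true), (fun=> tt); split=> // [i [] _ _|[]].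
  by exists i => //; exact: Or31.
by exists j.+1; split=> //; right.
Qed.

Definition ccons (e : bool) (c : nat -> bool) i := if i is m.+1 then c m else e.

(** The points [j], ..., [j + s - 1] go to the lowest layer through [blk], the later ones to the
    rest of the stack. The last point of the block sees [j + s] only across a break; otherwise it
    must find every node further up, whence the condition [br (j + s).-1]. *)
Lemma parse_block n j (b : Prop) e s (blk : nat -> layer_frame e) :
  (0 < s)%N ->
  (forall o o', (o < s)%N -> (o' < s)%N -> o = o' \/ (o.+2 <= o')%N ->
    fle (blk o) (blk o')) ->
  (forall o g, (o < s)%N -> fle (blk o) g ->
    exists o', [/\ (o' < s)%N, o = o' \/ (o.+2 <= o')%N & blk o' = g]) ->
  (forall g, exists o, [/\ (o < s)%N, b \/ (0 < o)%N & blk o = g]) ->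
  (forall i, (j <= i)%N -> (i.+1 < j + s)%N -> ~ br i) ->
  parse n (j + s) (br (j + s).-1) -> parse n.+1 j b.
Proof.
move=> s0 bm bb bo nobr [c [k [km kb ko]]].
exists (ccons e c).
exists (fun i => (if (i < j + s)%N then inl (blk (i - j)%N) else inr (k i))
  : sum_frame (layer_frame e) (stack_frame n c)).
split.
- move=> i m ji im; have := zle_leq im; case: ifP => hi; case: ifP => hm //=; last 2 first.
  + by lia.
  + by move=> _; apply: km => //; lia.
  move=> _; apply: bm; [lia|lia|].
  case: im => [->|h|[e' bi]]; [by left|right; lia|].
  by case: (nobr i) => //; lia.
- move=> i [g|g] ji; case: ifP => hi //= h.
  + have [|o' [os oo e']] := bb _ _ _ h; first by lia.
    exists (j + o')%N; last by rewrite ifT ?addKn ?e' //; lia.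
    by case: oo => oo; [apply: Or31; lia|apply: Or32; lia].
  + have [m [jm jm' <-]] := ko g; exists m; last by rewrite ifF //; lia.
    have [im|mi] := leqP i.+2 m; first exact: Or32.
    have e1 : i = (j + s).-1 by lia.
    have e2 : m = i.+1 by lia.
    by apply: Or33; split=> //; rewrite e1; case: jm' => //; lia.
  + have [|m im <-] := kb i g _ h; first by lia.
    by exists m => //; rewrite ifF //; have := zle_leq im; lia.
- move=> [g|g].
    have [o [os bo' <-]] := bo g; exists (j + o)%N; split; first by lia.
      by case: bo'; [left|right; lia].
    by rewrite ifT ?addKn //; lia.
  have [m [jm _ <-]] := ko g; exists m; split; [lia|right; lia|].
  by rewrite ifF //; lia.
Qed.

(** One of the two nodes is attained only at [j] itself, hence the argument [True]. *)
Lemma parse2 n j : ~ br j -> parse n (j + 2) (br j.+1) -> parse n.+1 j True.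
Proof.
move=> nbr; have -> : j.+1 = (j + 2).-1 by lia.
apply: (@parse_block _ _ _ false 2 (fun o => o == 1%N)) => //.
- by move=> [|[|o]] [|[|o']] //= _ _ [|].
- by move=> o g os /= <-; exists o; split=> //; left.
- by move=> [] /=; [exists 1%N|exists 0%N]; split=> //; left.
- by move=> i ji ij; have -> : i = j by lia.
Qed.

(** The comparable points [j] and [j.+2] share a node, so both nodes occur strictly above [j] and
    [b] may be arbitrary. *)
Lemma parse3 n j b : ~ br j -> ~ br j.+1 -> parse n (j + 3) (br j.+2) -> parse n.+1 j b.
Proof.
move=> nbr nbr'; have -> : j.+2 = (j + 3).-1 by lia.
apply: (@parse_block _ _ _ false 3 (fun o => o == 1%N)) => //.
- by move=> [|[|[|o]]] [|[|[|o']]] //= _ _ [|].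
- by move=> o g os /= <-; exists o; split=> //; left.
- by move=> [] /=; [exists 1%N|exists 2%N]; split=> //; right.
- by move=> i ji ij; have [->|->] : i = j \/ i = j.+1 by lia.
Qed.

(** Four consecutive unbroken points are the poset of [X2] read as a2, a1, b1, b2. *)
Lemma parse4 n j : ~ br j -> ~ br j.+1 -> ~ br j.+2 ->
  parse n (j + 4) (br j.+3) -> parse n.+1 j True.
Proof.
move=> nbr nbr' nbr''; have -> : j.+3 = (j + 4).-1 by lia.
apply: (@parse_block _ _ _ true 4 (fun o => match o with
  | 0 => X2a2 | 1 => X2a1 | 2 => X2b1 | _ => X2b2 end)) => //.
- by move=> [|[|[|[|o]]]] [|[|[|[|o']]]] //= _ _ [|].
- move=> [|[|[|[|o]]]] //= [] //= _ _;
  by [exists 0%N; split=> //; left|exists 1%N; split=> //; left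
    |exists 2%N; split=> //; left|exists 3%N; split=> //; left
    |exists 2%N; split=> //; right|exists 3%N; split=> //; right].
- by move=> [] /=; [exists 1%N|exists 0%N|exists 2%N|exists 3%N]; split=> //; left.
- by move=> i ji ij; have [->|[->|->]] : i = j \/ i = j.+1 \/ i = j.+2 by lia.
Qed.

Hypothesis br2 : forall i, br i -> ~ br i.+1.

(** A segment running up to a break is cut into blocks of three, after a leading block of two or
    four that corrects its length modulo three; a leading block needs [True], which is available
    just after a break. The second half is the invariant inside a segment: what remains has length
    divisible by three or is infinite. As [j] is not itself a break, the length is at least two, so
    remainder one leaves at least four points. *)
Lemma parse_all n : (forall j, ~ br j -> parse n j True) /\
  forall j, (forall i, (j <= i)%N -> ~ br i) \/
    (exists m, br (j + 3 * m + 2)%N /\ forall i, (j <= i < j + 3 * m + 2)%N -> ~ br i) ->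
  parse n j False.
Proof.
elim: n => [|n [IHt IHf]]; first by split=> *; exact: parse0.
have weaken j (b b' : Prop) : (b -> b') -> parse n j b -> parse n j b'.
  move=> bb' [c [k [km kb ko]]]; exists c, k; split=> // g.
  by have [m [jm b_or <-]] := ko g; exists m; split=> //; case: b_or; [left; exact: bb'|right].
have rest j e s : br e -> (forall i, (j <= i < e)%N -> ~ br i) ->
    (0 < s <= e.+1 - j)%N -> ((e.+1 - j - s) %% 3 = 0)%N -> parse n (j + s) (br (j + s).-1).
  move=> be nob hs mod3; have [se|se] := leqP (e.+1 - j) s.
    have -> : (j + s).-1 = e by lia.
    apply: (@weaken _ True) => //; apply: IHt.
    have -> : (j + s)%N = e.+1 by lia.
    exact: br2.
  apply: (@weaken _ False) => //; apply: IHf; right.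
  exists ((e.+1 - j - s) %/ 3).-1%N.
  have -> : (j + s + 3 * ((e.+1 - j - s) %/ 3).-1 + 2)%N = e by lia.
  by split=> // i hi; apply: nob; lia.
split=> j h.
  have [ex|no] := pselect (exists i, `[< (j <= i)%N /\ br i >]); last first.
    have nob i : (j <= i)%N -> ~ br i.
      by move=> ji bi; apply: no; exists i; apply/asboolP.
    apply: parse2 => //; apply: (@weaken _ False) => //.
    by apply: IHf; left=> i ji; apply: nob; lia.
  case: (ex_minnP ex) => e /asboolP[je be] emin.
  have nob i : (j <= i < e)%N -> ~ br i.
    move=> /andP[ji ie] bi; have : (e <= i)%N by apply: emin; apply/asboolP.
    by lia.
  have je' : (j < e)%N by rewrite ltn_neqAle je andbT; apply: contra_notN h => /eqP->.
  have [e2|[e3|e1]] : ((e.+1 - j) %% 3 = 2 \/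
    (e.+1 - j) %% 3 = 0 \/ (e.+1 - j) %% 3 = 1)%N by lia.
  - apply: parse2 => //; have -> : j.+1 = (j + 2).-1 by lia.
    by apply: (rest j e) => //; lia.
  - apply: parse3 => //; first by apply: nob; lia.
    have -> : j.+2 = (j + 3).-1 by lia.
    by apply: (rest j e) => //; lia.
  - apply: parse4 => //; first by apply: nob; lia.
      by apply: nob; lia.
    have -> : j.+3 = (j + 4).-1 by lia.
    by apply: (rest j e) => //; lia.
case: h => [nob|[m [be nob]]].
  apply: parse3; [by apply: nob|by apply: nob; lia|].
  by apply: (@weaken _ False) => //; apply: IHf; left=> i ji; apply: nob; lia.
apply: parse3; [by apply: nob; lia|by apply: nob; lia|].
have -> : j.+2 = (j + 3).-1 by lia.
by apply: (rest j (j + 3 * m + 2)%N) => //; lia.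
Qed.

Lemma zigzag_stacks (K : heyting -> Prop) H rho n : variety K ->
  @dual H (zigzag br) rho -> K H -> exists c, K (stack n c).
Proof.
move=> vK D KH.
have [j nbr] : exists j, ~ br j.
  by have [b0|] := pselect (br 0); [exists 1%N; exact: br2|exists 0].
have [c [k [km kb ko]]] := (parse_all n).1 j nbr.
exists c; have [rho' D'] := stack_dual n c.
apply: (@pmorphism_variety (zigzag br) _ (fun i => (j <= i)%N) k K _ _ _ _ D D' vK) => //.
split=> //.
- by move=> i m /= ji /zle_leq; exact: leq_trans.
- by move=> g; have [m [jm _ e]] := ko g; exists m.
Qed.

End ZigzagToStack.

(** * Fibres of an epimorphism *)

Section Epimorphism.
Context (K : heyting -> Prop) (vK : variety K).
Context (A B : heyting) (f : A -> B) (KB : K B).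
Context (fhom : heyting_hom f) (epi : epimorphism K f).

Lemma proj_ext (P : set B) (pP : prime P) x y :
  (forall R, prime R -> P [<=] R -> R x <-> R y) ->
  proj (prime_filter pP) x = proj (prime_filter pP) y.
Proof.
by move=> e; apply/proj_eq; split; apply/(prime_imp _ _ pP) => q pq Pq; apply (e q pq Pq).
Qed.

(* The map [P |-> Q], identical on the primes strictly above [P], is dual to a
   second homomorphism from [B] to [B / P]. *)
Lemma restr_unique (P Q : set B) d : prime P -> prime Q -> restr f P = restr f Q ->
  ~ P d -> (forall R, prime R -> P [<] R -> R d) ->
  (forall R, prime R -> P [<] R -> Q [<=] R) ->
  (forall R, prime R -> Q [<] R -> P [<] R) -> P = Q.
Proof.
move=> pP pQ ePQ Pd Rd PQ QP.
pose g := proj (prime_filter pP).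
have ghom : heyting_hom g := proj_hom (prime_filter pP).
(* Since [d] separates [P] from everything strictly above it, [e b] lies in [P] exactly when [b] is
   in [Q], and in the larger prime filters exactly when [b] is. *)
pose e b := if pselect (Q b) then \top else b `&` d.
have eP b : P (e b) <-> Q b.
  rewrite /e; case: pselect => Qb; first by split=> // _; exact: prime_top.
  by split=> // /(prime_meet pP)[].
have eR R b : prime R -> P [<] R -> R (e b) <-> R b.
  move=> pR PR; rewrite /e; case: pselect => Qb.
    by split=> _; [exact: (PQ R) Qb|exact: prime_top].
  rewrite (prime_meet pR); split=> [[]//|Rb]; split=> //; exact: Rd.
have gext x y : (P x <-> P y) -> (forall R, prime R -> P [<] R -> R x <-> R y) -> g x = g y.
  by move=> SP SR; apply: proj_ext => R pR /sub_cases[<-|] //; exact: SR.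
pose h b := g (e b).
have hhom : heyting_hom h.
  split; rewrite /h.
  - move=> x y; rewrite -(hom_meet ghom); apply: gext => [|R pR PR].
      by rewrite (prime_meet pP) !eP (prime_meet pQ).
    by rewrite (prime_meet pR) !eR // (prime_meet pR).
  - move=> x y; rewrite -(hom_join ghom); apply: gext => [|R pR PR].
      by rewrite (prime_join pP) !eP (prime_join pQ).
    by rewrite (prime_join pR) !eR // (prime_join pR).
  - move=> x y; rewrite -(hom_imp ghom); apply: gext => [|R pR PR].
      rewrite eP (prime_imp _ _ pP) (prime_imp _ _ pQ); split=> H q pq.
        move=> /sub_cases[<-|Pq]; first by rewrite !eP; exact: H.
        by rewrite !eR //; apply: H => //; exact: PQ.
      move=> /sub_cases[<-|Qq].
        by rewrite -!eP; exact: H.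
      have Pq := QP _ pq Qq.
      have := H _ pq Pq.1; rewrite !eR //.
    rewrite eR // !(prime_imp _ _ pR); split=> H q pq Rq.
      by have Pq := proper_sub PR Rq; rewrite !eR //; exact: H.
    by have Pq := proper_sub PR Rq; have := H q pq Rq; rewrite !eR.
  - rewrite -(hom_bot ghom); apply: gext => [|R pR PR].
      by rewrite eP; split=> [/(prime_bot pQ)|/(prime_bot pP)].
    by rewrite eR.
  - rewrite -(hom_top ghom); apply: gext => [|R pR PR].
      by rewrite eP; split=> _; exact: prime_top.
    by rewrite eR.
have gh : g =1 h.
  apply: epi => //; first exact: quotient_variety.
  move=> a; apply: gext => [|R pR PR].
    rewrite eP; have : restr f P a <-> restr f Q a by rewrite ePQ.
    exact.
  by rewrite eR.
have key b : P b <-> Q b.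
  have := gh b; rewrite /h => /proj_eq[H1 H2]; rewrite -eP.
  by split; [exact: prime_mp H1|exact: prime_mp H2].
by apply: sub_eq => b /key.
Qed.

(** If [A] mapped onto [B / Q], every [b] could be replaced modulo [Q] by a value of [f] and then
    sent to [B / P], consistently because the traces agree. This homomorphism equals the projection
    on the image of [f], hence everywhere, and [P = Q]. So some class of [B / Q] is missed, and it
    yields the new pair above [Q]. *)
Lemma restr_above (P Q : set B) : prime P -> prime Q -> restr f P = restr f Q -> P <> Q ->
  exists P' Q', [/\ prime P', prime Q', Q [<=] P', Q [<=] Q'
    & restr f P' = restr f Q' /\ P' <> Q'].
Proof.
move=> pP pQ ePQ nPQ; pose gQ := proj (prime_filter pQ); pose gP := proj (prime_filter pP).
have hQ : heyting_hom gQ := proj_hom (prime_filter pQ).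
have hP : heyting_hom gP := proj_hom (prime_filter pP).
have fQ : heyting_hom (gQ \o f).
  split=> [x y|x y|x y||] /=; rewrite ?(hom_meet fhom) ?(hom_join fhom) ?(hom_imp fhom)
    ?(hom_bot fhom) ?(hom_top fhom).
  - exact: (hom_meet hQ).
  - exact: (hom_join hQ).
  - exact: (hom_imp hQ).
  - exact: (hom_bot hQ).
  - exact: (hom_top hQ).
have [onto|/existsNP[c nc]] := pselect (forall c, exists a, (gQ \o f) a = c); last first.
  have [p [q [pp pq e pc nqc]]] := restr_separates fQ nc.
  have up s : prime s -> Q [<=] restr gQ s.
    move=> ps x Qx; rewrite /restr /=.
    suff -> : gQ x = gQ \top by rewrite (hom_top hQ); exact: prime_top.
    apply: proj_ext => R pR QR; split=> _; [exact: prime_top|exact: QR].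
  exists (restr gQ p), (restr gQ q).
  split; [exact: restr_prime|exact: restr_prime|exact: up|exact: up|].
  have [x ex] := proj_onto c.
  split=> [//|epq]; apply: nqc; have : restr gQ p x by rewrite /restr /= /gQ ex.
  by rewrite epq /restr /= /gQ ex.
have [s sP] := choice (fun b => onto (gQ b)).
have tr a a' : gQ (f a) = gQ (f a') -> gP (f a) = gP (f a').
  rewrite /gQ /gP !proj_eq -!(hom_imp fhom).
  have E x : P (f x) <-> Q (f x).
    have : restr f P x <-> restr f Q x by rewrite ePQ.
    exact.
  by rewrite !E.
case: nPQ; pose h b := gP (f (s b)).
have sE b : gQ (f (s b)) = gQ b := sP b.
have hhom : heyting_hom h.
  split=> [x y|x y|x y||]; rewrite /h.
  - rewrite -(hom_meet hP) -(hom_meet fhom); apply: tr.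
    by rewrite sE (hom_meet fhom) !(hom_meet hQ) !sE.
  - rewrite -(hom_join hP) -(hom_join fhom); apply: tr.
    by rewrite sE (hom_join fhom) !(hom_join hQ) !sE.
  - rewrite -(hom_imp hP) -(hom_imp fhom); apply: tr.
    by rewrite sE (hom_imp fhom) !(hom_imp hQ) !sE.
  - rewrite -(hom_bot hP) -(hom_bot fhom); apply: tr.
    by rewrite sE (hom_bot fhom).
  - rewrite -(hom_top hP) -(hom_top fhom); apply: tr.
    by rewrite sE (hom_top fhom).
have gh : gP =1 h.
  apply: epi => //; first exact: quotient_variety.
  by move=> a /=; rewrite /h; apply: tr; rewrite sE.
have mem (R : set B) (pR : prime R) x y : proj (prime_filter pR) x = proj (prime_filter pR) y ->
    R x <-> R y.
  by move=> /proj_eq[h1 h2]; split; [exact: prime_mp h1|exact: prime_mp h2].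
apply: sub_eq => b.
  move=> /(mem _ pP _ _ (gh b)) Pf; apply/(mem _ pQ _ _ (sE b)).
  have : restr f P (s b) by [].
  by rewrite ePQ.
move=> /(mem _ pQ _ _ (sE b)) Qf; apply/(mem _ pP _ _ (gh b)).
have : restr f Q (s b) by [].
by rewrite -ePQ.
Qed.

End Epimorphism.

(** Zorn's lemma is applied to the parts removed from [u], since intersections of chains of primes
    correspond to unions of removed parts. *)
Lemma minimal_prime (H : heyting) (p q u : set H) : prime u -> p [<=] u -> q [<=] u ->
  exists m, [/\ prime m, p [<=] m /\ q [<=] m, m [<=] u
    & forall v, prime v -> p [<=] v -> q [<=] v -> v [<=] m -> v = m].
Proof.
move=> pu up uq.
pose ok S := [/\ prime (u `\` S)%classic, p [<=] (u `\` S)%classic & q [<=] (u `\` S)%classic].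
have [|S [[pm mp mq] maxS]] := @Zorn_bigcup H ok.
  move=> C Cok Ctot.
  have memE x : (u `\` \bigcup_(S in C) S)%classic x <-> u x /\ forall S, C S -> ~ S x.
    split=> -[ux nx]; split=> //; first by move=> S CS Sx; apply: nx; exists S.
    by move=> [S CS Sx]; exact: nx CS Sx.
  split; last 2 first.
  - by move=> x px; apply/memE; split; [exact: up|move=> S /Cok[_ /(_ _ px)[]]].
  - by move=> x px; apply/memE; split; [exact: uq|move=> S /Cok[_ _ /(_ _ px)[]]].
  split.
  - by apply/memE; split; [exact: prime_top|move=> S /Cok[pS _ _]; case: (prime_top pS)].
  - by move=> /memE[/(prime_bot pu)].
  - move=> x y; rewrite !memE (prime_meet pu); split.
      move=> [[ux uy] h]; split; split=> // S CS; have [pS _ _] := Cok _ CS.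
        have /(prime_meet pS)[[]//] : (u `\` S)%classic (x `&` y).
          by split; [exact/(prime_meet pu)|exact: h].
      have /(prime_meet pS)[_ []//] : (u `\` S)%classic (x `&` y).
        by split; [exact/(prime_meet pu)|exact: h].
    move=> [[ux hx] [uy hy]]; split=> // S CS; have [pS _ _] := Cok _ CS.
    have : (u `\` S)%classic (x `&` y).
      by apply/(prime_meet pS); split; split=> //; [exact: hx|exact: hy].
    by case.
  - move=> x y; split.
      move=> /memE[uxy h]; apply: contrapT => /not_orP[nx ny].
      have bad z : u z -> ~ (u `\` \bigcup_(S in C) S)%classic z -> exists2 S, C S & S z.
        move=> uz nz; apply: contrapT => no; apply: nz; apply/memE; split=> // S CS Sz.
        by apply: no; exists S.
      have out S : C S -> (u `\` S)%classic x \/ (u `\` S)%classic y.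
        move=> CS; have [pS _ _] := Cok _ CS; apply/(prime_join pS).
        by split=> //; exact: h.
      have [ux|nux] := pselect (u x); last first.
        have uy : u y by case/(prime_join pu): uxy.
        have [S CS Sy] := bad y uy ny.
        by case: (out S CS) => -[].
      have [S CS Sx] := bad x ux nx.
      have uy : u y by case: (out S CS) => -[].
      have [S' CS' Sy] := bad y uy ny.
      case: (Ctot _ _ CS CS') => SS.
        by case: (out _ CS') => -[_]; [move=> /(_ (SS _ Sx))|].
      by case: (out _ CS) => -[_]; [|move=> /(_ (SS _ Sy))].
    move=> [/memE[ux h]|/memE[uy h]]; apply/memE.
      split=> [|S CS]; first by apply/(prime_join pu); left.
      have [pS _ _] := Cok _ CS.
      have [] // : (u `\` S)%classic (x `|` y).
      by apply/(prime_join pS); left; split=> //; exact: h.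
    split=> [|S CS]; first by apply/(prime_join pu); right.
    have [pS _ _] := Cok _ CS.
    have [] // : (u `\` S)%classic (x `|` y).
    by apply/(prime_join pS); right; split=> //; exact: h.
exists (u `\` S)%classic; split; [exact: pm|by split|by move=> x []|].
move=> v pv pv' qv vm; apply: sub_eq => // x [ux nSx]; apply: contrapT => nvx.
apply: (maxS (S `|` (u `\` v))%classic).
  by split=> [y Sy|h]; [left|apply: nSx; apply: h; right].
have e' : (u `\` (S `|` (u `\` v)))%classic = v.
  apply/seteqP; split=> y.
    by move=> [uy /not_orP[_ h]]; apply: contrapT => ny; apply: h.
  by move=> vy; have [uy nSy] := vm _ vy; split=> //; case=> // -[].
by rewrite /ok e'.
Qed.

(** * Ascents from an incomparable pair *)

Section Fibres.
Context (K : heyting -> Prop) (vK : variety K) (KKG : subclass K KG).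
Context (A B : heyting) (f : A -> B) (KB : K B).
Context (fhom : heyting_hom f) (epi : epimorphism K f).
Context (r : set B) (rr : prime r).
Implicit Types (u v x y w s : set B).

Let X u := prime u /\ r [<=] u.
Let KGB : KG B := KKG KB.
Let pi := restr f.

Let X_up u v : X u -> prime v -> u [<=] v -> X v.
Proof. by move=> [_ ru] pv uv; split=> //; exact: subset_trans ru uv. Qed.

Let lift x w : X x -> X w -> pi x [<=] pi w ->
  exists v, [/\ X v, x [<=] v & pi v = pi w].
Proof.
move=> Xx Xw xw.
have [v [pv xv e]] := restr_lift fhom Xx.1 (restr_prime fhom Xw.1) xw.
by exists v; split=> //; exact: X_up Xx pv xv.
Qed.

Let pi_mono x y : x [<=] y -> pi x [<=] pi y.
Proof. by move=> xy a; exact: xy. Qed.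

Let unique x y d : X x -> X y -> pi x = pi y -> ~ x d ->
  (forall u, X u -> x [<] u -> u d) -> (forall u, X u -> x [<] u -> y [<=] u) ->
  (forall u, X u -> y [<] u -> x [<] u) -> x = y.
Proof.
move=> Xx Xy e nxd hd hy hx; apply: (restr_unique vK KB epi Xx.1 Xy.1 e nxd) => u pu.
- by move=> xu; apply: hd => //; exact: X_up Xx pu xu.1.
- by move=> xu; apply: hy => //; exact: X_up Xx pu xu.1.
- by move=> xu; apply: hx => //; exact: X_up Xy pu xu.1.
Qed.

(** [x] and [y] are candidates for consecutive zigzag points, [x] with the smaller index. *)
Definition oriented x y :=
  [/\ X x, X y, x [#] y & forall u, X u -> y [<] u -> x [<] u].

(** The constructors are the ways in which the prime filters above [x] can continue: one node below
    them all, nothing, a new pair above both points, or the next point of the ladder. [V] consists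
    of the prime filters above the final node, on which the ascent gives no information. *)
Inductive terminates : set (set B) -> set B -> set B -> Prop :=
  | TermNode x y s : oriented x y -> X s -> x [<] s -> y [<] s ->
      (forall u, X u -> x [<] u -> s [<=] u) -> terminates [set u | s [<=] u] x y
  | TermTop x y : oriented x y -> (forall u, X u -> ~ x [<] u) -> terminates set0 x y
  | TermBreak V x y x' y' : oriented x y -> oriented x' y' -> x [<] x' -> y [<] x' ->
      x [<] y' -> y [<] y' -> (forall u, X u -> x [<] u -> x' [<=] u \/ y' [<=] u) ->
      terminates V x' y' -> terminates V x y
  | TermLadder V x y w : oriented x y -> oriented y w -> x [<] w ->
      (forall u, X u -> x [<] u -> u = w \/ y [<] u) ->
      terminates V y w -> terminates V x y.

Lemma terminates_above V x y : terminates V x y ->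
  forall u, V u -> x [<] u /\ y [<] u.
Proof.
elim=> {V x y}.
- by move=> x y s _ _ xs ys _ u su; split; [exact: proper_sub su|exact: proper_sub su].
- by [].
- move=> V x y x' y' _ _ xx' yx' _ _ _ _ IH u /IH[x'u _].
  by split; [exact: strict_trans xx' x'u|exact: strict_trans yx' x'u].
- move=> V x y w _ _ xw _ _ IH u /IH[yu wu]; split=> //.
  exact: strict_trans xw wu.
Qed.

(** Induction from the end of the ascent. A coincidence of traces between an old and a new point is
    lifted to a coincidence among the points already treated, or excluded by [restr_unique]. *)
Lemma terminates_fibre V x y : terminates V x y -> forall p q, X p -> X q ->
  x [<=] p \/ y [<=] p -> x [<=] q \/ y [<=] q -> pi p = pi q -> p = q \/ V p /\ V q.
Proof.
move=> t; have := terminates_above t; elim: t => {V x y}.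
- move=> x y s [Xx Xy xy oy] Xs xs ys cover _.
  have [_ /proper_witness[d [sd nxd]]] := xs.
  have [_ /proper_witness[d' [sd' nyd]]] := ys.
  have nxs : pi x <> pi s.
    move=> e; suff exs : x = s by move: xs.2; rewrite exs; apply.
    apply: (unique (d := d)) => // u Xu xu; [exact: (cover u Xu xu _ sd)|].
    exact: strict_trans xs xu.
  have nys : pi y <> pi s.
    move=> e; suff exs : y = s by move: ys.2; rewrite exs; apply.
    apply: (unique (d := d')) => // u Xu yu;
      [exact: (cover u Xu (oy _ Xu yu) _ sd')|exact: (cover u Xu (oy _ Xu yu))|].
    exact: strict_trans ys yu.
  have nxy : pi x <> pi y.
    move=> e; suff exs : x = y by move: xy.1; rewrite exs; apply.
    apply: (unique (d := d)) => // u Xu xu; [exact: (cover u Xu xu _ sd)|].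
    exact: subset_trans ys.1 (cover u Xu xu).
  have cases p : X p -> x [<=] p \/ y [<=] p -> [\/ p = x, p = y | s [<=] p].
    move=> Xp [/sub_cases[->|xp]|/sub_cases[->|yp]]; [exact: Or31| |exact: Or32|].
      by apply: Or33; exact: (cover p Xp xp).
    by apply: Or33; exact: (cover p Xp (oy _ Xp yp)).
  have low p : X p -> s [<=] p -> pi p <> pi x /\ pi p <> pi y.
    move=> Xp sp; split=> e.
      by apply: nxs; apply: sub_eq; [exact: (pi_mono xs.1)|rewrite -e; exact: pi_mono].
    by apply: nys; apply: sub_eq; [exact: (pi_mono ys.1)|rewrite -e; exact: pi_mono].
  move=> p q Xp Xq hp hq e.
  have [ep|ep|sp] := cases _ Xp hp; have [eq|eq|sq] := cases _ Xq hq; subst; try by left.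
  + by case: (low _ Xq sq) => /(_ (esym e)).
  + by case: nxy.
  + by case: (low _ Xq sq) => _ /(_ (esym e)).
  + by case: (low _ Xp sp) => /(_ e).
  + by case: (low _ Xp sp) => _ /(_ e).
  + by right.
- move=> x y [Xx Xy xy oy] top _.
  have nxy : pi x <> pi y.
    move=> e; suff exs : x = y by move: xy.1; rewrite exs; apply.
    apply: (unique (d := \bot)) => //; first exact: prime_bot Xx.1.
    + by move=> u Xu /(top u Xu).
    + by move=> u Xu /(top u Xu).
  have cases p : X p -> x [<=] p \/ y [<=] p -> p = x \/ p = y.
    move=> Xp [/sub_cases[->|xp]|/sub_cases[->|yp]]; [by left| |by right|].
      by case: (top _ Xp xp).
    by case: (top _ Xp (oy _ Xp yp)).
  move=> p q Xp Xq hp hq e.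
  by have [ep|ep] := cases _ Xp hp; have [eq|eq] := cases _ Xq hq; subst; try (by left);
    case: nxy.
- move=> V x y x' y' [Xx Xy xy oy] [Xx' Xy' [nxy nyx] oy'] xx' yx' xy' yy' cover t IH _.
  have IHF := IH (terminates_above t).
  have nV : ~ V x' /\ ~ V y'.
    by split=> /(terminates_above t)[[_ h1] [_ h2]]; [apply: h1|apply: h2].
  have up' p : x' [<=] p \/ y' [<=] p -> x [<] p /\ y [<] p.
    by move=> [h|h]; split; exact: proper_sub h.
  (* Say [p] is above [x']. The trace of [x'] lies between those of [z] and [p], hence equals that
     of [z] and is contained in that of [y']. The lift above [x'] with the trace of [y'] is [y'] by
     induction, against incomparability. *)
  have low p z : X p -> X z -> (x' [<=] p \/ y' [<=] p) -> z [<] x' -> z [<] y' -> pi z <> pi p.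
    move=> Xp Xz hp zx' zy' e.
    have contra a b : X a -> X b -> ~ V b -> a [#] b -> z [<] a -> z [<] b ->
       (x' [<=] a \/ y' [<=] a) -> (x' [<=] b \/ y' [<=] b) -> a [<=] p -> False.
      move=> Xa Xb nVb [nab nba] za zb ha hb ap.
      have ea : pi a = pi z.
        by apply: sub_eq; [rewrite e; exact: pi_mono|exact: (pi_mono za.1)].
      have [|v [Xv av ev]] := lift Xa Xb; first by rewrite ea; exact: (pi_mono zb.1).
      have [|evb|[_ /nVb//]] := IHF v b Xv Xb _ hb ev.
        by case: ha => h; [left|right]; exact: subset_trans h av.
      by apply: nab; rewrite -evb.
    case: hp => hp.
      by apply: (contra x' y') => //; [exact: nV.2|left|right].
    by apply: (contra y' x') => //; [exact: nV.1|right|left].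
  have nxy' : pi x <> pi y.
    have [_ /proper_witness[d1 [xd1 nx1]]] := xx'.
    have [_ /proper_witness[d2 [yd2 nx2]]] := xy'.
    move=> e; suff exs : x = y by move: xy.1; rewrite exs; apply.
    (* Everything strictly above [x] contains [x'] or [y'], so a join of one element from each
       separates [x] from it. *)
    apply: (unique (d := d1 `|` d2)) => //.
    + by move=> /(prime_join Xx.1)[].
    + move=> u Xu /(cover u Xu)[h|h]; apply/(prime_join Xu.1); [left|right]; exact: h.
    + by move=> u Xu /(cover u Xu)/up'[_ []].
  have cases p : X p -> x [<=] p \/ y [<=] p -> [\/ p = x, p = y | x' [<=] p \/ y' [<=] p].
    move=> Xp [/sub_cases[->|xp]|/sub_cases[->|yp]]; [exact: Or31| |exact: Or32|].
      by apply: Or33; exact: (cover p Xp xp).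
    by apply: Or33; exact: (cover p Xp (oy _ Xp yp)).
  move=> p q Xp Xq hp hq e.
  have [ep|ep|sp] := cases _ Xp hp; have [eq|eq|sq] := cases _ Xq hq; subst; try by left.
  + by case: (low q x).
  + by case: nxy'.
  + by case: (low q y).
  + by case: (low p x) => //; rewrite e.
  + by case: (low p y) => //; rewrite e.
  + exact: IHF.
- move=> V x y w [Xx Xy xy oy] [_ Xw yw ow] xw cover t IH _.
  have IHF := IH (terminates_above t).
  have nVw : ~ V w by move=> /(terminates_above t)[_ [_ []]].
  have [_ /proper_witness[d [wd nxd]]] := xw.
  have nxy : pi x <> pi y.
    move=> e; have [|v [Xv yv ev]] := lift Xy Xw.
      by rewrite -e; exact: (pi_mono xw.1).
    have [||evw|[_ /nVw//]] := IHF v w Xv Xw _ _ ev; [by left|by right|].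
    by move: yw.1; rewrite -evw; apply.
  have nxw : pi x <> pi w.
    move=> e.
    (* A [v0] above [y] but not above [w] would have its trace lifted above [w], contrary to
       induction. Without such a [v0], everything strictly above [x] contains [w], and [unique]
       applies to [x] and [w]. *)
    have [[v0 [Xv0 yv0 nwv0]]|no] := pselect (exists v, [/\ X v, y [<] v & ~ w [<] v]).
      have inc : w [#] v0.
        split=> s; last by case: yw => h _; apply: h; exact: subset_trans yv0.1 s.
        case/sub_cases: s => // ewv; move: yv0.1; rewrite -ewv; by case: yw.
      have [|v' [Xv' wv' ev']] := lift Xw Xv0.
        by rewrite -e; apply: pi_mono; exact: (oy _ Xv0 yv0).1.
      have nVv0 : ~ V v0 by move=> /(terminates_above t)[_ /nwv0].
      have [||evv|[_ /nVv0//]] := IHF v' v0 Xv' Xv0 _ _ ev'; [by right|by left; case: yv0|].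
      by move: inc.1; rewrite -evv; apply.
    suff exw : x = w by move: xw.2; rewrite exw; apply.
    have cov u : X u -> x [<] u -> w [<=] u.
      move=> Xu /(cover u Xu)[->//|yu]; apply: contrapT => nwu; apply: no.
      by exists u; split=> // -[].
    apply: (unique (d := d)) => // u Xu xu; [exact: (cov u Xu xu _ wd)|].
    exact: strict_trans xw xu.
  have low p : X p -> y [<=] p \/ w [<=] p -> pi x <> pi p.
    move=> Xp hp e.
    have [wp|nwp] := pselect (w [<=] p).
      by apply: nxw; apply: sub_eq; [exact: (pi_mono xw.1)|rewrite e; exact: pi_mono].
    case: hp => // /sub_cases[yp|yp]; first by subst p.
    have npw : ~ p [<=] w by move=> pw; case: yw => h _; apply: h; exact: subset_trans yp.1 pw.
    have [|v [Xv pv ev]] := lift Xp Xw; first by rewrite -e; exact: (pi_mono xw.1).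
    have [||evw|[_ /nVw//]] := IHF v w Xv Xw _ _ ev.
    + by left; apply: subset_trans yp.1 pv.
    + by right.
    + by apply: npw; rewrite -evw.
  have cases p : X p -> x [<=] p \/ y [<=] p -> p = x \/ (y [<=] p \/ w [<=] p).
    move=> Xp [/sub_cases[->|xp]|yp]; [by left| |by right; left].
    by right; case: (cover _ Xp xp) => [->|[yp _]]; [right|left].
  move=> p q Xp Xq hp hq e.
  have [ep|sp] := cases _ Xp hp; have [eq|sq] := cases _ Xq hq; subst; try by left.
  + by case: (low q).
  + by case: (low p) => //; rewrite e.
  + exact: IHF.
Qed.

(** If both orientations fail, the two witnesses together with [x] and [y] form the configuration
    excluded by [KG_no22]. *)
Lemma inc_oriented x y : X x -> X y -> x [#] y -> oriented x y \/ oriented y x.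
Proof.
move=> Xx Xy xy.
have [o|no] := pselect (forall u, X u -> y [<] u -> x [<] u); first by left.
right; split=> //; first exact: inc_sym.
move=> u Xu xu; apply: contrapT => nyu.
apply: no => v Xv yv; apply: contrapT => nxv.
apply: (@KG_no22 _ KGB _ rr x u y v) => //.
- move=> /sub_cases[e|//]; subst v; case: xy => _; apply; exact: yv.1.
- move=> /sub_cases[e|//]; subst u; case: xy => h _; apply: h; exact: xu.1.
Qed.

(** A prime filter above [x] but not above [y] is unique by [KG_degree2] and [KG_width2], and
    continues the ladder. If there is none, [x] and [y] have minimal common upper bounds, at most
    two by width. *)
Lemma oriented_step x y : oriented x y ->
  [\/ exists w, [/\ oriented y w, x [<] w & forall u, X u -> x [<] u -> u = w \/ y [<] u],
      exists x' y', [/\ oriented x' y', x [<] x' /\ y [<] x', x [<] y' /\ y [<] y'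
        & forall u, X u -> x [<] u -> x' [<=] u \/ y' [<=] u],
      exists s, [/\ X s, x [<] s, y [<] s & forall u, X u -> x [<] u -> s [<=] u]
    | forall u, X u -> ~ x [<] u].
Proof.
move=> [Xx Xy xy oy].
have [[w [Xw xw nyw]]|no] := pselect (exists w, [/\ X w, x [<] w & ~ y [<] w]).
  have incyw w' : x [<] w' -> ~ y [<] w' -> y [#] w'.
    move=> xw' nyw'; split=> h.
      by case/sub_cases: h => // e; subst w'; case: xy => h _; apply: h; exact: xw'.1.
    by case: xy => h' _; apply: h'; exact: subset_trans xw'.1 h.
  have yw := incyw w xw nyw.
  apply: Or41; exists w; split=> //.
    split=> // u Xu wu; apply: contrapT => nyu.
    have xu := strict_trans xw wu.
    by apply: (@KG_degree2 _ KGB _ rr y x w u) => //; [exact: inc_sym|exact: incyw].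
  move=> u Xu xu; apply: contrapT => /not_orP[nuw nyu]; have yu := incyw u xu nyu.
  have [e|uw|wu|inc] := inc_cases u w; first by [].
  - by apply: (@KG_degree2 _ KGB _ rr y x u w) => //; exact: inc_sym.
  - by apply: (@KG_degree2 _ KGB _ rr y x w u) => //; exact: inc_sym.
  - by apply: (@KG_width2 _ KGB _ rr y u w) => //.
have ox u : X u -> x [<] u -> y [<] u.
  by move=> Xu xu; apply: contrapT => nyu; apply: no; exists u.
have [[u0 [Xu0 xu0]]|none] := pselect (exists u, X u /\ x [<] u); last first.
  by apply: Or44 => u Xu xu; apply: none; exists u.
have above m : prime m -> x [<=] m -> y [<=] m -> [/\ X m, x [<] m & y [<] m].
  move=> pm /[dup] xm /sub_cases[e|xm'] ym; first by subst m; case: xy.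
  have Xm := X_up Xx pm xm; by split=> //; exact: ox.
have minim u : X u -> x [<] u -> exists m, [/\ X m, x [<] m, y [<] m, m [<=] u
    & forall v, X v -> x [<] v -> v [<=] m -> v = m].
  move=> Xu xu; have [m [pm [xm ym] mu mmin]] := minimal_prime Xu.1 xu.1 (ox _ Xu xu).1.
  have [Xm xm' ym'] := above m pm xm ym; exists m; split=> // v Xv xv vm.
  by apply: mmin => //; [exact: Xv.1|exact: xv.1|exact: (ox _ Xv xv).1].
have [m [Xm xm ym _ mmin]] := minim u0 Xu0 xu0.
have [all_m|/existsNP[u /not_implyP[Xu /not_implyP[xu nmu]]]] :=
  pselect (forall u, X u -> x [<] u -> m [<=] u); first by apply: Or43; exists m.
have [m' [Xm' xm' ym' m'u m'min]] := minim u Xu xu.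
have mm' : m [#] m'.
  split=> h; first by apply: nmu; exact: subset_trans h m'u.
  by apply: nmu; rewrite -(mmin m').
have cover v : X v -> x [<] v -> m [<=] v \/ m' [<=] v.
  move=> Xv xv; have [m2 [Xm2 xm2 ym2 m2v m2min]] := minim v Xv xv.
  have [e|ne] := pselect (m2 = m); first by subst; left.
  have [e|ne'] := pselect (m2 = m'); first by subst; right.
  exfalso; apply: (@KG_width2 _ KGB _ rr m m' m2) => //; split=> h.
  - by apply: ne; rewrite (m2min m).
  - by apply: ne; rewrite (mmin m2).
  - by apply: ne'; rewrite (m2min m').
  - by apply: ne'; rewrite (m'min m2).
apply: Or42; have [o|o] := inc_oriented Xm Xm' mm'.
  by exists m, m'; split.
by exists m', m; split=> // v Xv /(cover v Xv)[]; [right|left].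
Qed.

Definition endless x y := oriented x y /\ forall V, ~ terminates V x y.

(** If all ascents ended, incomparable prime filters would be told apart from all others above them.
    Two prime filters [u] and [v] with equal traces, one strictly inside the other, would then bound
    a chain of prime filters comparable to everything in [X]. *)
Lemma fibre_endless p q : X p -> X q -> pi p = pi q -> p <> q ->
  exists x y, endless x y.
Proof.
move=> Xp Xq e npq; apply: contrapT => none.
have fin x y : oriented x y -> exists V, terminates V x y.
  move=> o; apply: contrapT => no; apply: none; exists x, y; split=> // V t.
  by apply: no; exists V.
have inc_fibre u v w : X u -> X v -> X w -> u [#] v -> pi u = pi w ->
    u [<=] w \/ v [<=] w -> u = w.
  move=> Xu Xv Xw uv euw hw.
  have [o|o] := inc_oriented Xu Xv uv.
    have [V t] := fin _ _ o.
    have [|//|[Vu _]] := terminates_fibre t Xu Xw _ hw euw; first by left.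
    by have [[_ []]] := terminates_above t Vu.
  have [V t] := fin _ _ o.
  have [||//|[Vu _]] := terminates_fibre t Xu Xw _ _ euw; first by right.
    by case: hw; [right|left].
  by have [_ [_ []]] := terminates_above t Vu.
have main u v : X u -> X v -> pi u = pi v -> u [<] v -> False.
  move=> Xu Xv euv uv.
  have [nuv /proper_witness[d [vd nud]]] := uv.
  have node a : X a -> pi a = pi u -> a [<=] v -> forall b, X b -> ~ a [#] b.
    move=> Xa ea av b Xb ab.
    have [e'|av'] := sub_cases av; last first.
      have eav : pi a = pi v by rewrite ea.
      have := inc_fibre _ _ _ Xa Xb Xv ab eav (or_introl av) => e'.
      by move: av'.2; rewrite e'; apply.
    subst a.
    have [e'|ub|bu|ub] := inc_cases u b.
    - by subst b; case: ab => _; apply.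
    - have [|b' [Xb' vb' eb']] := lift Xv Xb; first by rewrite ea; exact: (pi_mono ub.1).
      have := inc_fibre _ _ _ Xb Xv Xb' (inc_sym ab) (esym eb') (or_intror vb').
      by move=> e'; subst b'; case: ab.
    - by case: ab => _; apply; exact: subset_trans bu.1 nuv.
    - have := inc_fibre _ _ _ Xu Xb Xv ub euv (or_introl nuv) => e'.
      by move: uv.2; rewrite e'; apply.
  have fib a : u [<=] a -> a [<=] v -> pi a = pi u.
    by move=> ua av; apply: sub_eq; [rewrite euv; exact: pi_mono|exact: pi_mono].
  pose I a := [/\ X a, u [<=] a & a [<=] v].
  have nodeI a b : I a -> X b -> a [<=] b \/ b [<=] a.
    move=> [Xa ua av] Xb; have := node a Xa (fib a ua av) av b Xb.
    by move=> h; apply: contrapT => /not_orP[? ?]; apply: h.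
  (* Cut of the chain at [d]: [p1] is the union of the members without [d], [q1] the intersection of
     those with [d]. Nothing lies strictly between them, so [unique] forces them to be equal,
     although only [q1] contains [d]. *)
  pose p1 := [set z : B | exists2 a, I a & ~ a d /\ a z].
  pose q1 := [set z : B | forall a, I a -> a d -> a z].
  have Iu : I u by split.
  have Iv : I v by split.
  have low a : I a -> ~ a d -> a [<=] p1 by move=> Ia nad z az; exists a.
  have high a : I a -> a d -> q1 [<=] a by move=> Ia ad z; apply.
  have pp1 : prime p1.
    split.
    - by exists u => //; split=> //; exact: prime_top Xu.1.
    - by move=> [a [Xa _ _] [_ /(prime_bot Xa.1)]].
    - move=> a b; split=> [[c Ic [nc /(prime_meet (let: And3 h _ _ := Ic in h).1)[ca cb]]]|].
        by split; exists c.
      move=> [[c Ic [nc ca]] [c' Ic' [nc' cb]]].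
      have [Xc _ _] := Ic; have [Xc' _ _] := Ic'.
      have [cc|cc] := nodeI c c' Ic Xc'.
        by exists c' => //; split=> //; apply/(prime_meet Xc'.1); split=> //; exact: cc.
      by exists c => //; split=> //; apply/(prime_meet Xc.1); split=> //; exact: cc.
    - move=> a b; split=> [[c Ic [nc]]|[[c Ic [nc ca]]|[c Ic [nc cb]]]].
      + have [Xc _ _] := Ic => /(prime_join Xc.1)[ca|cb]; [left|right]; by exists c.
      + by exists c => //; split=> //; apply/(prime_join (let: And3 h _ _ := Ic in h).1); left.
      + by exists c => //; split=> //; apply/(prime_join (let: And3 h _ _ := Ic in h).1); right.
  have pq1 : prime q1.
    split.
    - by move=> a [Xa _ _] _; exact: prime_top Xa.1.
    - by move=> /(_ v Iv vd)/(prime_bot Xv.1).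
    - move=> a b; split=> [h|[ha hb] c Ic cd].
        split=> c Ic cd; have [Xc _ _] := Ic;
        by have /(prime_meet Xc.1)[] := h c Ic cd.
      have [Xc _ _] := Ic; apply/(prime_meet Xc.1).
      by split; [exact: ha|exact: hb].
    - move=> a b; split=> [h|[h|h] c Ic cd]; last 2 first.
      + by have [Xc _ _] := Ic; apply/(prime_join Xc.1); left; exact: h.
      + by have [Xc _ _] := Ic; apply/(prime_join Xc.1); right; exact: h.
      apply: contrapT => /not_orP[/existsNP[c /not_implyP[Ic /not_implyP[cd nca]]]].
      move=> /existsNP[c' /not_implyP[Ic' /not_implyP[cd' ncb]]].
      have [Xc _ _] := Ic; have [Xc' _ _] := Ic'.
      have [cc|cc] := nodeI c c' Ic Xc'.
        have /(prime_join Xc.1)[//|cb] := h c Ic cd.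
        by apply: ncb; exact: cc.
      have /(prime_join Xc'.1)[ca|//] := h c' Ic' cd'.
      by apply: nca; exact: cc.
  have Ip1 : I p1.
    have up1 := low u Iu nud; split=> //; first exact: X_up Xu pp1 up1.
    by move=> z [a [_ _ av] [_ az]]; exact: av.
  have Iq1 : I q1.
    have uq1 : u [<=] q1 by move=> z uz a [_ ua _] _; exact: ua.
    split=> //; first exact: X_up Xu pq1 uq1.
    exact: high.
  have np1d : ~ p1 d by move=> [a _ []].
  have q1d : q1 d by move=> a _.
  have [Xp1 up1 p1v] := Ip1; have [Xq1 uq1 q1v] := Iq1.
  have epq : p1 = q1.
    apply: (unique (d := d)) => //; first by rewrite !fib.
    - move=> a Xa p1a; have [q1a|aq1] := nodeI q1 a Iq1 Xa; first exact: q1a.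
      apply: contrapT => nad; apply: p1a.2; apply: low => //.
      split=> //; [exact: subset_trans up1 p1a.1|exact: subset_trans aq1 q1v].
    - move=> a Xa p1a; have [//|aq1] := nodeI q1 a Iq1 Xa.
      have Ia : I a.
        by split=> //; [exact: subset_trans up1 p1a.1|exact: subset_trans aq1 q1v].
      have [ad|nad] := pselect (a d); first exact: high.
      by case: p1a.2; exact: low.
    - move=> a Xa q1a; apply: sub_proper q1a.
      have [//|qp] := nodeI p1 q1 Ip1 Xq1; by case: np1d; exact: qp.
  by apply: np1d; rewrite epq.
have [//|pq|qp|inc] := inc_cases p q.
- exact: main pq.
- exact: main qp.
- have e' := inc_fibre _ _ _ Xp Xq Xq inc e (or_intror (fun _ => id)).
  by case: npq.
Qed.

Lemma endless_step x y : endless x y ->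
  (exists w, [/\ endless y w, x [<] w & forall u, X u -> x [<] u -> u = w \/ y [<] u]) \/
  exists x' y', [/\ endless x' y', x [<] x' /\ y [<] x', x [<] y' /\ y [<] y'
        & forall u, X u -> x [<] u -> x' [<=] u \/ y' [<=] u].
Proof.
move=> [o nt]; case: (oriented_step o).
- move=> [w [ow xw cov]]; left; exists w; split=> //; split=> // V t.
  by apply: (nt V); exact: TermLadder t.
- move=> [x' [y' [o' [h1 h2] [h3 h4] cov]]]; right; exists x', y'; split=> //; split=> // V t.
  by apply: (nt V); exact: TermBreak t.
- by move=> [s [Xs xs ys cov]]; case: (nt _ (TermNode o Xs xs ys cov)).
- by move=> top; case: (nt _ (TermTop o top)).
Qed.

(** The state is the pair of the current and the next point. A break from [x], [y] to [x'], [y']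
    takes two steps, passing through the comparable pair of [y] and [x']; therefore no two breaks
    are consecutive. *)
Lemma endless_zigzag x0 y0 : endless x0 y0 -> exists br z,
  [/\ [/\ forall i, X (z i), forall i, z i [<] z i.+2 & forall i, br i -> z i [<] z i.+1],
      forall i, ~ br i -> z i [#] z i.+1,
      forall i u, X u -> z i [<] u -> [\/ u = z i.+1, u = z i.+2 | z i.+1 [<] u],
      forall i u, X u -> z i.+1 [<] u -> z i [<] u
    & forall i, br i -> ~ br i.+1].
Proof.
move=> end0.
pose broken (s : set B * set B) := X s.1 /\ s.1 [<] s.2 /\
  exists y', [/\ endless s.2 y', s.1 [<] y' &
  forall u, X u -> s.1 [<] u -> s.2 [<=] u \/ y' [<=] u].
pose valid (st : set B * set B) := endless st.1 st.2 \/ broken st.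
have step (s : {st | valid st}) : exists t : {st | valid st},
    [/\ (sval t).1 = (sval s).2, (sval s).1 [<] (sval t).2,
      forall u, X u -> (sval s).1 [<] u ->
        [\/ u = (sval s).2, u = (sval t).2 | (sval s).2 [<] u]
    & broken (sval s) -> endless (sval t).1 (sval t).2].
  case: s => -[x y] /= vs; case: (vs) => [es|bs].
    have nb : ~ broken (x, y).
      by move=> [_ [/= [h _] _]]; case: es => -[_ _ [] ].
    case: (endless_step es).
      move=> [w [ew xw cov]]; have vt : valid (y, w) by left.
      exists (exist _ _ vt); split=> //= u Xu /(cov u Xu)[->|]; [exact: Or32|exact: Or33].
    move=> [x' [y' [e' [h1 h2] [h3 h4] cov]]].
    have vt : valid (y, x').
      right; split; first by case: es => -[].
      split=> //; exists y'; split=> // u Xu yu; apply: cov => //.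
      by case: es => -[_ _ _ o] _; exact: o.
    exists (exist _ _ vt); split=> //= u Xu /(cov u Xu)[h|h]; apply: Or33.
      exact: proper_sub h2 h.
    exact: proper_sub h4 h.
  move: bs => [/= Xx [xy [y' [e' xy' cov]]]]; have vt : valid (y, y') by left.
  exists (exist _ _ vt); split=> //= u Xu /(cov u Xu)[/sub_cases[->|]|/sub_cases[->|h]].
  - exact: Or31.
  - exact: Or33.
  - exact: Or32.
  - by apply: Or33; case: e' => -[_ _ _ o] _; exact: o.
have [nxt nxtP] := choice step.
have v0 : valid (x0, y0) by left.
pose S i : {st | valid st} := iter i nxt (exist _ _ v0).
pose z i := (sval (S i)).1.
have zS i : z i.+1 = (sval (S i)).2 by have [] := nxtP (S i).
exists (fun i => z i [<] z i.+1), z; split.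
- split=> [i|i|i //].
    by case: (svalP (S i)) => [[[]]|[]].
  by rewrite (zS i.+1); have [] := nxtP (S i).
- move=> i nbr; case: (svalP (S i)) => [[[_ _]]|[_ []]]; rewrite -zS //.
- by move=> i u Xu iu; rewrite (zS i.+1) zS; have [_ _ h _] := nxtP (S i); exact: h.
- move=> i u Xu; rewrite zS; case: (svalP (S i)) => [[[_ _ _ o]] _|[_ [h _]]]; first exact: o.
  by move=> yu; exact: strict_trans h yu.
- move=> i bi; rewrite (zS i.+1).
  case: (svalP (S i)) => [[[_ _]]|bs]; first by move: bi; rewrite zS => -[h _] [].
  have [_ _ _ /(_ bs)] := nxtP (S i); rewrite -/(S i.+1) -/(z i.+1).
  by move=> [[_ _ [h _] _] _] [].
Qed.

End Fibres.

Lemma not_ES_stacks (K : heyting -> Prop) : variety K -> subclass K KG ->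
  ~ ES_property K -> forall n, exists c, K (stack n c).
Proof.
move=> vK KKG nES n; apply: contrapT => nst; apply: nES => A B f KA KB fhom epi b.
apply: contrapT => nb.
have [p [q [pp pq e pb nqb]]] := restr_separates fhom nb.
have npq : p <> q by move=> epq; apply: nqb; rewrite -epq.
have [p' [q' [pp' pq' qp' qq' [e' npq']]]] := restr_above vK KB fhom epi pp pq e npq.
have [x [y end0]] := fibre_endless vK KKG KB fhom epi pq (conj pp' qp') (conj pq' qq') e' npq'.
have [br [z [[zX z2 zbr] zinc zcov zdown br2]]] := endless_zigzag KKG KB pq end0.
have [H [rho D]] := frame_dual (zigzag br).
apply: nst; apply: (zigzag_stacks br2 n vK D).
exact: (zigzag_variety zX z2 zbr zinc zcov zdown vK KB D).
Qed.

(** * The chain inside a zigzag *)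

Definition chain_frame : frame.
Proof.
refine (@Frame nat (fun i j => (i <= j)%N) leqnn _ _).
- by move=> j i k; exact: leq_trans.
- by move=> i j ij ji; apply/eqP; rewrite eqn_leq ij.
Defined.

(* The points [2 * i - 1] and [2 * i] of a zigzag are identified. *)
Definition pair_class (k : nat) : nat := (k.+1 %/ 2)%N.

Section ChainSubalgebra.
Context (br : nat -> Prop) (K : heyting -> Prop) (vK : variety K).
Context (H : heyting) (rho : H -> zigzag br -> Prop) (D : dual rho) (KH : K H).

Lemma pair_class_pmorphism :
  @pmorphism (zigzag br) chain_frame (fun _ => True) pair_class.
Proof.
split=> //.
- by move=> i j _ /zle_leq ij; rewrite /= /pair_class; lia.
- move=> i y _ /=; rewrite leq_eqVlt => /orP[/eqP <-|iy].
    by exists i => //; exact: Or31.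
  by exists (2 * y)%N; [apply: Or32|]; rewrite /pair_class in iy *; lia.
- by move=> y; exists (2 * y)%N; rewrite // /pair_class; lia.
Qed.

Let pt (k : nat) : set H := @dual_point _ (zigzag br) rho k.

Let up_elt k : exists x, forall i, rho x i <-> (k <= i)%N.
Proof.
apply: (dual_onto D (V := fun i : zigzag br => (k <= i)%N)).
by move=> i j /= ki /zle_leq; exact: leq_trans.
Qed.

(** The upsets [x] and [y] differ only in [k]: if [v] omits [k], the meet of [v] and [x] is below
    [y], and otherwise [x] is below the join of [v] and [y]. *)
Lemma prime_point (Q : set H) k x y : prime Q ->
  (forall i, rho x i <-> (k <= i)%N) -> (forall i, rho y i <-> (k.+1 <= i)%N) ->
  Q x -> ~ Q y -> Q = pt k.
Proof.
move=> pQ xP yP Qx nQy; apply/seteqP; split=> v.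
  move=> Qv; apply: contrapT => nvk; apply: nQy.
  have : Q (v `&` x) by apply/(prime_meet pQ).
  move=> h; apply: (prime_up pQ) h _; apply/(dual_le D) => i /(dual_meet D)[vi /xP ki].
  apply/yP; rewrite ltn_neqAle ki andbT; apply/eqP => e; apply: nvk.
  by rewrite /pt /dual_point /= e.
move=> vk; have : Q (v `|` y).
  apply: (prime_up pQ) Qx _; apply/(dual_le D) => i /xP.
  rewrite leq_eqVlt => /orP[/eqP<-|ki]; apply/(dual_join D); [by left|right].
  exact/yP.
by case/(prime_join pQ).
Qed.

Lemma point_zle k j : pt k [<=] pt j -> zle br k j.
Proof.
move=> kj; have [|x xP] := dual_onto D (V := zle br k).
  by move=> a b ka ab; exact: (@fle_trans (zigzag br)) ka ab.
by apply/xP; apply: kj; apply/xP; exact: Or31.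
Qed.

(** The chain is a proper subalgebra, so its inclusion is not an epimorphism, and some prime filter
    [r] of [C] tells [g] from [h]. Its two traces agree on the chain, where each positive position
    leaves only two candidates; exchanging [g] and [h] if necessary fixes their order. *)
Lemma ES_pair_class : ES_property K -> exists (C : heyting) (g h : H -> C) r i,
  [/\ K C, heyting_hom g, heyting_hom h,
    [/\ prime r, (0 < i)%N, restr g r = pt (2 * i).-1 & restr h r = pt (2 * i)]
  & forall q, prime q -> forall j,
     (restr g q = pt j -> exists2 j', restr h q = pt j' & pair_class j' = pair_class j) /\
     (restr h q = pt j -> exists2 j', restr g q = pt j' & pair_class j' = pair_class j)].
Proof.
move=> ES; have [Hc [rc Dc]] := frame_dual chain_frame.
have pm := pair_class_pmorphism.
have KHc : K Hc := pmorphism_variety D Dc vK pm KH.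
have exf x : exists y, forall k, rho y k <-> rc x (pair_class k).
  apply: (dual_onto D (V := fun k => rc x (pair_class k))) => i j h ij.
  by apply: (dual_up Dc h); exact: (pm_mono pm).
have [f fP] := choice exf.
have fhom : heyting_hom f.
  split=> [x y|x y|x y||]; apply: (dual_eq D) => k; rewrite fP.
  - by rewrite (dual_meet D) (dual_meet Dc) !fP.
  - by rewrite (dual_join D) (dual_join Dc) !fP.
  - rewrite (dual_imp D) (dual_imp Dc); split=> h j kj.
      by rewrite !fP; apply: h; exact: (pm_mono pm).
    by have [j' kj' <-] := pm_back pm I kj; rewrite -!fP; exact: h.
  - by split=> [/(dual_bot Dc)|/(dual_bot D)].
  - by split=> _; [exact: (dual_top D)|exact: (dual_top Dc)].
have [C [g [h [KC hg hh gfhf [V gV]]]]] : exists (C : heyting) (g h : H -> C),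
    [/\ K C, heyting_hom g, heyting_hom h, g \o f =1 h \o f & exists V, g V <> h V].
  apply: contrapT => no.
  have epi : epimorphism K f.
    move=> C g h KC hg hh e V; apply: contrapT => gV; apply: no.
    by exists C, g, h; split=> //; exists V.
  (* The upset of all points from 2 on separates the paired points 1 and 2, so it is not a value of
     [f]. *)
  have [x xP] := up_elt 2; have [c ec] := ES _ _ f KHc KH fhom epi x.
  have : rho x 2 by apply/xP.
  rewrite -ec fP => h; have : rho (f c) 1 by apply/fP.
  by rewrite ec => /xP.
have exT (i : nat) : exists y, forall k, rc y k <-> (i <= k)%N.
  apply: (dual_onto Dc (V := fun k : chain_frame => (i <= k)%N)).
  by move=> a b /= ia ab; exact: leq_trans ab.
have [T TP] := choice exT.
have fT i k : rho (f (T i)) k <-> ((2 * i).-1 <= k)%N.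
  by rewrite fP TP /pair_class; split; lia.
have types (Q : set H) i : prime Q -> Q (f (T i)) -> ~ Q (f (T i.+1)) ->
    (Q = pt (2 * i)) \/ (0 < i)%N /\ Q = pt (2 * i).-1.
  move=> pQ Qi nQi; have [u uP] := up_elt (2 * i).
  have [Qu|nQu] := pselect (Q u).
    left; apply: (prime_point pQ uP _ Qu nQi) => k; rewrite fT; split; lia.
  have i0 : (0 < i)%N.
    rewrite lt0n; apply/eqP => e; apply: nQu; apply: (prime_up pQ) Qi _.
    by apply/(dual_le D) => k _; apply/uP; rewrite e.
  right; split=> //; apply: (prime_point pQ (fT i) _ Qi nQu) => k.
  by rewrite uP; split; lia.
have compat (g1 h1 : H -> C) : heyting_hom h1 -> g1 \o f =1 h1 \o f ->
    forall q, prime q -> forall j, restr g1 q = pt j ->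
    exists2 j', restr h1 q = pt j' & pair_class j' = pair_class j.
  move=> hh1 e q pq j ej.
  have mem i : restr h1 q (f (T i)) <-> (i <= pair_class j)%N.
    have -> : restr h1 q (f (T i)) = restr g1 q (f (T i)).
      by rewrite /restr /=; have /= -> := e (T i).
    by rewrite ej /pt /dual_point /= fP TP.
  have [||->|[i0 ->]] := types (restr h1 q) (pair_class j) (restr_prime hh1 pq).
  - exact/mem.
  - by rewrite mem ltnn.
  - by exists (2 * pair_class j)%N => //; rewrite /pair_class; lia.
  - by exists (2 * pair_class j).-1 => //; rewrite /pair_class in i0 *; lia.
have comp q : prime q -> forall j,
     (restr g q = pt j -> exists2 j', restr h q = pt j' & pair_class j' = pair_class j) /\
     (restr h q = pt j -> exists2 j', restr g q = pt j' & pair_class j' = pair_class j).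
  move=> pq j; split; first exact: compat.
  by apply: compat => // x; rewrite gfhf.
have [r pr rV] : exists2 r, prime r & ~ (r (g V) <-> r (h V)).
  apply: contrapT => no; apply: gV; apply: prime_ext => r pr.
  by apply: contrapT => nr; apply: no; exists r.
have [m Vm] : exists m, rho V m.
  apply: contrapT => no; have e : V = \bot.
    apply: (dual_eq D) => k; split=> [Vk|/(dual_bot D)//]; case: no; by exists k.
  by apply: rV; rewrite e (hom_bot hg) (hom_bot hh).
(* The upset [f (T m.+3)] starts at [2 * m + 5] and lies below [V], which contains every point from
   [m.+2] on. If [r] contained its common value under [g] and [h], it could not distinguish [g V]
   from [h V]; hence [r] has a finite position on the chain. *)
have big : ~ r (g (f (T m.+3))).
  have TV : f (T m.+3) <= V.
    by apply/(dual_le D) => k /fT mk; apply: (dual_up D Vm); apply: Or32; lia.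
  move=> gT; apply: rV; split=> _.
    by apply: (prime_up pr) (hom_le hh TV); have /= <- := gfhf (T m.+3).
  exact: (prime_up pr) gT (hom_le hg TV).
have [i gi ngi] : exists2 i, r (g (f (T i))) & ~ r (g (f (T i.+1))).
  have T0 : r (g (f (T 0))).
    suff -> : f (T 0) = \top by rewrite (hom_top hg); exact: prime_top.
    by apply: (dual_eq D) => k; split=> _; [exact: (dual_top D)|apply/fT].
  apply: contrapT => no; apply: big; elim: (m.+3) => // i IH.
  by apply: contrapT => nS; apply: no; exists i.
have hi : r (h (f (T i))) by have /= <- := gfhf (T i).
have nhi : ~ r (h (f (T i.+1))) by have /= <- := gfhf (T i.+1).
have mem k : restr g r = pt k -> restr h r = pt k -> False.
  move=> eg eh; apply: rV; have -> : r (g V) = restr g r V by [].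
  by have -> : r (h V) = restr h r V by []; rewrite eg eh.
have [eg|[i0 eg]] := types (restr g r) i (restr_prime hg pr) gi ngi;
have [eh|[i0' eh]] := types (restr h r) i (restr_prime hh pr) hi nhi.
- by case: (mem _ eg eh).
- exists C, h, g, r, i; split=> // q pq j; have [] := comp q pq j; by split.
- by exists C, g, h, r, i.
- by case: (mem _ eg eh).
Qed.

End ChainSubalgebra.

(** * Prime filters located by their traces under two homomorphisms *)

Section TypedPoints.
Context (br : nat -> Prop) (brE : forall i, ~ br (2 * i)).
Context (K : heyting -> Prop) (KKG : subclass K KG).
Context (H C : heyting) (rho : H -> zigzag br -> Prop) (D : dual rho) (KC : K C).
Context (g h : H -> C) (hg : heyting_hom g) (hh : heyting_hom h).

Let pt (k : nat) : set H := @dual_point _ (zigzag br) rho k.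

Hypothesis compat : forall q, prime q -> forall j,
   (restr g q = pt j -> exists2 j', restr h q = pt j' & pair_class j' = pair_class j) /\
   (restr h q = pt j -> exists2 j', restr g q = pt j' & pair_class j' = pair_class j).
Context (r : set C) (pr : prime r) (i0 : nat) (i0_gt0 : (0 < i0)%N).
Context (rg : restr g r = pt (2 * i0).-1) (rh : restr h r = pt (2 * i0)).

Let KGC : KG C := KKG KC.

Definition typed q a b := [/\ prime q, r [<=] q, restr g q = pt a & restr h q = pt b].

Let typed_sub q q' a b a' b' : typed q a b -> typed q' a' b' -> q [<=] q' ->
  zle br a a' /\ zle br b b'.
Proof.
move=> [_ _ qa qb] [_ _ qa' qb'] qq'; split; apply: (point_zle D).
  by rewrite -/(pt a) -/(pt a') -qa -qa' => x; exact: qq'.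
by rewrite -/(pt b) -/(pt b') -qb -qb' => x; exact: qq'.
Qed.

Let see_g q a b a' : typed q a b -> zle br a a' -> exists q' b',
  [/\ q [<=] q', typed q' a' b', zle br b b' & pair_class b' = pair_class a'].
Proof.
move=> tq aa'; have [pq rq qa qb] := tq.
have [|q' [pq' qq' qa']] := restr_lift hg pq (dual_point_prime D a').
  by rewrite qa => x ax; exact: (dual_up D ax aa').
have [b' qb' e] := (compat pq' a').1 qa'; have tq' : typed q' a' b'.
  by split=> //; exact: subset_trans qq'.
by exists q', b'; split=> //; have [] := typed_sub tq tq' qq'.
Qed.

Let see_h q a b b' : typed q a b -> zle br b b' -> exists q' a',
  [/\ q [<=] q', typed q' a' b', zle br a a' & pair_class a' = pair_class b'].
Proof.
move=> tq bb'; have [pq rq qa qb] := tq.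
have [|q' [pq' qq' qb']] := restr_lift hh pq (dual_point_prime D b').
  by rewrite qb => x bx; exact: (dual_up D bx bb').
have [a' qa' e] := (compat pq' b').2 qb'; have tq' : typed q' a' b'.
  by split=> //; exact: subset_trans qq'.
by exists q', a'; split=> //; have [] := typed_sub tq tq' qq'.
Qed.

Let zleN a b : (b < a)%N -> ~ zle br a b.
Proof. by move=> ba /zle_leq; lia. Qed.

Let zleE a : ~ zle br (2 * a) (2 * a).+1.
Proof. by case=> [|//|[_ /brE]]; lia. Qed.

Let typed_inc q q' a b a' b' : typed q a b -> typed q' a' b' ->
  ~ zle br a a' \/ ~ zle br b b' -> ~ zle br a' a \/ ~ zle br b' b -> q [#] q'.
Proof.
move=> tq tq' n1 n2; split=> s.
  by have [] := typed_sub tq tq' s; case: n1.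
by have [] := typed_sub tq' tq s; case: n2.
Qed.

Let width2 q q' q'' a b a' b' a'' b'' : typed q a b -> typed q' a' b' ->
  typed q'' a'' b'' -> q [#] q' -> q [#] q'' -> q' [#] q'' -> False.
Proof.
move=> [p1 r1 _ _] [p2 r2 _ _] [p3 r3 _ _].
by apply: (@KG_width2 _ KGC _ pr).
Qed.

(** Climbing under [g] from [r], one pair at a time: the other member of the pair is ruled out as
    second coordinate, because [2 * j] and [2 * j + 1] are incomparable. *)
Let typed_D j : (i0 <= j)%N -> exists q, typed q (2 * j).-1 (2 * j).
Proof.
elim: j => [|j IH]; first by lia.
rewrite leq_eqVlt => /orP[/eqP <-|ij]; first by exists r; split.
have [q tq] := IH ij.
have [|q' [b' [_ tq' zb cb]]] := see_g tq (a' := (2 * j.+1).-1); first by apply: Or32; lia.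
exists q'; have [e|e] : b' = (2 * j.+1)%N \/ b' = (2 * j).+1%N.
- by rewrite /pair_class in cb; lia.
- by subst b'.
by rewrite e in zb; case: (zleE zb).
Qed.

Let typed_B j : (i0 < j)%N -> exists q, typed q (2 * j) (2 * j).
Proof.
case: j => // j ij; have [q tq] := typed_D ij.
have [|q' [b' [_ tq' zb cb]]] := see_g tq (a' := (2 * j.+1)%N); first by apply: Or32; lia.
exists q'; have [e|e] : b' = (2 * j.+1)%N \/ b' = (2 * j).+1%N.
- by rewrite /pair_class in cb; lia.
- by subst b'.
by rewrite e in zb; case: (zleE zb).
Qed.

(** Without the break, the types (2j-1, 2j), (2j, 2j) and some (a', 2j-1) would be pairwise
    incomparable. The last is seen from (2j-4, 2j-4), whose existence requires the bound on [j]. *)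
Lemma typed_unbroken j : (i0 + 3 <= j)%N -> br (2 * j).-1.
Proof.
move=> ij; apply: contrapT => nbr.
have nz : ~ zle br (2 * j).-1 (2 * j) by case=> [|//|[_ //]]; lia.
have nz' : ~ zle br (2 * j) (2 * j).-1 by apply: zleN; lia.
have [d td] := typed_D (j := j) ltac:(lia).
have [b tb] := typed_B (j := j) ltac:(lia).
have [b2 tb2] := typed_B (j := j - 2) ltac:(lia).
have [|e [a' [_ te _ _]]] := see_h tb2 (b' := (2 * j).-1); first by apply: Or32; lia.
apply: (width2 td tb te).
- by apply: (typed_inc td tb); left.
- by apply: (typed_inc td te); right.
- by apply: (typed_inc tb te); right.
Qed.

(** If the type is seen neither under [h] nor under [g], then (2j, 2j-1) and (2j-1, 2j) both occur
    and, with (2j-2, 2j-2), violate width two. *)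
Let typed_A j : (i0 + 3 <= j)%N -> exists q, typed q (2 * j).-1 (2 * j).-1.
Proof.
move=> ij; have [q tq] := typed_B (j := j - 2) ltac:(lia).
have [|e [a' [_ te _ ca]]] := see_h tq (b' := (2 * j).-1); first by apply: Or32; lia.
have [|d [b' [_ td _ cb]]] := see_g tq (a' := (2 * j).-1); first by apply: Or32; lia.
have [b tb] := typed_B (j := j.-1) ltac:(lia).
have [ea|ea] : a' = (2 * j).-1 \/ a' = (2 * j)%N by rewrite /pair_class in ca; lia.
  by exists e; rewrite -{1}ea.
have [eb|eb] : b' = (2 * j).-1 \/ b' = (2 * j)%N by rewrite /pair_class in cb; lia.
  by exists d; rewrite -{2}eb.
subst a' b'; exfalso; have e1 : (2 * j).-1 = (2 * j.-1).+1 by lia.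
apply: (width2 tb te td).
- by apply: (typed_inc tb te); [right; rewrite e1|left; apply: zleN; lia].
- by apply: (typed_inc tb td); [left; rewrite e1|left; apply: zleN; lia].
- by apply: (typed_inc te td); [left|right]; apply: zleN; lia.
Qed.

(** Residues 0, 1, 2 of [k] select the types of [typed_D] at [j], [typed_A] at [j.+1] and [typed_B]
    at [j]; the start [i0 + 2] is what [typed_A] needs. *)
Let t1 k := let j := (i0 + 2 + k %/ 3)%N in
  if k %% 3 == 0 then (2 * j).-1 else if k %% 3 == 1%N then (2 * j).+1 else (2 * j)%N.
Let t2 k := let j := (i0 + 2 + k %/ 3)%N in
  if k %% 3 == 1%N then (2 * j).+1 else (2 * j)%N.

Let typed_ladder k : exists q, typed q (t1 k) (t2 k).
Proof.
rewrite /t1 /t2; case: eqP => [->|h0] /=; first by apply: typed_D; lia.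
case: eqP => h1; last by apply: typed_B; lia.
have [|q tq] := @typed_A (i0 + 2 + k %/ 3).+1; first by lia.
by exists q; rewrite (_ : (2 * _).+1 = (2 * (i0 + 2 + k %/ 3).+1).-1) //; lia.
Qed.

(* The three types per level occur on a single infinite ladder
   (2j-1, 2j), (2j+1, 2j+1), (2j, 2j), (2j+1, 2j+2), ... *)
Lemma typed_zigzag (H0 : heyting) (rho0 : H0 -> zigzag (fun _ => False) -> Prop) :
  variety K -> dual rho0 -> K H0.
Proof.
move=> vK D0; have [z tz] := choice typed_ladder.
pose X u := prime u /\ r [<=] u.
have zX k : X (z k) by case: (tz k).
have zinc k : z k [#] z k.+1.
  have [[e1 e2]|[[e1 e2]|[e1 e2]]] : (k %% 3 = 0 /\ k.+1 %/ 3 = k %/ 3) \/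
    (k %% 3 = 1 /\ k.+1 %/ 3 = k %/ 3) \/ (k %% 3 = 2 /\ k.+1 %/ 3 = (k %/ 3).+1)%N by lia.
  - have e3 : (k.+1 %% 3 = 1)%N by lia.
    apply: (typed_inc (tz k) (tz k.+1)).
      by right; rewrite /t2 e1 e2 e3 /=; exact: zleE.
    by left; rewrite /t1 e1 e2 e3 /=; apply: zleN; lia.
  - have e3 : (k.+1 %% 3 = 2)%N by lia.
    apply: (typed_inc (tz k) (tz k.+1)).
      by left; rewrite /t1 e1 e2 e3 /=; apply: zleN; lia.
    by left; rewrite /t1 e1 e2 e3 /=; exact: zleE.
  - have e3 : (k.+1 %% 3 = 0)%N by lia.
    apply: (typed_inc (tz k) (tz k.+1)).
      left; rewrite /t1 e1 e2 e3 /=.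
      rewrite (_ : (2 * _).-1 = (2 * (i0 + 2 + k %/ 3)).+1); [exact: zleE|lia].
    by left; rewrite /t1 e1 e2 e3 /=; apply: zleN; lia.
have nsub k : ~ z k.+2 [<=] z k.
  have lt : (t1 k < t1 k.+2)%N \/ (t2 k < t2 k.+2)%N.
    have [e|[e|e]] : (k %% 3 = 0 \/ k %% 3 = 1 \/ k %% 3 = 2)%N by lia.
    - have e' : (k.+2 %% 3 = 2 /\ k.+2 %/ 3 = k %/ 3)%N by lia.
      by left; rewrite /t1 e e'.1 e'.2 /=; lia.
    - have e' : (k.+2 %% 3 = 0 /\ k.+2 %/ 3 = (k %/ 3).+1)%N by lia.
      by right; rewrite /t2 e e'.1 e'.2 /=; lia.
    - have e' : (k.+2 %% 3 = 1 /\ k.+2 %/ 3 = (k %/ 3).+1)%N by lia.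
      by left; rewrite /t1 e e'.1 e'.2 /=; lia.
  move=> /(typed_sub (tz k.+2) (tz k))[hz1 hz2].
  by case: lt => lt; [move: hz1|move: hz2]; exact: zleN.
(* Both are incomparable to [z k.+1], so width two makes them comparable to each other. *)
have z2 k : z k [<] z k.+2.
  have [e|//|[sub _]|inc] := inc_cases (z k) (z k.+2).
  - by case: (nsub k); rewrite -e.
  - by case: (nsub k).
  - by case: (width2 (tz k) (tz k.+1) (tz k.+2)).
have zcover k u : X u -> z k [<] u -> [\/ u = z k.+1, u = z k.+2 | z k.+1 [<] u].
  move=> Xu ku; have [yu|nyu] := pselect (z k.+1 [<] u); first exact: Or33.
  have yu : z k.+1 [#] u.
    split=> s; last by case: (zinc k) => + _; apply; exact: subset_trans ku.1 s.
    case: (sub_cases s) => // e; case: (zinc k) => + _; apply; rewrite e; exact: ku.1.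
  have yx := inc_sym (zinc k); have yw := zinc k.+1.
  have [->|uw|wu|inc] := inc_cases u (z k.+2); first exact: Or32.
  - by case: (KG_degree2 KGC pr (zX k.+1) (zX k) Xu (zX k.+2) ku uw yx yw).
  - by case: (KG_degree2 KGC pr (zX k.+1) (zX k) (zX k.+2) Xu (z2 k) wu yx yu).
  - by case: (KG_width2 KGC pr (zX k.+1) Xu (zX k.+2) yu yw inc).
have zdown k u : X u -> z k.+1 [<] u -> z k [<] u.
  move=> Xu yu; apply: contrapT => nku.
  apply: (KG_no22 KGC pr (zX k) (zX k.+2) (zX k.+1) Xu (z2 k) yu).
    move=> s; case: (sub_cases s) => // e; case: (zinc k) => _; apply; rewrite e; exact: yu.1.
  by case: (zinc k.+1).
exact: (zigzag_variety zX z2 _ (fun k _ => zinc k) zcover zdown vK KC D0).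
Qed.

End TypedPoints.

(** * Infinite sums as zigzags *)

Section OsumNotES.
Context (K : heyting -> Prop) (vK : variety K) (KKG : subclass K KG).

(** For the unbroken ladder, [typed_unbroken] would produce a break. *)
Lemma unbroken_not_ES (H : heyting) (rho : H -> zigzag (fun _ => False) -> Prop) :
  dual rho -> K H -> ~ ES_property K.
Proof.
move=> D KH ES.
have [C [g [h [r [i [KC hg hh [pr i0 rg rh] comp]]]]]] := ES_pair_class vK D KH ES.
exact: (typed_unbroken (fun _ => id) KKG D KC hg hh comp pr i0 rg rh (leqnn (i + 3))).
Qed.

Lemma zigzag_not_ES br (H : heyting) (rho : H -> zigzag br -> Prop) :
  (forall i, ~ br (2 * i)%N) -> dual rho -> K H -> ~ ES_property K.
Proof.
move=> brE D KH ES.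
have [C [g [h [r [i [KC hg hh [pr i0 rg rh] comp]]]]]] := ES_pair_class vK D KH ES.
have [H0 [rho0 D0]] := frame_dual (zigzag (fun _ => False)).
apply: (unbroken_not_ES D0) ES.
exact: (typed_zigzag brE KKG D KC hg hh comp pr i0 rg rh vK D0).
Qed.

Definition layer_size (b : bool) := if b then 4 else 2.

(** A numbering in which two points of a layer are incomparable exactly when their numbers are
    consecutive. *)
Definition layer_code b : layer_frame b -> nat :=
  if b as b return layer_frame b -> nat then
    fun g => match g with X2a2 => 0 | X2a1 => 1 | X2b1 => 2 | X2b2 => 3 end%N
  else fun g : bool => g : nat.

Lemma layer_code_le b (x y : layer_frame b) : fle x y <->
  layer_code x = layer_code y \/ ((layer_code x).+2 <= layer_code y)%N.
Proof. by case: b x y => -[] []; split=> //= h; by [left|right|case: h]. Qed.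

Lemma layer_code_lt b (x : layer_frame b) : (layer_code x < layer_size b)%N.
Proof. by case: b x => -[]. Qed.

Lemma layer_code_onto b o : (o < layer_size b)%N -> exists x : layer_frame b, layer_code x = o.
Proof.
case: b; case: o => [|[|[|[|o]]]] //= _.
- by exists X2a2.
- by exists X2a1.
- by exists X2b1.
- by exists X2b2.
- by exists false.
- by exists true.
Qed.

Fixpoint offset (c : nat -> bool) n :=
  if n is m.+1 then (offset c m + layer_size (c m))%N else 0.

Lemma offset_lt c n m : (n < m)%N -> (offset c n + layer_size (c n) <= offset c m)%N.
Proof.
elim: m => // m IH; rewrite ltnS leq_eqVlt => /orP[/eqP->//|/IH] /= h.
exact: leq_trans h (leq_addr _ _).
Qed.

Lemma offset_even c n : exists m, offset c n = (2 * m)%N.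
Proof.
elim: n => [|n [m e]] /=; first by exists 0%N.
by rewrite e; case: (c n); [exists m.+2|exists m.+1]; rewrite /layer_size; lia.
Qed.

(** The breaks: the last point of a layer lies below the first point of the next one. Layer sizes
    are even, so breaks carry odd numbers. *)
Definition layer_end c k := exists n, k.+1 = offset c n.

Definition osum_code c (x : osum_frame (fun i => layer_frame (c i))) : nat :=
  (offset c (projT1 x) + layer_code (projT2 x))%N.

Lemma osum_code_pmorphism c :
  @pmorphism _ (zigzag (layer_end c)) (fun _ => True) (@osum_code c).
Proof.
have onto y : exists x, @osum_code c x = y.
  elim: y => [|y [[n g] e]].
    have [|g e] := @layer_code_onto (c 0) 0; first by case: (c 0).
    by exists (existT _ 0 g); rewrite /osum_code /= e.
  have := layer_code_lt g; rewrite leq_eqVlt => /orP[/eqP h|h]; last first.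
    have [g' e'] := layer_code_onto h.
    by exists (existT _ n g'); rewrite /osum_code /= e' -e /osum_code /=; lia.
  have [|g' e'] := @layer_code_onto (c n.+1) 0; first by case: (c n.+1).
  by exists (existT _ n.+1 g'); rewrite /osum_code /= e' -e /osum_code /= -h; lia.
split=> //; last by move=> y; have [x] := onto y; exists x.
- move=> [n g] [m k] _ /osum_fle_inv[nm|[e h]].
    have := offset_lt c nm; have := layer_code_lt g; rewrite /osum_code /= => hg off.
    have [l|l] := leqP (offset c n + layer_code g).+2 (offset c m + layer_code k).
      exact: Or32.
    by apply: Or33; split; [lia|exists m; lia].
  subst m; move: h => /layer_code_le[h|h]; rewrite /osum_code /=.
    by rewrite h; exact: Or31.
  by apply: Or32; move: h => /=; lia.
- move=> [n g] y _; have [[m k] <-] := onto y => z; exists (existT _ m k) => //.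
  have leqz := zle_leq z; have hg := layer_code_lt g; have hk := layer_code_lt k.
  rewrite /osum_code /= in leqz z.
  have [nm|mn|e] := ltngtP n m; first exact: OsumAbove.
    by have := offset_lt c mn; lia.
  subst m; apply: OsumLayer; apply/layer_code_le.
  case: z => [e|h|[e [l el]]]; [by left; lia|by right; lia|].
  have [ln|nl|en] := ltngtP l n.
  - by have := offset_lt c ln; lia.
  - by have := offset_lt c nl; lia.
  - by subst l; lia.
Qed.

Lemma osum_not_ES c : K (osum (fun i => layer (c i))) -> ~ ES_property K.
Proof.
move=> Kos; have [ro Do] := osum_dual (fun i => layer_dual (c i)).
set br := layer_end c; have brE i : ~ br (2 * i)%N.
  by move=> [n e]; have [m e'] := offset_even c n; lia.
have [H [rho D]] := frame_dual (zigzag br).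
have KH : K H := pmorphism_variety Do D vK (osum_code_pmorphism c) Kos.
exact: zigzag_not_ES brE D KH.
Qed.

End OsumNotES.

(** * The equivalences *)

Lemma D2_or_X2_layer (I : Type) (A : I -> heyting) : (forall i, D2_or_X2 (A i)) ->
  exists c : I -> bool, A = fun i => layer (c i).
Proof.
move=> h; have ex i : exists b, A i = layer b.
  by case: (h i) => ->; [exists false|exists true].
by have [c cP] := choice ex; exists c; apply: funext.
Qed.

Lemma layer_D2_or_X2 b : D2_or_X2 (layer b).
Proof. by case: b; [right|left]. Qed.

Lemma isomorphic_refl (A : heyting) : isomorphic A A.
Proof. by exists id; split=> //; exists id. Qed.

Lemma isomorphic_variety (K : heyting -> Prop) (A B : heyting) :
  variety K -> isomorphic A B -> K A -> K B.
Proof.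
move=> vK [f [fhom [f' fK f'K]]] KA.
apply: (@relation_variety K A B (fun a b => f a = b)) => //.
- by move=> b; exists (f' b).
- by move=> a x y <- <-.
- exact: hom_bot.
- exact: hom_top.
- by move=> a x b y <- <-; exact: hom_meet.
- by move=> a x b y <- <-; exact: hom_join.
- by move=> a x b y <- <-; exact: hom_imp.
Qed.

Theorem theorem9p4 (K : heyting -> Prop)
    (varK : variety K) (subK : subclass K KG) :
  (ES_property K <->
   ~ exists (A : nat -> heyting) (B : heyting),
       [/\ forall n, D2_or_X2 (A n), K B & isomorphic B (osum A)])
  /\
  (ES_property K <->
   exists n : nat, (0 < n)%N /\
     ~ exists (A : 'I_n -> heyting) (B : heyting),
         [/\ forall i, D2_or_X2 (A i), K B
           & isomorphic B (\big[hsum/two]_(i < n) A i)]).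
Proof.
have stacks n c : K (stack n c) -> exists (A : 'I_n -> heyting) (B : heyting),
    [/\ forall i, D2_or_X2 (A i), K B & isomorphic B (\big[hsum/two]_(i < n) A i)].
  move=> Kst; exists (fun i : 'I_n => layer (c i)), (stack n c); split=> //.
  - by move=> i; exact: layer_D2_or_X2.
  - exact: isomorphic_refl.
split; split.
- move=> ES [A [B [hA KB iso]]]; have [c e] := D2_or_X2_layer hA; subst A.
  exact: osum_not_ES varK subK _ (isomorphic_variety varK iso KB) ES.
- move=> no; apply: contrapT => /(not_ES_stacks varK subK)/(stacks_osum varK)[c Kc].
  apply: no; exists (fun i => layer (c i)), (osum (fun i => layer (c i))); split=> //.
  + by move=> i; exact: layer_D2_or_X2.
  + exact: isomorphic_refl.
- move=> ES; apply: contrapT => no.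
  have [|c Kc] := @stacks_osum K varK; last exact: osum_not_ES varK subK _ Kc ES.
  move=> n.
  have [A [B [hA KB iso]]] : exists (A : 'I_n.+1 -> heyting) (B : heyting),
      [/\ forall i, D2_or_X2 (A i), K B & isomorphic B (\big[hsum/two]_(i < n.+1) A i)].
    by apply: contrapT => nA; apply: no; exists n.+1.
  have [c e] := D2_or_X2_layer hA; subst A.
  (* Only positive heights are available, so height [n] is obtained from [n.+1] by dropping a layer;
     [inord] extends the finite family to all natural numbers. *)
  exists (fun i => c (inord i)); apply: stack_pred => //.
  have -> : stack n.+1 (fun i => c (inord i)) =
      \big[hsum/two]_(i < n.+1) layer (c i).
    by apply: eq_bigr => i _; rewrite inord_val.
  exact: isomorphic_variety iso KB.
- move=> [n [_ no]]; apply: contrapT => /(not_ES_stacks varK subK)/(_ n)[c Kc].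
  by apply: no; exact: stacks Kc.
Qed.
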